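(* Let $B\subset\mathbb R^d$ be a compact convex set containing a neighbourhood of $0$, and let $Z=N$ be a Poisson cluster point process in $\mathbb R^d$ with underlying Poisson intensity $\lambda_\Pi$ and typical cluster $L_0$. Then the directed $B$-relative empty space hazard $r_B$ of $Z$ satisfies, for every Borel set $C\subset\mathbb R^d$, $$\lim_{t\to\infty}t^{1-d}r_B(t,C)=P(L_0\ne\emptyset)\,\lambda_\Pi\,\nu_B(C).$$
   Context: Distances. $B^*:=\{-x:x\in B\}$. For $x\in\mathbb R^d$ and $K\subset\mathbb R^d$, $d_B(x,K):=\inf\{t\ge 0:(x+tB)\cap K\ne\emptyset\}$ (with $\inf\emptyset=\infty$). If $0<d_B(x,K)<\infty$ and $(x+d_B(x,K)B)\cap K=\{y\}$ is a single point, then $u_B(K,x):=(x-y)/d_B(x,K)\in\partial B^*$. Empty space hazard. For a stationary random closed set $Z$ for which $u_B(Z,0)$ is a.s. well defined on $\{0<d_B(0,Z)<\infty\}$ (this holds here), put $u_B(Z,0):=u_0$ for a fixed $u_0\in\partial B^*$ if $0\in Z$ or $d_B(0,Z)=\infty$, and let $F_B(t,C):=P(d_B(0,Z)\le t,\ u_B(Z,0)\in C)$, $F_B(t):=F_B(t,\mathbb R^d)$, for $t\ge0$ and Borel $C\subset\mathbb R^d$. $F_B(\cdot,C)$ is absolutely continuous on $(0,\infty)$; $f_B(\cdot,C)$ denotes its density, taken in the right-continuous version on $[0,\infty)$ (the right-hand derivative of $F_B(\cdot,C)$). The hazard is $r_B(t,C):=f_B(t,C)/(1-F_B(t))$, with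 $a/0:=0$. The measure $\nu_B$. $\nu_B(\cdot):=d\int_{B^*}\mathbf 1\{x/d_B(x,\{0\})\in\cdot\}\,dx$, a measure concentrated on $\partial B^*$. Poisson cluster point process. $N=\bigcup_{x\in\Pi}(L_x+x)$, where $\Pi$ is a stationary Poisson process in $\mathbb R^d$ with intensity $\lambda_\Pi\in(0,\infty)$ and, given $\Pi$, the $L_x$, $x\in\Pi$, are i.i.d. finite random point sets in $\mathbb R^d$ distributed as the typical cluster $L_0$; $\gamma:=E\,\mathrm{card}\,L_0\in(0,\infty)$, so $N$ has intensity $\lambda=\lambda_\Pi\gamma$. Standing assumption: the measure $E\big[\sum_{x,y\in L_0,\,x\ne y}\mathbf 1\{x-y\in\cdot\}\big]$ on $\mathbb R^d$ is absolutely continuous with respect to Lebesgue measure. *)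

(* Defs.v *)
From HB Require Import structures.
From mathcomp Require Import all_boot all_order all_algebra.
From mathcomp Require Import all_classical all_reals all_analysis.
From mathcomp Require Import measurable_realfun.
From mathcomp Require Import ring lra.

Set Implicit Arguments.
Unset Strict Implicit.
Unset Printing Implicit Defensive.

Import Order.TTheory GRing.Theory Num.Def Num.Theory.
Import numFieldNormedType.Exports.

Local Open Scope classical_set_scope.
Local Open Scope ring_scope.

(* R^d is 'rV[R]_d, with the Borel sigma-algebra, generated by the open sets. *)
HB.instance Definition _ (R : realType) (d : nat) :=
  @isMeasurable.Build (sigma_display (@open 'rV[R]_d)) 'rV[R]_d
    <<s @open 'rV[R]_d >> (@sigma_algebra0 _ setT _)
    (@sigma_algebraC 'rV[R]_d _) (@sigma_algebra_bigcup _ setT _).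

Section lebesgue.
Context {R : realType}.

Lemma open_measurable_rV d (U : set 'rV[R]_d) : open U -> measurable U.
Proof. exact: sub_sigma_algebra. Qed.

Definition cons_rV d (p : measurableTypeR R * 'rV[R]_d) : 'rV[R]_d.+1 :=
  \row_i oapp (p.2 0) (p.1 : R) (unlift ord0 i).

Lemma cons_rVE0 d (p : measurableTypeR R * 'rV[R]_d) : cons_rV p 0 0 = p.1.
Proof. by rewrite mxE unlift_none. Qed.

Lemma cons_rVEl d (p : measurableTypeR R * 'rV[R]_d) i :
  cons_rV p 0 (lift ord0 i) = p.2 0 i.
Proof. by rewrite mxE liftK. Qed.

Definition behead_rV d (v : 'rV[R]_d.+1) : 'rV[R]_d :=
  \row_i v 0 (lift ord0 i).

Lemma cons_rVK d (p : measurableTypeR R * 'rV[R]_d) :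
  behead_rV (cons_rV p) = p.2.
Proof. by apply/rowP => i; rewrite mxE cons_rVEl. Qed.

Lemma rat_near (x e : R) : 0 < e -> exists q : rat, `|x - ratr q| < e.
Proof.
move=> e0; have xe : x - e < x + e by rewrite ltrD2l gtrN.
have [q] := rat_in_itvoo xe; rewrite in_itv/= => /andP[h1 h2]; exists q.
by rewrite ltr_norml; apply/andP; split; rewrite ?ltrBrDl ?ltrBlDl; lra.
Qed.

Lemma measurable_cons_rV d : measurable_fun [set: _] (@cons_rV d).
Proof.
apply: (@measurability _ _ _ _ setT _ (@open 'rV[R]_d.+1)) => // _ [U oU <-].
rewrite setTI.
pose I := ('rV[rat]_d.+1 * nat)%type.
pose c (q : 'rV[rat]_d.+1) : 'rV[R]_d.+1 := map_mx ratr q.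
pose b (j : I) := ball (c j.1) (j.2.+1%:R^-1 : R).
pose J := [set j : I | b j `<=` U].
have -> : @cons_rV d @^-1` U =
    \bigcup_(j in J) ((ball (c j.1 0 0) (j.2.+1%:R^-1 : R)) `*`
                      (ball (behead_rV (c j.1)) (j.2.+1%:R^-1 : R))).
  apply/seteqP; split => [[x v] Uxv|[x v] [[q k] /= Jqk [/= h1 [_ h2]]]]; last first.
    apply: Jqk; split=> [|i j]; first by rewrite /= invr_gt0.
    rewrite ord1.
    case: (unliftP ord0 j) => [j'|] ->; first by rewrite cons_rVEl; move: (h2 0 j'); rewrite mxE.
    by rewrite cons_rVE0.
  have : nbhs (cons_rV (x, v)) U by exact: open_nbhs_nbhs.
  move=> /nbhs_ballP[e /= e0 eU].
  have [k ke] : exists k : nat, k.+1%:R^-1 < e / 2.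
    have e20 : 0 < e / 2 by rewrite divr_gt0.
    exists (Num.truncn (e / 2)^-1).
    by rewrite invf_plt ?posrE ?ltr0n// truncnS_gt.
  have k0 : 0 < k.+1%:R^-1 :> R by rewrite invr_gt0.
  have /choice[q hq] : forall j, exists q : rat,
    `|cons_rV (x, v) 0 j - ratr q| < k.+1%:R^-1 by move=> j; exact: rat_near.
  have near j : `|c (\row_j q j) 0 j - cons_rV (x, v) 0 j| < k.+1%:R^-1.
    have -> : c (\row_j q j) 0 j = ratr (q j) by rewrite !mxE.
    by rewrite distrC.
  exists (\row_j q j, k); last first.
    split => /=; first by have := near 0; rewrite cons_rVE0.
    split=> // i j; rewrite ord1 mxE -[v]/((x, v).2) -(cons_rVEl (x, v)).
    exact: near.
  move=> y /= [_ hy]; apply: eU; split=> // i j; rewrite ord1.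
  have h1 := near j; have := hy 0 j.
  rewrite /ball/= => h2.
  rewrite -[X in `|X|](subrKA (c (\row_j q j) 0 j)).
  rewrite (le_lt_trans (ler_normD _ _))// (splitr e) ltrD//.
    by rewrite distrC (lt_trans h1).
  exact: lt_trans ke.
rewrite bigcup_mkcond; apply: countable_bigcupT_measurable => [|j].
  exact: countableP.
case: ifPn => // _; apply: measurableX.
  by rewrite /= ball_itv; exact: measurable_itv.
by apply: open_measurable_rV; exact: ball_open.
Qed.

Lemma measurable_behead_rV d : measurable_fun [set: _] (@behead_rV d).
Proof.
apply: (@measurability _ _ _ _ setT _ (@open 'rV[R]_d)) => // _ [U oU <-].
rewrite setTI; apply: open_measurable_rV; apply: open_comp => // v _.
move=> W /nbhs_ballP[e /= e0 eW]; apply/nbhs_ballP; exists e => //= w [_ vw].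
by apply: eW; split=> // i j; rewrite !mxE; exact: vw.
Qed.

Lemma measurable_head_rV d :
  measurable_fun [set: 'rV[R]_d.+1] (fun v => v 0 0 : measurableTypeR R).
Proof.
apply: (@measurability _ _ _ (measurableTypeR R) setT _ _
  (RGenOpens.measurableE R)) => _ [_ [x [y ->]] <-].
rewrite setTI; apply: open_measurable_rV.
by apply: open_comp; [move=> v _; exact: coord_continuous|exact: interval_open].
Qed.

Section cons.
Context d (m : {sigma_finite_measure set 'rV[R]_d -> \bar R}).

Definition lebesgue_cons : set 'rV[R]_d.+1 -> \bar R :=
  pushforward (lebesgue_measure \x m)%E (@cons_rV d).

Let preimage_cons_rV A :
  measurable A -> measurable (@cons_rV d @^-1` A).
Proof.
by move=> mA; rewrite -[X in measurable X]setTI; exact: measurable_cons_rV.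
Qed.

Let lebesgue_cons0 : lebesgue_cons set0 = 0%E.
Proof. by rewrite /lebesgue_cons /pushforward preimage_set0 measure0. Qed.

Let lebesgue_cons_ge0 A : (0 <= lebesgue_cons A)%E.
Proof. by rewrite /lebesgue_cons /pushforward; exact: measure_ge0. Qed.

Let lebesgue_cons_sigma_additive : semi_sigma_additive lebesgue_cons.
Proof.
move=> F mF tF mUF; rewrite /lebesgue_cons /pushforward preimage_bigcup.
apply: measure_semi_sigma_additive => [n||].
- exact: preimage_cons_rV.
- apply/trivIsetP => /= i j _ _ ij; rewrite -preimage_setI.
  by move/trivIsetP : tF => /(_ _ _ _ _ ij) ->//; rewrite preimage_set0.
- by rewrite -preimage_bigcup; exact: preimage_cons_rV.
Qed.

HB.instance Definition _ := isMeasure.Build _ _ _ lebesgue_cons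
  lebesgue_cons0 lebesgue_cons_ge0 lebesgue_cons_sigma_additive.

Let lebesgue_cons_sigma_finite : sigma_finite setT lebesgue_cons.
Proof.
have /sigma_finiteP[F [FT ndF Foo]] := sigma_finiteT (@lebesgue_measure R).
have /sigma_finiteP[G [GT ndG Goo]] := sigma_finiteT m.
exists (fun n => (fun v : 'rV[R]_d.+1 => v 0 0) @^-1` F n `&` @behead_rV d @^-1` G n).
  apply/esym; rewrite -subTset => v _.
  have [i _ Fi] : (\bigcup_k F k) (v 0 0) by rewrite -FT.
  have [j _ Gj] : (\bigcup_k G k) (behead_rV v) by rewrite -GT.
  exists (maxn i j) => //; split.
    by have /subsetPset := ndF _ _ (leq_maxl i j); exact.
  by have /subsetPset := ndG _ _ (leq_maxr i j); exact.
move=> n; have [mF Fn] := Foo n; have [mG Gn] := Goo n; split.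
  apply: measurableI; rewrite -[X in measurable X]setTI.
    exact: measurable_head_rV.
  exact: measurable_behead_rV.
rewrite /lebesgue_cons /pushforward [X in (_ X < _)%E](_ : _ = F n `*` G n).
  by rewrite product_measure1E// lte_mul_pinfty// ge0_fin_numE.
by apply/funext => -[x v] /=; rewrite /preimage/= cons_rVK cons_rVE0.
Qed.

HB.instance Definition _ := Measure_isSigmaFinite.Build _ _ _ lebesgue_cons
  lebesgue_cons_sigma_finite.

End cons.

(* d-fold product of the one-dimensional Lebesgue measure *)
Fixpoint lebesgue_rV d : {sigma_finite_measure set 'rV[R]_d -> \bar R} :=
  if d is d'.+1 then lebesgue_cons (lebesgue_rV d') else \d_(0 : 'rV[R]_0).

End lebesgue.

Section relative_distance.
Context {R : realType} {d : nat}.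
Local Notation V := 'rV[R]_d.
Implicit Types (B K C : set V) (x : V).

Definition reflection B : set V := [set - x | x in B].

Definition boundary B : set V := closure B `\` B°.

Definition rel_dist B x K : \bar R :=
  ereal_inf [set t%:E | t in
    [set t : R | 0 <= t /\ [set x + t *: b | b in B] `&` K !=set0]].

Definition contact_points B x K : set V :=
  [set x + fine (rel_dist B x K) *: b | b in B] `&` K.

(* The default u0 is used when d_B is 0 or infinite, and also when the contact
   point is not unique; for the cluster processes below, the latter happens
   with probability 0. *)
Definition rel_dir (u0 : V) B K x : V :=
  if `[< (0 < rel_dist B x K < +oo)%E /\
         exists y, contact_points B x K = [set y] >]
  then (fine (rel_dist B x K))^-1 *: (x - xget 0 (contact_points B x K))
  else u0.

Definition nu B C : \bar R :=
  (d%:R%:E * \int[@lebesgue_rV R d]_(x in reflection B)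
    (\1_C ((fine (rel_dist B x [set 0]))^-1 *: x))%:E)%E.

End relative_distance.

Section probability.
Context {disp : measure_display} {T : measurableType disp} {R : realType}.
Variable P : probability T R.

Definition mutually_independent (I : choiceType) (F : I -> set_system T) :=
  forall (J : seq I) (E : I -> set T), uniq J ->
    (forall i, i \in J -> F i (E i)) ->
    P (\bigcap_(i in [set` J]) E i) = (\prod_(i <- J) P (E i))%E.

Context {d : nat}.
Local Notation V := 'rV[R]_d.

Definition count_events : set_system (set V) :=
  [set [set phi | counting (phi `&` A) = k%:R%:E :> \bar R] |
    A in (measurable : set_system V) & k in [set: nat]].

(* The space of point configurations, with the sigma-algebra that makes every
   map phi |-> card (phi `&` A), A Borel, measurable. *)
Definition config := g_sigma_algebraType count_events.

Definition random_points (X : T -> set V) :=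
  measurable_fun [set: T] (X : T -> config).

Definition locally_finite (phi : set V) :=
  forall A : set V, bounded_set A -> finite_set (phi `&` A).

Definition point_process (X : T -> set V) :=
  random_points X /\ forall w, locally_finite (X w).

(* The second argument of poisson_prob is not used by the library. *)
Definition stationary_poisson_process (lambda : R) (Pi : T -> set V) :=
  [/\ point_process Pi,
      forall A : set V, measurable A -> (lebesgue_rV d A < +oo)%E ->
        forall k : nat,
          P [set w | counting (Pi w `&` A) = k%:R%:E :> \bar R] =
          poisson_prob (lambda * fine (lebesgue_rV d A)) 0 [set k] &
      forall (n : nat) (A : 'I_n -> set V),
        (forall i, measurable (A i)) -> trivIset [set: 'I_n] A ->
        mutually_independent (fun i =>
          g_sigma_algebra_preimage (fun w => counting (Pi w `&` A i) : \bar R))].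

Definition finite_random_points (X : T -> set V) :=
  random_points X /\ forall w, finite_set (X w).

(* "Given Pi, the L_x, x \in Pi, are i.i.d. copies of L0": for some measurable
   enumeration (xi_n) of Pi, the clusters L_(xi_n) are i.i.d. copies of L0 and
   independent of (xi_n). *)
Definition iid_clusters (Pi : T -> set V) (L : T -> V -> set V)
    (L0 : T -> set V) :=
  exists xi : nat -> T -> V,
    let Lxi n w := L w (xi n w) in
    [/\ (forall n, measurable_fun [set: T] (xi n)) /\
        {ae P, forall w, injective (xi ^~ w) /\ Pi w = range (xi ^~ w)},
        forall n, finite_random_points (Lxi n),
        forall n (E : set config), measurable E ->
          P (Lxi n @^-1` E) = P (L0 @^-1` E) &
        mutually_independent (fun i : option nat =>
          if i is Some n
          then g_sigma_algebra_preimage (Lxi n : T -> config)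
          else <<s \bigcup_n g_sigma_algebra_preimage (xi n) >>)].

Definition mean_cluster_size (L0 : T -> set V) : \bar R :=
  (\int[P]_w counting (L0 w))%E.

Definition poisson_cluster_process (lambda : R) (Pi : T -> set V)
    (L : T -> V -> set V) (L0 N : T -> set V) :=
  [/\ 0 < lambda /\ stationary_poisson_process lambda Pi,
      finite_random_points L0,
      (0 < mean_cluster_size L0 < +oo)%E,
      iid_clusters Pi L L0 &
      point_process N /\
      {ae P, forall w, N w = \bigcup_(x in Pi w) [set y + x | y in L w x]}].

Definition difference_measure (L0 : T -> set V) (A : set V) : \bar R :=
  (\int[P]_w \esum_(p in [set p : V * V | [/\ L0 w p.1, L0 w p.2 & p.1 != p.2]])
    (\1_A (p.1 - p.2))%:E)%E.

Section hazard.
Variables (Z : T -> set V) (B : set V) (u0 : V).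

Definition contact_distribution (t : R) (C : set V) : R :=
  fine (P [set w | (rel_dist B 0 (Z w) <= t%:E)%E /\ C (rel_dir u0 B (Z w) 0)]).

(* The density of t |-> contact_distribution t C in its right-continuous
   version, i.e., the right-hand derivative of this function. *)
Definition contact_density (t : R) (C : set V) : R :=
  lim (h^-1 * (contact_distribution (t + h) C - contact_distribution t C)
    @[h --> 0^'+]).

(* The convention a / 0 = 0 is that of the library. *)
Definition hazard (t : R) (C : set V) : R :=
  contact_density t C / (1 - contact_distribution t [set: V]).

End hazard.
End probability.

(* Main.v *)
Require Import Defs.
From HB Require Import structures.
From mathcomp Require Import all_boot all_order all_algebra.
From mathcomp Require Import finmap.
From mathcomp Require Import all_classical all_reals all_analysis measurable_realfun.
From mathcomp Require Import ring lra.

Set Implicit Arguments.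
Unset Strict Implicit.
Unset Printing Implicit Defensive.

Import Order.TTheory GRing.Theory Num.Def Num.Theory.
Import numFieldNormedType.Exports.
Import HBNNSimple.

Local Open Scope classical_set_scope.
Local Open Scope ring_scope.

(* Each cluster carries a position x and a shape K. Let H t C be the set of pairs
   (x, K) such that the cluster x + K is hit by t B, with contact direction in
   C; it has finite mass G t C for the intensity measure of the marked Poisson
   process. The probability that N misses t B is exp (- G t setT), and up to
   the event that two clusters are first hit during ]t, t + h], whose probability
   is o(h), the increment of the contact distribution is
   exp (- G t setT) (1 - exp (- (G (t + h) C - G t C))).
   Hence the hazard is the right derivative of G in t.
   For fixed K, up to null sets (no ties, as the difference measure of L0 is
   absolutely continuous), the set of x with (x, K) in H t C is a disjoint union
   of translates of the parts of gauge at most t of star-shaped sets contained in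
   the cone of the directions in C. This makes G a concave function of t ^ d,
   so that its right derivative is d t ^ (d - 1) times a monotone slope,
   whose limit is that of G t C / t ^ d. The latter is found by bounding it
   from below for C and for its complement, as the star-shaped sets cover the cone
   when K is nonempty, and from above for their union, as the hit positions
   lie in (t + r) B for some r depending on K only. *)

(** * Lebesgue measure on R^d *)

(** All probabilities come from one identity, [marked_poisson_laplace]: the product over all
    clusters of the factors 1 - q (x, K) has mean exp (- lambda I), where I is the integral of q.
    For q an indicator, the product says that no cluster lies in a given set; this yields void
    probabilities and, for a union of two sets, the main term of the increment. The obstacle is the
    error term, the probability that no cluster is hit at time t and at least two are hit at time t
    + h. It is reached by the same identity, without second moments of the process: give q the value
    1 on clusters hit at t and 1/2 on those hit only at t + h. If none is hit at t and k are hit at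
    t + h, the product is 2 ^ (- k), and 1 + [k = 0] - 2 . 2 ^ (- k) is 0 for k <= 1 and at least
    1/2 for k >= 2. Its mean is the square of exp (- G t / 2) - exp (- G (t + h) / 2), which is
    quadratic in h. Concavity in t ^ d is used twice: it makes the right derivative exist at every t
    > 0, and it transfers the limit of G t C / t ^ d to the derivative, which growth of G alone
    would not do. *)

Section rV_measurability.
Context {R : realType}.

Lemma measurable_coord_rV d (i : 'I_d) :
  measurable_fun [set: 'rV[R]_d] (fun v => v 0 i : measurableTypeR R).
Proof.
apply: (@measurability _ _ _ (measurableTypeR R) setT _ _
  (RGenOpens.measurableE R)) => _ [_ [x [y ->]] <-].
rewrite setTI; apply: open_measurable_rV.
by apply: open_comp; [move=> v _; exact: coord_continuous|exact: interval_open].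
Qed.

(** Since [cons_rV] is measurable from the product sigma-algebra, induction on d recovers a vector
    function from its coordinates. Vector operations then reduce to real ones. *)
Lemma measurable_fun_rV d disp (X : measurableType disp) (f : X -> 'rV[R]_d) :
  (forall i, measurable_fun [set: X] (fun x => f x 0 i : measurableTypeR R)) ->
  measurable_fun [set: X] f.
Proof.
elim: d f => [|d IH] f mf.
  rewrite (_ : f = cst 0); first exact: measurable_cst.
  by apply/funext => x; exact: thinmx0.
rewrite (_ : f = @cons_rV R d \o
    (fun x => (f x 0 0 : measurableTypeR R, behead_rV (f x)))).
  apply: measurableT_comp; first exact: measurable_cons_rV.
  apply: measurable_fun_pair => /=; first exact: mf.
  apply: IH => i; rewrite (_ : (fun x => _) = fun x => f x 0 (lift ord0 i)).
    exact: mf.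
  by apply/funext => x; rewrite mxE.
apply/funext => x; apply/rowP => j /=.
case: (unliftP ord0 j) => [k|] ->; last by rewrite cons_rVE0.
by rewrite cons_rVEl/= mxE.
Qed.

Lemma measurable_fun_coord d disp (X : measurableType disp)
    (f : X -> 'rV[R]_d) (i : 'I_d) : measurable_fun [set: X] f ->
  measurable_fun [set: X] (fun x => f x 0 i : measurableTypeR R).
Proof. by move=> mf; exact: measurableT_comp (measurable_coord_rV i) mf. Qed.

Lemma measurable_funD_rV d disp (X : measurableType disp)
    (f g : X -> 'rV[R]_d) : measurable_fun [set: X] f ->
  measurable_fun [set: X] g -> measurable_fun [set: X] (fun x => f x + g x).
Proof.
move=> mf mg; apply: measurable_fun_rV => i.
under eq_fun do rewrite mxE.
by apply: (@measurable_funD _ _ R); exact: measurable_fun_coord.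
Qed.

Lemma measurable_funZ_rV d disp (X : measurableType disp)
    (r : X -> R) (f : X -> 'rV[R]_d) :
  measurable_fun [set: X] (r : X -> measurableTypeR R) ->
  measurable_fun [set: X] f -> measurable_fun [set: X] (fun x => r x *: f x).
Proof.
move=> mr mf; apply: measurable_fun_rV => i.
under eq_fun do rewrite mxE.
by apply: (@measurable_funM _ _ R) => //; exact: measurable_fun_coord.
Qed.

Lemma measurable_funN_rV d disp (X : measurableType disp)
    (f : X -> 'rV[R]_d) : measurable_fun [set: X] f ->
  measurable_fun [set: X] (fun x => - f x).
Proof.
move=> mf; under eq_fun do rewrite -scaleN1r.
by apply: measurable_funZ_rV => //; exact: measurable_cst.
Qed.

Lemma measurable_funB_rV d disp (X : measurableType disp)
    (f g : X -> 'rV[R]_d) : measurable_fun [set: X] f ->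
  measurable_fun [set: X] g -> measurable_fun [set: X] (fun x => f x - g x).
Proof.
by move=> mf mg; exact: measurable_funD_rV mf (measurable_funN_rV mg).
Qed.

Lemma continuous_measurable_rV d (h : 'rV[R]_d -> R) : continuous h ->
  measurable_fun [set: 'rV[R]_d] (h : _ -> measurableTypeR R).
Proof.
move=> ch; apply: (@measurability _ _ _ (measurableTypeR R) setT _ _
  (RGenOpens.measurableE R)) => _ [_ [x [y ->]] <-].
rewrite setTI; apply: open_measurable_rV.
by apply: open_comp; [move=> v _; exact: ch|exact: interval_open].
Qed.

Lemma closed_measurable_rV d (A : set 'rV[R]_d) : closed A -> measurable A.
Proof.
move=> cA; rewrite -[A]setCK; apply: measurableC.
by apply: open_measurable_rV; exact: closed_openC.
Qed.

Lemma measurable_rV1 d (x : 'rV[R]_d) : measurable [set x].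
Proof. by apply: closed_measurable_rV; exact: accessible_closed_set1 (hausdorff_accessible (@norm_hausdorff _ _)) x. Qed.

End rV_measurability.

(** The pushforward bundled as a measure, with the measurability of [f] as an explicit argument. *)
Definition push_measure d1 d2 (T1 : measurableType d1) (T2 : measurableType d2)
    (R : realFieldType) (m : {measure set T1 -> \bar R}) (f : T1 -> T2)
    (mf : measurable_fun [set: T1] f) : {measure set T2 -> \bar R} :=
  measure_function_pushforward__canonical__measure_function_Measure m mf.

Section lebesgue_affine.
Context {R : realType}.
Local Open Scope ereal_scope.

Lemma measurable_affine1 (r b : R) : measurable_fun [set: measurableTypeR R]
  ((fun x : measurableTypeR R => r * x + b)%R : _ -> measurableTypeR R).
Proof. by apply: (@measurable_funD _ _ R) => //; exact: measurable_funM. Qed.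

(** By uniqueness of Lebesgue measure it is enough to compare on half-open intervals. For r < 0 the
    preimage is half-open at the other end, with the same length. *)
Lemma lebesgue_measure_affine (r b : R) (A : set (measurableTypeR R)) :
  (r != 0)%R -> measurable A ->
  lebesgue_measure ((fun x => r * x + b)%R @^-1` A) =
    (`|r|^-1)%:E * lebesgue_measure A.
Proof.
move=> r0 mA.
have mf := measurable_affine1 r b.
have r0' : (0 < `|r|)%R by rewrite normr_gt0.
pose f : measurableTypeR R -> measurableTypeR R := (fun x => r * x + b)%R.
have sr : (0 <= `|r|)%R by [].
pose mu : {measure set (measurableTypeR R) -> \bar R} :=
  mscale (NngNum sr) (push_measure lebesgue_measure mf).
suff -> : lebesgue_measure A = mu A.
  by rewrite /mu /mscale/= /pushforward muleA -EFinM mulVf ?mul1e ?gt_eqF.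
apply: lebesgue_measure_unique mA => _ [[x y] _ <-].
have muE : mu `]x, y]%classic =
    `|r|%:E * lebesgue_measure (f @^-1` `]x, y]%classic) by [].
rewrite [LHS]lebesgue_measure_itv/= [RHS]muE.
have [rpos|rneg|rz] := ltrgt0P r; last by rewrite rz eqxx in r0.
- have -> : f @^-1` `]x, y]%classic = `]((x - b) / r)%R, ((y - b) / r)%R]%classic.
    apply/seteqP; split => z /=; rewrite !in_itv/= /f ltr_pdivrMr// ler_pdivlMr//;
      by rewrite ltrBlDr lerBrDr mulrC.
  rewrite lebesgue_measure_itv/= !lte_fin ltr_pM2r ?invr_gt0// ltrD2r.
  case: ifPn => _; last by rewrite mule0.
  by rewrite -!EFinB -EFinM; congr EFin; field; rewrite gt_eqF.
- have -> : f @^-1` `]x, y]%classic = `[((y - b) / r)%R, ((x - b) / r)%R[%classic.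
    apply/seteqP; split => z /=; rewrite !in_itv/= /f ltr_ndivlMr// ler_ndivrMr//;
      by rewrite ltrBlDr lerBrDr mulrC andbC.
  rewrite lebesgue_measure_itv/= !lte_fin ltr_nM2r ?invr_lt0// ltrD2r.
  case: ifPn => _; last by rewrite mule0.
  by rewrite -!EFinB -EFinM; congr EFin; field; rewrite lt_eqF.
Qed.

Lemma lebesgue_rVS d (A : set 'rV[R]_d.+1) : measurable A ->
  lebesgue_rV d.+1 A = \int[lebesgue_measure]_x
    lebesgue_rV d [set v | A (cons_rV (x, v))].
Proof.
move=> mA; apply: eq_integral => x _ /=; congr (lebesgue_rV d _).
by apply/seteqP; split => v /= => [/xsectionP//|Av]; exact/xsectionP.
Qed.

Lemma measurable_slice d (A : set 'rV[R]_d.+1) x : measurable A ->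
  measurable [set v | A (@cons_rV R d (x, v))].
Proof.
move=> mA; rewrite -[X in measurable X]setTI.
exact: (measurableT_comp (@measurable_cons_rV R d)).
Qed.

Lemma measurable_fun_slice d (A : set 'rV[R]_d.+1) : measurable A ->
  measurable_fun [set: measurableTypeR R]
    (fun x => lebesgue_rV d [set v | A (cons_rV (x, v))]).
Proof.
move=> mA.
have mA' : measurable (@cons_rV R d @^-1` A).
  by rewrite -[X in measurable X]setTI; exact: measurable_cons_rV.
have := measurable_fun_xsection (lebesgue_rV d) mA'.
apply: eq_measurable_fun => x _ /=; congr (lebesgue_rV d _).
by apply/seteqP; split => v /= => [/xsectionP//|Av]; exact/xsectionP.
Qed.

Lemma measurable_affine_rV d (r : R) (b : 'rV[R]_d) :
  measurable_fun [set: 'rV[R]_d] (fun v => r *: v + b)%R.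
Proof.
apply: measurable_funD_rV; last exact: measurable_cst.
by apply: measurable_funZ_rV => //; exact: measurable_cst.
Qed.

Lemma measurable_preimage_affine d (r : R) (b : 'rV[R]_d) A : measurable A ->
  measurable ((fun v : 'rV[R]_d => r *: v + b)%R @^-1` A).
Proof.
by move=> mA; rewrite -[X in measurable X]setTI; exact: measurable_affine_rV.
Qed.

(** Slicing along the first coordinate: the induction hypothesis scales each slice by |r| ^ - d, and
    the substitution in the outer integral gives one more factor |r| ^ -1. *)
Lemma lebesgue_rV_affine d (r : R) (b : 'rV[R]_d) (A : set 'rV[R]_d) :
  (r != 0)%R -> measurable A ->
  lebesgue_rV d ((fun v => r *: v + b)%R @^-1` A) =
    (`|r| ^- d)%:E * lebesgue_rV d A.
Proof.
move=> r0; elim: d b A => [|d IH] b A mA.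
  rewrite expr0 invr1 mul1e; congr (lebesgue_rV 0 _).
  by apply/funext => v; rewrite /preimage/= (thinmx0 v) (thinmx0 (_ + _)%R).
rewrite !lebesgue_rVS//; last exact: measurable_preimage_affine.
pose h x := lebesgue_rV d [set v | A (cons_rV (x, v))].
have mh : measurable_fun [set: measurableTypeR R] h by exact: measurable_fun_slice.
transitivity (\int[lebesgue_measure]_x ((`|r| ^- d)%:E * h (r * x + b 0 0)%R)).
  apply: eq_integral => x _; rewrite -(IH (behead_rV b)); last exact: measurable_slice.
  congr (lebesgue_rV d _); apply/funext => v; rewrite /preimage/=; congr (A _).
  apply/rowP => j; rewrite !mxE; case: (unliftP ord0 j) => [k|] -> /=.
    by rewrite ?unlift_none ?liftK/= !mxE.
  by rewrite ?unlift_none.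
have mha : measurable_fun [set: measurableTypeR R]
    (fun x : measurableTypeR R => h (r * x + b 0 0)%R).
  exact: (measurableT_comp mh (measurable_affine1 _ _)).
rewrite ge0_integralZl//.
rewrite exprS invfM mulrC EFinM -muleA; congr (_ * _).
have -> : \int[lebesgue_measure]_x h (r * x + b 0 0)%R =
    \int[push_measure lebesgue_measure (measurable_affine1 r (b 0 0)%R)]_x h x.
  by rewrite ge0_integral_pushforward//; exact: measurable_affine1.
have sr : (0 <= `|r|^-1)%R by rewrite invr_ge0.
rewrite -(ge0_integral_mscale _ _ (NngNum sr))//.
apply: eq_measure_integral => D mD _.
exact: lebesgue_measure_affine.
Qed.

End lebesgue_affine.

Section lebesgue_bounded.
Context {R : realType}.
Local Open Scope ereal_scope.

Definition box d (M : R) : set 'rV[R]_d := [set v | forall i, `|v 0 i|%R <= M]%R.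

Lemma measurable_box d M : measurable (@box d M).
Proof.
rewrite (_ : box M = \bigcap_(i in [set: 'I_d])
   ((fun v : 'rV[R]_d => v 0%R i : measurableTypeR R) @^-1` `[(- M)%R, M]%classic)).
  apply: fin_bigcap_measurable => // i _.
  rewrite -[X in measurable X]setTI; exact: measurable_coord_rV.
apply/seteqP; split => v /= H i; first by move=> _; rewrite /= in_itv/= -ler_norml.
by have := H i Logic.I; rewrite /= in_itv/= -ler_norml.
Qed.

Lemma lebesgue_box d M : lebesgue_rV d (box M) < +oo.
Proof.
elim: d => [|d IH].
  by rewrite /= /dirac (le_lt_trans _ (ltry 1))// lee_fin indicE; case: (_ \in _).
have -> : lebesgue_rV d.+1 (box M) =
    (lebesgue_measure \x lebesgue_rV d) (`[(- M)%R, M]%classic `*` box M).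
  rewrite /= /lebesgue_cons /pushforward; congr (product_measure1 _ _ _).
  apply/seteqP; split => [[x v] /= H|[x v] /= [xM vM] i].
    split; first by have := H ord0; rewrite cons_rVE0 /= in_itv/= -ler_norml.
    by move=> i; have := H (lift ord0 i); rewrite cons_rVEl.
  case: (unliftP ord0 i) => [k|] ->; first by rewrite cons_rVEl; exact: vM.
  by rewrite cons_rVE0; move: xM; rewrite /= in_itv/= -ler_norml.
rewrite product_measure1E//; last exact: measurable_box.
rewrite lte_mul_pinfty ?measure_ge0//.
  by rewrite ge0_fin_numE ?measure_ge0// [X in X < _]lebesgue_measure_itv/=; case: ifPn => // _; rewrite ltry.
Qed.

Lemma lebesgue_bounded d (A : set 'rV[R]_d) : measurable A -> bounded_set A ->
  lebesgue_rV d A < +oo.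
Proof.
move=> mA [M [Mreal HM]]; apply: le_lt_trans (lebesgue_box d (M + 1)).
apply: le_measure; rewrite ?inE//; first exact: measurable_box.
move=> v Av i; have M1 : (M < M + 1)%R by rewrite ltrDl.
apply: le_trans (HM _ M1 _ Av).
rewrite [leRHS]/normr/= mx_normE.
exact: (le_bigmax _ (fun ij : 'I_1 * 'I_d => `|v ij.1 ij.2|%:nng%R) (0%R, i)).
Qed.

End lebesgue_bounded.

(** * The gauge of a convex body *)

(** The Minkowski functional of B, obtained from [rel_dist] so that contact distances are expressed
    by it directly. *)
Definition gauge {R : realType} {d : nat} (B : set 'rV[R]_d) (y : 'rV[R]_d) : R :=
  fine (rel_dist B 0 [set y]).

Lemma seq_min (R : realType) (I : eqType) (s : seq I) (f : I -> R) :
  s != [::] -> exists2 y, y \in s & forall z, z \in s -> f y <= f z.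
Proof.
elim: s => // a s IH _; have [->|/IH[y ys Hy]] := eqVneq s [::].
  by exists a => [|z]; rewrite ?mem_seq1// => /eqP->.
have [ay|/ltW ya] := leP (f a) (f y).
  exists a; first exact: mem_head.
  by move=> z; rewrite inE => /predU1P[->//|/Hy]; exact: le_trans.
exists y; first by rewrite inE ys orbT.
by move=> z; rewrite inE => /predU1P[->//|/Hy].
Qed.

Section gauge_theory.
Context {R : realType} {d : nat} (B : set 'rV[R]_d).
Hypotheses (Bcompact : compact B) (Bconvex : convex_set B)
  (B0 : nbhs (0 : 'rV[R]_d) B).
Local Notation V := 'rV[R]_d.
Local Notation g := (gauge B).

Lemma convexE x y (t : R) : 0 <= t <= 1 -> B x -> B y ->
  B (t *: x + (1 - t) *: y).
Proof.
move=> t01 Bx By.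
have ti : Itv.spec (@Itv.num_sem R) (Itv.Real `[0%Z, 1%Z]) t.
  by rewrite /Itv.spec/= /Itv.num_sem/= in_itv/= t01 realE; case/andP: t01 => ->.
have := @Bconvex x y (Itv.mk ti); rewrite !inE => /(_ Bx By).
by [].
Qed.

Lemma compact_contains0 : B 0. Proof. exact: nbhs_singleton. Qed.

Lemma scale_compact x (t : R) : 0 <= t <= 1 -> B x -> B (t *: x).
Proof.
by move=> t01 Bx; have := convexE t01 Bx compact_contains0; rewrite scaler0 addr0.
Qed.

Let S y := [set t : R | 0 <= t /\ [set 0 + t *: b | b in B] `&` [set y] !=set0].

Let SE y (t : R) : 0 < t -> S y t <-> B (t^-1 *: y).
Proof.
move=> t0; have tn0 : t != 0 by rewrite gt_eqF.
split=> [[_ [z [[b Bb <-] /= <-]]]|Bty].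
  by rewrite add0r scalerA mulVf// scale1r.
split; first exact: ltW.
exists y; split => //; exists (t^-1 *: y) => //.
by rewrite add0r scalerA divff// scale1r.
Qed.

Let S_mono y (s t : R) : 0 < t -> s <= t -> S y s -> S y t.
Proof.
move=> t0 st [s0 [z [[b Bb <-] /= <-]]]; rewrite SE// add0r scalerA.
apply: scale_compact => //.
by rewrite mulr_ge0 ?invr_ge0 ?(ltW t0)//= mulrC ler_pdivrMr// mul1r.
Qed.

Lemma ball_subset_body : exists2 r : R, 0 < r & forall v : V, `|v| < r -> B v.
Proof.
have [r /= r0 rB] := (nbhs_ballP _ _).1 B0; exists r => // v vr; apply: rB.
by rewrite -ball_normE/= sub0r normrN.
Qed.

Lemma body_bounded : exists2 M : R, 0 < M & forall v : V, B v -> `|v| <= M.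
Proof.
have [M [Mr HM]] := compact_bounded Bcompact.
exists (`|M| + 1); first by rewrite ltr_wpDl.
by move=> v Bv; apply: HM => //; rewrite (le_lt_trans (ler_norm M))// ltrDl.
Qed.

Let S_has_inf y : S y !=set0 /\ has_lbound (S y).
Proof.
split; last by exists 0 => t [].
have [r r0 rB] := ball_subset_body.
exists ((`|y| + 1) * r^-1); apply/SE.
  by rewrite mulr_gt0 ?invr_gt0// ltr_wpDl.
apply: rB; rewrite normrZ gtr0_norm; last first.
  by rewrite invr_gt0 mulr_gt0 ?invr_gt0// ltr_wpDl.
rewrite invfM invrK mulrAC gtr_pMl// mulrC ltr_pdivrMr ?ltr_wpDl//.
by rewrite mul1r ltrDl.
Qed.

Let gaugeE y : g y = inf (S y).
Proof.
have [S0 Slb] := S_has_inf y.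
by rewrite /gauge /rel_dist ereal_inf_EFin.
Qed.

(** The infimum behind the gauge is attained: if it equals t, then s^-1 y lies in B for every s > t,
    and B is closed. If it is below t, convexity and 0 in B suffice. *)
Lemma gaugeP y (t : R) : 0 < t -> (g y <= t) <-> B (t^-1 *: y).
Proof.
move=> t0; have [S0 Slb] := S_has_inf y; rewrite gaugeE; split; last first.
  by move=> /(SE _ t0) St; exact: ge_inf.
rewrite le_eqVlt => /predU1P[inft|]; last first.
  by move=> /inf_lt[//|s Ss st]; apply/SE => //; exact: S_mono t0 (ltW st) Ss.
have Bcl : closed B by exact: (compact_closed (@norm_hausdorff _ _) Bcompact).
suff ct : s^-1 *: y @[s --> t^'+] --> t^-1 *: y.
  apply: (@closed_cvg _ _ t^'+ _ (fun s => s^-1 *: y) B Bcl _ _ ct); near=> s.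
  have ts : t < s by near: s; exact: nbhs_right_gt.
  have s0 : 0 < s by exact: lt_trans ts.
  have : inf (S y) < s by rewrite inft.
  by move=> /inf_lt[//|r Sr rs]; apply/SE => //; exact: S_mono s0 (ltW rs) Sr.
apply: cvgZr_tmp; apply: cvgV; rewrite ?gt_eqF//.
by apply: cvg_within_filter; exact: cvg_id.
Unshelve. all: by end_near. Qed.

Lemma gauge_ge0 y : 0 <= g y.
Proof.
by have [S0 Slb] := S_has_inf y; rewrite gaugeE; apply: lb_le_inf => // t [].
Qed.

Lemma gauge_eq a (y : V) : 0 <= a -> (forall t, 0 < t -> a <= t <-> B (t^-1 *: y)) ->
  g y = a.
Proof.
move=> a0 H; apply/eqP; rewrite eq_le; apply/andP; split.
  apply/ler_addgt0Pr => e e0.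
  by apply/gaugeP; [rewrite ltr_wpDl|apply/H; rewrite ?ltr_wpDl// lerDl ltW].
apply/ler_addgt0Pr => e e0.
have ge : 0 < g y + e by rewrite ltr_wpDl// gauge_ge0.
by apply/(H _ ge)/gaugeP; rewrite // lerDl ltW.
Qed.

Lemma gauge_at0 : g 0 = 0.
Proof.
apply: gauge_eq => // t t0; split => [_|_]; last exact: ltW.
by rewrite scaler0; exact: compact_contains0.
Qed.

Lemma gaugeZ (r : R) y : 0 < r -> g (r *: y) = r * g y.
Proof.
move=> r0; apply: gauge_eq => [|t t0]; first by rewrite mulr_ge0 ?gauge_ge0// ltW.
rewrite mulrC -ler_pdivlMr//.
rewrite (_ : t^-1 *: (r *: y) = (t / r)^-1 *: y).
  by apply: gaugeP; rewrite divr_gt0.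
by rewrite scalerA invfM invrK.
Qed.

(** For y in s B and z in t B, the vector (y + z) / (s + t) is a convex combination of y / s and z /
    t. The slack e / 2 serves to make s and t positive. *)
Lemma gaugeD y z : g (y + z) <= g y + g z.
Proof.
apply/ler_addgt0Pr => e e0.
have e2 : 0 < e / 2 by rewrite divr_gt0.
pose s := g y + e / 2; pose t := g z + e / 2.
have s0 : 0 < s by rewrite ltr_wpDl// gauge_ge0.
have t0 : 0 < t by rewrite ltr_wpDl// gauge_ge0.
have st0 : 0 < s + t by rewrite addr_gt0.
have By : B (s^-1 *: y) by apply/gaugeP; rewrite // lerDl ltW.
have Bz : B (t^-1 *: z) by apply/gaugeP; rewrite // lerDl ltW.
rewrite (_ : _ + e = s + t); last by rewrite /s /t; field.
apply/gaugeP => //.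
rewrite (_ : _ *: _ = (s / (s + t)) *: (s^-1 *: y) +
                      (1 - s / (s + t)) *: (t^-1 *: z)); last first.
  rewrite !scalerA scalerDr; congr (_ *: _ + _ *: _); field; lra.
apply: convexE => //; apply/andP; split; first by rewrite divr_ge0// ltW.
by rewrite ler_pdivrMr// mul1r lerDl ltW.
Qed.

Lemma gauge_lipschitz : exists2 c : R, 0 < c & forall y, g y <= c * `|y|.
Proof.
have [r r0 rB] := ball_subset_body.
(* The factor 2 places the rescaled vector at norm r / 2, strictly inside the ball contained in
   B. *)
exists (2 / r); first by rewrite divr_gt0.
move=> y; have [->|y0] := eqVneq y 0; first by rewrite gauge_at0 normr0 mulr0.
have y0' : 0 < `|y| by rewrite normr_gt0.
have c0 : 0 < 2 / r * `|y| by rewrite mulr_gt0// divr_gt0.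
apply/gaugeP => //; apply: rB; rewrite normrZ gtr0_norm ?invr_gt0//.
have -> : (2 / r * `|y|)^-1 * `|y| = r / 2 by field; rewrite !gt_eqF.
lra.
Qed.

Lemma gauge_continuous : continuous g.
Proof.
have [c c0 gc] := gauge_lipschitz.
have H x y : `|g x - g y| <= c * `|x - y|.
  rewrite ler_norml lerNl opprB; apply/andP; split.
    have := gaugeD (y - x) x; rewrite subrK -lerBlDr => /le_trans; apply.
    by rewrite (le_trans (gc _))// distrC.
  have := gaugeD (x - y) y; rewrite subrK -lerBlDr => /le_trans; apply.
  exact: gc.
move=> x A /nbhs_ballP[e /= e0 eA]; apply/nbhs_ballP.
exists (e / c) => [|y]; first by rewrite /= divr_gt0.
rewrite -ball_normE/= ltr_pdivlMr// => xy.
by apply: eA; rewrite -ball_normE/= (le_lt_trans (H _ _))// mulrC.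
Qed.

Lemma gauge_gt0 y : y != 0 -> 0 < g y.
Proof.
move=> y0; rewrite lt_def gauge_ge0 andbT; apply/eqP => gy0.
have [M M0 HM] := body_bounded.
have y0' : 0 < `|y| by rewrite normr_gt0.
(* Dividing y by this number gives a vector of norm 2 M, which cannot lie in B. *)
have t0 : 0 < `|y| / (2 * M) by rewrite divr_gt0// mulr_gt0.
have /(gaugeP _ t0)/HM : g y <= `|y| / (2 * M) by rewrite gy0 ltW.
rewrite normrZ gtr0_norm ?invr_gt0//.
have -> : (`|y| / (2 * M))^-1 * `|y| = 2 * M by field; rewrite !gt_eqF.
lra.
Qed.

Lemma gauge_eq0 y : (g y == 0) = (y == 0).
Proof.
apply/eqP/eqP => [gy|->]; last exact: gauge_at0.
by apply/eqP/negPn/negP => /gauge_gt0; rewrite gy ltxx.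
Qed.

Lemma gauge_norm : exists2 M : R, 0 < M & forall y, `|y| <= M * g y.
Proof.
have [M M0 HM] := body_bounded; exists M => // y.
have [->|y0] := eqVneq y 0; first by rewrite gauge_at0 normr0 mulr0.
have gy := gauge_gt0 y0.
have /HM : B ((g y)^-1 *: y) by apply/(gaugeP _ gy).
by rewrite normrZ gtr0_norm ?invr_gt0// mulrC ler_pdivrMr.
Qed.

Lemma gauge_le1 y : g y <= 1 <-> B y.
Proof. by have := gaugeP y ltr01; rewrite invr1 scale1r. Qed.

Lemma rel_dist_le K (t : R) : 0 <= t -> (exists2 y, K y & g y <= t) ->
  (rel_dist B 0 K <= t%:E)%E.
Proof.
move=> t0 [y Ky gyt]; apply/lee_addgt0Pr => e e0.
apply: ereal_inf_lbound; exists (t + e) => //; split; first by rewrite addr_ge0// ltW.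
have te0 : 0 < t + e by rewrite ltr_wpDl.
exists y; split => //; exists ((t + e)^-1 *: y); last first.
  by rewrite add0r scalerA divff ?scale1r// gt_eqF.
by apply/gaugeP => //; rewrite (le_trans gyt)// lerDl ltW.
Qed.

Lemma rel_dist_lt K (t : R) : (rel_dist B 0 K < t%:E)%E ->
  exists2 y, K y & g y < t.
Proof.
move=> /ereal_inf_lt [_ [s [s0 [y [[b Bb <-] Ky]]]] <-]; rewrite lte_fin => st.
exists (0 + s *: b) => //; rewrite add0r; apply: le_lt_trans st.
move: s0; rewrite le_eqVlt => /predU1P[<-|s0]; first by rewrite scale0r gauge_at0.
by rewrite gaugeZ// ger_pMr//; exact/gauge_le1.
Qed.

(** Sublevel sets of the gauge are bounded, so only finitely many points of K compete with a given
    one. *)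
Lemma locally_finite_min K : locally_finite K -> K !=set0 ->
  exists2 y, K y & forall z, K z -> g y <= g z.
Proof.
move=> Kfin [y0 Ky0]; have [M M0 gM] := gauge_norm.
have bd : bounded_set [set y | g y <= g y0].
  exists (M * g y0); split; first exact: num_real.
  move=> r Mr y /= gy; rewrite (le_trans (gM y))// (le_trans _ (ltW Mr))//.
  by rewrite ler_pM2l.
have /finite_seqP[s sE] := Kfin _ bd.
have memE z : (z \in s) <-> K z /\ g z <= g y0.
  by have := congr1 (@^~ z) sE; rewrite /= => <-.
have [|y /memE[Ky gy] Hy] := @seq_min _ _ s g.
  by apply/eqP => s0; have /memE := conj Ky0 (lexx (g y0)); rewrite s0.
exists y => // z Kz; have [gz|/ltW gz] := leP (g z) (g y0).
  by apply: Hy; exact/memE.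
exact: le_trans gz.
Qed.

Lemma rel_dist_min K y : K y -> (forall z, K z -> g y <= g z) ->
  rel_dist B 0 K = (g y)%:E.
Proof.
move=> Ky Hy; apply/eqP; rewrite eq_le; apply/andP; split.
  by apply: rel_dist_le; [exact: gauge_ge0|exists y].
by rewrite leNgt; apply/negP => /rel_dist_lt[z Kz]; rewrite ltNge Hy.
Qed.

Lemma rel_dist_leP K (t : R) : locally_finite K -> 0 <= t ->
  (rel_dist B 0 K <= t%:E)%E <-> exists2 y, K y & g y <= t.
Proof.
move=> Kfin t0; split => [Kt|]; last exact: rel_dist_le.
have [z Kz _] : exists2 y, K y & g y < t + 1.
  by apply: rel_dist_lt; rewrite (le_lt_trans Kt)// lte_fin ltrDl.
have [y Ky Hy] := locally_finite_min Kfin (ex_intro _ z Kz).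
by exists y => //; rewrite -lee_fin -(rel_dist_min Ky Hy).
Qed.

Lemma contact_points_min K y : K y -> (forall z, K z -> g y <= g z) -> 0 < g y ->
  contact_points B 0 K = K `&` [set z | g z = g y].
Proof.
move=> Ky Hy gy; rewrite /contact_points (rel_dist_min Ky Hy)/=.
apply/seteqP; split => z.
  move=> [[b Bb <-] Kz]; split => //=; apply/eqP; rewrite eq_le Hy// andbT.
  by rewrite add0r gaugeZ// ger_pMr//; exact/gauge_le1.
move=> [Kz /= gz]; split => //; exists ((g y)^-1 *: z); last first.
  by rewrite add0r scalerA divff ?scale1r// gt_eqF.
by apply/gaugeP; rewrite // gz.
Qed.

(** The case in which the direction is not the default: positive distance and a single contact
    point. *)
Definition unique_min K y :=
  [/\ K y, 0 < g y & forall z, K z -> z != y -> g y < g z].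

Lemma rel_dir_unique_min u0 K y : unique_min K y ->
  rel_dir u0 B K 0 = - (g y)^-1 *: y.
Proof.
move=> [Ky gy Hy].
have Hy' z : K z -> g y <= g z.
  by move=> Kz; have [->//|zy] := eqVneq z y; exact/ltW/Hy.
have cE : contact_points B 0 K = [set y].
  rewrite (contact_points_min Ky Hy' gy); apply/seteqP; split => z /=; last first.
    by move=> ->.
  by move=> [Kz gzy]; have [//|/(Hy _ Kz)] := eqVneq z y; rewrite gzy ltxx.
rewrite /rel_dir; case: asboolP => [_|[]]; last first.
  split; last by exists y.
  by rewrite (rel_dist_min Ky Hy') lte_fin gy ltry.
rewrite (rel_dist_min Ky Hy')/= cE.
have -> : xget 0 [set y] = y by have [] := @xgetPex _ 0 [set y] (ex_intro _ y erefl).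
by rewrite sub0r scalerN scaleNr.
Qed.

Lemma rel_dir_default u0 K : locally_finite K -> K !=set0 ->
  ~ (exists y, unique_min K y) -> rel_dir u0 B K 0 = u0.
Proof.
move=> Kfin K0 nK; rewrite /rel_dir; case: asboolP => // -[/andP[d0 _] [y cy]].
exfalso; apply: nK.
have [z Kz Hz] := locally_finite_min Kfin K0.
move: d0; rewrite (rel_dist_min Kz Hz) lte_fin => gz.
move: cy; rewrite (contact_points_min Kz Hz gz) => cy.
have zy : z = y by have : [set y] z by rewrite -cy.
exists z; split => // x Kx xz; rewrite lt_neqAle Hz// andbT eq_sym.
apply/eqP => gxz; move/eqP : xz; apply.
by rewrite zy; have : [set y] x by rewrite -cy; split => //=; rewrite gxz.
Qed.

(** This removes the infimum and the choice of a contact point. The second alternative is the one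
    where the default [u0] is used: some point is within t, but it is at the origin or the minimum
    is tied. *)
Lemma rel_dir_event u0 K (t : R) (C : set V) : locally_finite K -> 0 <= t ->
  ((rel_dist B 0 K <= t%:E)%E /\ C (rel_dir u0 B K 0)) <->
  (exists y, [/\ unique_min K y, g y <= t & C (- (g y)^-1 *: y)]) \/
  [/\ exists2 y, K y & g y <= t, ~ (exists y, unique_min K y) & C u0].
Proof.
move=> Kfin t0; rewrite (rel_dist_leP Kfin t0); split.
  move=> [[y Ky gyt] Cdir].
  have [[z Kz]|nK] := pselect (exists y, unique_min K y).
    left; exists z; split => //; last by rewrite -(rel_dir_unique_min u0 Kz).
    case: Kz => _ _ Hz; have [<-//|/(Hz _ Ky)/ltW] := eqVneq y z.
    by move=> /le_trans; apply.
  right; split => //; first by exists y.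
  by rewrite -(rel_dir_default u0 Kfin _ nK)//; exists y.
move=> [[y [Ky gyt Cy]]|[[y Ky gyt] nK Cu0]]; last first.
  by split; [exists y|rewrite rel_dir_default//; exists y].
by rewrite (rel_dir_unique_min u0 Ky); split=> //; exists y => //; case: Ky.
Qed.

Lemma finite_locally_finite (K : set V) : finite_set K -> locally_finite K.
Proof. by move=> Kf A _; exact: finite_setIl. Qed.

(** * Volumes of cones, shells and spheres of the gauge *)

Section lebesgue_gauge.
Hypothesis d_gt0 : (0 < d)%N.
Local Notation Leb := (@lebesgue_rV R d).

Lemma measurable_gauge : measurable_fun [set: V] (g : V -> measurableTypeR R).
Proof. apply: continuous_measurable_rV; exact: gauge_continuous. Qed.

Lemma measurable_gauge_le t : measurable [set y | g y <= t].
Proof.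
rewrite (_ : [set y | _] = g @^-1` `]-oo, t]%classic); last first.
  by apply/seteqP; split => y /=; rewrite in_itv.
by rewrite -[X in measurable X]setTI; exact: measurable_gauge.
Qed.

Lemma bounded_gauge_le t : bounded_set [set y | g y <= t].
Proof.
have [M M0 gM] := gauge_norm; exists (M * t); split; first exact: num_real.
move=> r Mr y /= gy; rewrite (le_trans (gM y))// (le_trans _ (ltW Mr))//.
by rewrite ler_pM2l.
Qed.

Lemma lebesgue_gauge_le_fin t A : measurable A -> A `<=` [set y | g y <= t] ->
  (Leb A < +oo)%E.
Proof.
move=> mA At; apply: lebesgue_bounded => //.
by have [M [Mr HM]] := bounded_gauge_le t; exists M; split => // r /HM Hr y /At /Hr.
Qed.

(** The set {0} is invariant under doubling, so its finite volume m satisfies m = 2 ^ - d m, which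
    forces m = 0 as d > 0. Translation handles the other points. *)
Lemma lebesgue_rV1 (x : V) : Leb [set x] = 0%E.
Proof.
suff L0 : Leb [set 0] = 0%E.
  have := @lebesgue_rV_affine R d 1 (- x) [set 0] (oner_neq0 _) (measurable_rV1 _).
  rewrite L0 mule0 => <-; congr (Leb _); apply/seteqP; split => y /=.
    by move=> ->; rewrite scale1r subrr.
  by rewrite scale1r => /eqP; rewrite subr_eq0 => /eqP.
have n2 : (2 : R) != 0 by rewrite pnatr_eq0.
have := @lebesgue_rV_affine R d 2 0 [set 0] n2 (measurable_rV1 _).
rewrite (_ : _ @^-1` _ = [set 0]); last first.
  apply/seteqP; split => y /=; last by move=> ->; rewrite scaler0 addr0.
  by rewrite addr0 => /eqP; rewrite scaler_eq0 pnatr_eq0/= => /eqP.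
have fin : Leb [set 0] \is a fin_num.
  rewrite ge0_fin_numE ?measure_ge0//.
  apply: (@lebesgue_gauge_le_fin 0); first exact: measurable_rV1.
  by move=> y /= ->; rewrite gauge_at0.
rewrite -(fineK fin) -EFinM => -[]; set x0 := fine _ => H.
congr EFin; apply/eqP; have : x0 * (1 - 2 ^- d) = 0.
  by move: H; rewrite gtr0_norm// => H; rewrite mulrBr mulr1 mulrC -H subrr.
move=> /eqP; rewrite mulf_eq0 => /orP[//|].
rewrite subr_eq0 eq_sym invr_eq1 => /eqP H2.
have : 1 < 2 ^+ d :> R by rewrite exprn_egt1// ?ltr1n// -lt0n.
by rewrite H2 ltxx.
Qed.

Lemma lebesgue_cone_le (G : set V) t : measurable G ->
  (forall (r : R) y, 0 < r -> G y -> G (r *: y)) -> 0 <= t ->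
  Leb (G `&` [set y | g y <= t]) = ((t ^+ d)%:E * Leb (G `&` [set y | (g y <= 1)%R]))%E.
Proof.
move=> mG coneG; rewrite le_eqVlt => /predU1P[<-|t0].
  rewrite expr0n gtn_eqF// mul0e; apply/eqP; rewrite eq_le measure_ge0 andbT.
  rewrite -(lebesgue_rV1 0); apply: le_measure; rewrite ?inE.
  - by apply: measurableI => //; exact: measurable_gauge_le.
  - exact: measurable_rV1.
  - move=> y [_ /= gy]; apply/eqP; rewrite -gauge_eq0.
    by rewrite eq_le gy gauge_ge0.
have tn0 : t^-1 != 0 by rewrite invr_neq0// gt_eqF.
have := @lebesgue_rV_affine R d t^-1 0 (G `&` [set y | g y <= 1]) tn0.
move=> /(_ (measurableI _ _ mG (measurable_gauge_le _))).
rewrite gtr0_norm ?invr_gt0// exprVn invrK => <-; congr (Leb _).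
have gE y : (g (t^-1 *: y + 0) <= 1) = (g y <= t).
  by rewrite addr0 gaugeZ ?invr_gt0// ler_pdivrMl// mulr1.
apply/seteqP; split => y /= []; rewrite -gE => Gy gy; split => //.
  by rewrite addr0; apply: coneG => //; rewrite invr_gt0.
have := coneG t _ t0 Gy; rewrite addr0 scalerA divff ?scale1r//.
by rewrite gt_eqF.
Qed.

Lemma lebesgue_cone_shell (G : set V) s t : measurable G ->
  (forall (r : R) y, 0 < r -> G y -> G (r *: y)) -> 0 <= s -> s <= t ->
  Leb (G `&` [set y | s < g y <= t]) =
  ((t ^+ d - s ^+ d)%:E * Leb (G `&` [set y | (g y <= 1)%R]))%E.
Proof.
move=> mG coneG s0 st; have t0 : 0 <= t by exact: le_trans st.
have mGr r : measurable (G `&` [set y | g y <= r]).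
  by apply: measurableI => //; exact: measurable_gauge_le.
have fin r : Leb (G `&` [set y | g y <= r]) \is a fin_num.
  rewrite ge0_fin_numE ?measure_ge0//.
  by apply: (@lebesgue_gauge_le_fin r) => // y [].
rewrite (_ : _ `&` _ = (G `&` [set y | g y <= t]) `\` (G `&` [set y | g y <= s])).
  rewrite measureD//; last first.
    by have := fin t; rewrite ge0_fin_numE ?measure_ge0.
  rewrite (_ : _ `&` (G `&` _) = G `&` [set y | g y <= s]); last first.
    apply/seteqP; split => [y [_ []]//|y [Gy gy]]; split => //; split => //=.
    exact: le_trans st.
  rewrite [X in (X - _)%E](lebesgue_cone_le mG coneG t0).
  rewrite [X in (_ - X)%E](lebesgue_cone_le mG coneG s0).
  by rewrite -(fineK (fin 1)) -!EFinM -EFinB mulrBl.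
apply/seteqP; split => y.
  by move=> [Gy /= /andP[sy yt]]; split => // -[_ /=]; rewrite leNgt sy.
move=> [[Gy /= gy] H]; split => //=; rewrite gy andbT ltNge; apply/negP => gys.
exact: H.
Qed.

(** For r > 0 the sphere lies in each shell ]s, r], whose volume is proportional to r ^ d - s ^ d
    and vanishes as s increases to r. *)
Lemma lebesgue_gauge_eq (r : R) : Leb [set y | g y = r] = 0%E.
Proof.
have [r0|rneg] := leP 0 r; last first.
  rewrite (_ : [set _ | _] = set0) ?measure0//; apply/seteqP; split => // y /= gy.
  by move: rneg; rewrite -gy ltNge gauge_ge0.
have mL : measurable [set y | g y = r].
  rewrite (_ : [set _ | _] = g @^-1` [set r])//.
  by rewrite -[X in measurable X]setTI; exact: measurable_gauge.
move: r0; rewrite le_eqVlt => /predU1P[r0|r0].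
  rewrite (_ : [set _ | _] = [set 0]) ?lebesgue_rV1//.
  apply/seteqP; split => y /=; last by move=> ->; rewrite gauge_at0.
  by move=> gy; apply/eqP; rewrite -gauge_eq0 gy -r0.
have fin : Leb (setT `&` [set y | g y <= 1]) \is a fin_num.
  rewrite ge0_fin_numE ?measure_ge0//.
  by apply: (@lebesgue_gauge_le_fin 1) => [|y [_]//]; rewrite setTI; exact: measurable_gauge_le.
have finr : Leb [set y | g y = r] \is a fin_num.
  rewrite ge0_fin_numE ?measure_ge0//.
  by apply: (@lebesgue_gauge_le_fin r) => // y /= ->.
set c := fine (Leb (setT `&` [set y | g y <= 1])).
have H s : 0 <= s -> s < r -> fine (Leb [set y | g y = r]) <= (r ^+ d - s ^+ d) * c.
  move=> s0 sr; rewrite -lee_fin fineK// EFinM /c fineK//.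
  rewrite -(lebesgue_cone_shell _ _ s0 (ltW sr))//.
  apply: le_measure; rewrite ?inE//.
    rewrite setTI (_ : [set _ | _] = g @^-1` `]s, r]%classic); last first.
      by apply/seteqP; split => y /=; rewrite in_itv.
    by rewrite -[X in measurable X]setTI; exact: measurable_gauge.
  by move=> y /= gy; split => //=; rewrite gy sr lexx.
rewrite -(fineK finr); congr EFin; apply/eqP; rewrite eq_le fine_ge0 ?measure_ge0// andbT.
have cv : (r ^+ d - s ^+ d) * c @[s --> r^'-] --> (r ^+ d - r ^+ d) * c.
  apply: cvgMl; apply: cvgB; first exact: cvg_cst.
  apply: (@cvg_comp _ _ _ id (fun s => s ^+ d) _ (nbhs r)).
    by apply: cvg_within_filter; exact: cvg_id.
  exact: exprn_continuous.
rewrite subrr mul0r in cv.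
apply: (cvgr_to_ge cv); near=> s; apply: H.
  by apply: ltW; near: s; exact: nbhs_left_gt.
by near: s; exact: nbhs_left_lt.
Unshelve. all: by end_near. Qed.

Lemma lebesgue_gauge_eq_translate (z : V) (r : R) : Leb [set y | g (z + y) = r] = 0%E.
Proof.
have mL : measurable [set y | g y = r].
  rewrite (_ : [set _ | _] = g @^-1` [set r])//.
  by rewrite -[X in measurable X]setTI; exact: measurable_gauge.
have := @lebesgue_rV_affine R d 1 z _ (oner_neq0 _) mL.
rewrite lebesgue_gauge_eq mule0 => <-; congr (Leb _).
by apply/funext => y; rewrite /preimage/= scale1r addrC.
Qed.

End lebesgue_gauge.

End gauge_theory.

(** * Measurability on the space of configurations *)

Section count_measurability.
Context {R : realType} {d : nat}.
Local Notation V := 'rV[R]_d.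

Lemma countingE (A : set V) : finite_set A ->
  counting A = (#|` fset_set A|)%:R%:E :> \bar R.
Proof. by move=> fA; rewrite /counting asboolT. Qed.

Lemma counting_nat (A : set V) :
  (exists k : nat, counting A = k%:R%:E :> \bar R) \/ counting A = +oo%E :> \bar R.
Proof.
rewrite /counting; case: asboolP => _; last by right.
by left; eexists.
Qed.

Lemma counting_eq0 (A : set V) : counting A = 0%E :> \bar R <-> A = set0.
Proof.
split; last by move=> ->; rewrite measure0.
rewrite /counting; case: asboolP => // fA [] /eqP.
by rewrite pnatr_eq0 cardfs_eq0 => /eqP/fset_set_set0 ->.
Qed.

Lemma measurable_nat_valued disp (X : measurableType disp) (f : X -> \bar R) :
  (forall x, (exists k : nat, f x = k%:R%:E) \/ f x = +oo%E) ->
  (forall k : nat, measurable [set x | f x = k%:R%:E]) ->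
  measurable_fun [set: X] f.
Proof.
move=> fnat mf _ S mS; rewrite setTI.
have mfin : measurable (\bigcup_(k in [set: nat]) [set x | f x = k%:R%:E]).
  by apply: bigcupT_measurable => k; exact: mf.
rewrite (_ : _ @^-1` _ =
    \bigcup_(k in [set k : nat | S k%:R%:E]) [set x | f x = k%:R%:E] `|`
    (if `[< S +oo%E >] then ~` \bigcup_(k in [set: nat]) [set x | f x = k%:R%:E]
     else set0)).
  apply: measurableU; first by apply: bigcup_measurable => k _; exact: mf.
  by case: ifPn => _ //; exact: measurableC.
apply/seteqP; split => x; rewrite /preimage/=.
  have [[k fk]|fy] := fnat x; first by rewrite fk => Sk; left; exists k.
  move=> Sx; right; rewrite fy in Sx; rewrite asboolT// => -[k _ /=].
  by rewrite fy.
move=> [[k /= Sk ->//]|]; case: asboolP => // Sy nk.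
have [[k fk]|->//] := fnat x.
by exfalso; apply: nk; exists k.
Qed.

Section config_fun.
Context {disp : measure_display} {X : measurableType disp}.
Variable kappa : X -> @config R d.
Hypothesis mkappa : measurable_fun [set: X] kappa.

Lemma measurable_counting (A : set V) : measurable A ->
  measurable_fun [set: X] (fun x => counting (kappa x `&` A) : \bar R).
Proof.
move=> mA; apply: measurable_nat_valued => [x|k]; first exact: counting_nat.
pose E : set (@config R d) := [set phi | counting (phi `&` A) = k%:R%:E :> \bar R].
have mE : measurable E by apply: sub_sigma_algebra; exists A => //; exists k.
by have := mkappa measurableT mE; rewrite setTI.
Qed.

Hypothesis fkappa : forall x, finite_set (kappa x).

Lemma measurable_finite_set_rV (K : set V) : finite_set K -> measurable K.
Proof.
move=> /finite_seqP[s ->]; elim: s => [|x s IH].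
  by rewrite set_nil; exact: measurable0.
rewrite (_ : [set` _] = [set x] `|` [set` s]).
  by apply: measurableU => //; exact: measurable_rV1.
apply/seteqP; split => y /=; rewrite inE; first by move=> /predU1P[->|]; [left|right].
by move=> [->|->]; rewrite ?eqxx ?orbT.
Qed.

(** Restricting the counting measure to the random finite set [kappa x] gives a kernel with finite
    values, to which the measurability of section masses applies. *)
Definition kcounting (x : X) : {measure set V -> \bar R} :=
  mrestr counting (measurable_finite_set_rV (fkappa x)).

Lemma measurable_kcounting (U : set V) : measurable U ->
  measurable_fun [set: X] (kcounting ^~ U).
Proof.
move=> mU; apply: eq_measurable_fun (measurable_counting mU) => x _.
by rewrite /kcounting/= /mrestr setIC.
Qed.

HB.instance Definition _ := isKernel.Build _ _ X V R kcounting measurable_kcounting.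

Lemma measurable_counting_xsection (D : set (X * V)) : measurable D ->
  measurable_fun [set: X]
    (fun x => counting (kappa x `&` [set y | D (x, y)]) : \bar R).
Proof.
move=> mD.
have [] := @measurable_prod_subset_xsection_kernel _ _ X V R kcounting setT
  measurableT _ D mD.
  move=> x; exists (#|` fset_set (kappa x)|.+1)%:R => A mA.
  rewrite /mrestr setIT /kcounting/= /mrestr.
  rewrite countingE; last by apply: finite_setIr.
  rewrite lte_fin ltr_nat ltnS; apply: fsubset_leq_card.
  rewrite -fset_set_sub//; last by apply: finite_setIr.
move=> _; apply: eq_measurable_fun => x _.
rewrite /mrestr setIT /kcounting/= /mrestr setIC; congr (counting _).
by apply/seteqP; split => y [ky /xsectionP Dy]; split => //; exact/xsectionP.
Qed.

(** Existence of a point means that the count over the section is not 0. Enlarging X by the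
    variables already bound lets nested quantifiers over the points of a configuration be handled
    one at a time. *)
Lemma measurable_exists_config (D : set (X * V)) : measurable D ->
  measurable [set x | exists2 y, kappa x y & D (x, y)].
Proof.
move=> mD; have mc := measurable_counting_xsection mD.
rewrite (_ : [set x | _] = ~` ((fun x => counting (kappa x `&` [set y | D (x, y)]) : \bar R)
   @^-1` [set 0%E])).
  by apply: measurableC; rewrite -[X in measurable X]setTI; apply: mc.
apply/seteqP; split => x /=.
  move=> [y ky Dy] /counting_eq0 E0.
  by have : set0 y by rewrite -E0.
move=> /counting_eq0 /eqP/set0P[y [ky Dy]]; by exists y.
Qed.

End config_fun.
Lemma measurable_fun_config disp (X : measurableType disp)
    (kappa : X -> @config R d) :
  (forall A : set V, measurable A -> forall k : nat,
    measurable [set x | counting (kappa x `&` A) = k%:R%:E :> \bar R]) ->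
  measurable_fun [set: X] kappa.
Proof.
move=> H; apply: (@measurability _ _ X (@config R d) setT kappa (@count_events R d)) => //.
by move=> _ [_ [A mA [k _ <-]] <-]; rewrite setTI; exact: H.
Qed.

Lemma measurable_config_restrict (A : set V) : measurable A ->
  measurable_fun [set: @config R d] (fun K => K `&` A : @config R d).
Proof.
move=> mA; apply: measurable_fun_config => U mU k.
apply: sub_sigma_algebra; exists (A `&` U); first exact: measurableI.
by exists k => //; apply/funext => K /=; rewrite setIA.
Qed.

Lemma measurable_finite_config : measurable [set K : @config R d | finite_set K].
Proof.
rewrite (_ : [set K | _] = \bigcup_(k in [set: nat])
   [set K : @config R d | counting (K `&` setT) = k%:R%:E :> \bar R]).
  apply: bigcupT_measurable => k; apply: sub_sigma_algebra.
  by exists setT => //; exists k.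
apply/seteqP; split => K /=.
  by move=> fK; eexists => //=; rewrite setIT countingE.
by move=> [k _ /=]; rewrite setIT /counting; case: asboolP.
Qed.

(** Marks range over all configurations, whereas the measurability results concern finite ones.
    Infinite configurations are emptied, which leaves the clusters unchanged since they are
    finite. *)
Definition finite_part (K : @config R d) : @config R d :=
  if `[< finite_set K >] then K else set0.

Lemma finite_part_finite K : finite_set (finite_part K).
Proof. by rewrite /finite_part; case: asboolP. Qed.

Lemma finite_part_id K : finite_set K -> finite_part K = K.
Proof. by rewrite /finite_part => fK; rewrite asboolT. Qed.

Lemma measurable_finite_part : measurable_fun [set: @config R d] finite_part.
Proof.
apply: measurable_fun_config => U mU k.
rewrite (_ : [set K | _] =
    ([set K : @config R d | counting (K `&` U) = k%:R%:E :> \bar R] `&`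
     [set K : @config R d | finite_set K]) `|`
    (if k == 0%N then ~` [set K : @config R d | finite_set K] else set0)).
  apply: measurableU.
    apply: measurableI; last exact: measurable_finite_config.
    by apply: sub_sigma_algebra; exists U => //; exists k.
  case: ifPn => // _; apply: measurableC; exact: measurable_finite_config.
apply/seteqP; split => K /=; rewrite /finite_part; case: asboolP => // fK.
- by move=> ?; left.
- rewrite set0I measure0 => -[k0]; right.
  have -> : k = 0%N by apply/eqP; rewrite -(@pnatr_eq0 R) -k0.
  by [].
- by move=> [[]//|]; case: ifPn.
- by move=> [[]//|]; case: eqP => // -> _; rewrite set0I measure0.
Qed.

End count_measurability.

Section order_sets.
Context {disp : measure_display} {X : measurableType disp} {R : realType}.
Variables f h : X -> R.
Hypotheses (mf : measurable_fun [set: X] (f : X -> measurableTypeR R))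
  (mh : measurable_fun [set: X] (h : X -> measurableTypeR R)).

Lemma measurable_set_le : measurable [set x | f x <= h x].
Proof.
rewrite (_ : [set x | _] = (fun x => f x <= h x) @^-1` [set true])//.
rewrite -[X in measurable X]setTI; exact: (measurable_fun_ler mf mh).
Qed.

Lemma measurable_set_lt : measurable [set x | f x < h x].
Proof.
rewrite (_ : [set x | _] = (fun x => f x < h x) @^-1` [set true])//.
rewrite -[X in measurable X]setTI; exact: (measurable_fun_ltr mf mh).
Qed.

Lemma measurable_set_eq : measurable [set x | f x = h x].
Proof.
rewrite (_ : [set x | _] = (fun x => f x == h x) @^-1` [set true]).
  rewrite -[X in measurable X]setTI; exact: (measurable_fun_eqr mf mh).
by apply/seteqP; split => x /= /eqP.
Qed.
End order_sets.

Section cluster_events.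
Context {R : realType} {d : nat} (B : set 'rV[R]_d).
Hypotheses (Bcompact : compact B) (Bconvex : convex_set B)
  (B0 : nbhs (0 : 'rV[R]_d) B).
Local Notation V := 'rV[R]_d.
Local Notation g := (gauge B).

Definition translate (K : set V) (x : V) : set V := [set y + x | y in K].

Lemma finite_translate K x : finite_set K -> finite_set (translate K x).
Proof. exact: finite_image. Qed.

Lemma unique_min_translate (K : set V) (x y : V) : K y ->
  unique_min B (translate K x) (y + x) <->
  0 < g (y + x) /\ ~ exists2 z, K z & z <> y /\ g (z + x) <= g (y + x).
Proof.
move=> ky; split=> [[_ gy H]|[gy H]].
  split => // -[z kz [zy]]; rewrite leNgt H//; first by exists z.
  by apply/eqP => /addIr.
split => //; first by exists y.
move=> _ [z kz <-] zy; rewrite ltNge; apply/negP => gz; apply: H.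
by exists z => //; split => // zyE; rewrite zyE eqxx in zy.
Qed.

Context {disp : measure_display} {X : measurableType disp}.
Variables (xi : X -> V) (kappa : X -> @config R d).
Hypotheses (mxi : measurable_fun [set: X] xi)
  (mkappa : measurable_fun [set: X] kappa)
  (fkappa : forall x, finite_set (kappa x)).

Let mg disp' (Y : measurableType disp') (f : Y -> V) :
  measurable_fun [set: Y] f ->
  measurable_fun [set: Y] (fun y => g (f y) : measurableTypeR R).
Proof. exact: measurableT_comp (measurable_gauge Bcompact Bconvex B0). Qed.

Lemma measurable_unique_min_sub : measurable
  [set p : X * V | 0 < g (p.2 + xi p.1) /\
  ~ exists2 z, kappa p.1 z & z <> p.2 /\ g (z + xi p.1) <= g (p.2 + xi p.1)].
Proof.
have m1 : measurable_fun [set: X * V] (fun p => p.2 + xi p.1).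
  by apply: measurable_funD_rV => //; exact: measurableT_comp.
rewrite (_ : [set p | _] = [set p | 0 < g (p.2 + xi p.1)] `&`
  ~` [set p : X * V | exists2 z, kappa p.1 z & z <> p.2 /\ g (z + xi p.1) <= g (p.2 + xi p.1)])//.
apply: measurableI; first by apply: measurable_set_lt; [exact: measurable_cst|exact: mg].
apply: measurableC.
pose D := [set q : (X * V) * V | q.2 <> q.1.2 /\
    g (q.2 + xi q.1.1) <= g (q.1.2 + xi q.1.1)].
apply: (@measurable_exists_config R d _ _ (kappa \o fst) _ _ D).
- exact: measurableT_comp.
- by move=> p; exact: fkappa.
have ms1 : measurable_fun [set: (X * V) * V] (fun q => q.1.1) by exact: measurableT_comp.
have ms2 : measurable_fun [set: (X * V) * V] (fun q => q.1.2) by exact: measurableT_comp.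
have mxi1 : measurable_fun [set: (X * V) * V] (fun q => xi q.1.1) by exact: measurableT_comp.
apply: (measurableI [set q : (X * V) * V | q.2 <> q.1.2]
  [set q : (X * V) * V | g (q.2 + xi q.1.1) <= g (q.1.2 + xi q.1.1)]).
  rewrite (_ : [set q | _] = (fun q : (X * V) * V => q.2 - q.1.2) @^-1` ~` [set 0]).
    rewrite -[X in measurable X]setTI; apply: measurable_funB_rV => //.
    by apply: measurableC; exact: measurable_rV1.
  apply/seteqP; split => q; rewrite /preimage/= => H.
    by move=> /eqP; rewrite subr_eq0 => /eqP.
  by move=> qE; apply: H; rewrite qE subrr.
by apply: measurable_set_le; apply: mg; exact: measurable_funD_rV.
Qed.

Lemma measurable_hit t : measurable [set x | exists2 y, kappa x y & g (y + xi x) <= t].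
Proof.
apply: (measurable_exists_config mkappa fkappa (D := [set p | g (p.2 + xi p.1) <= t])).
apply: measurable_set_le; last exact: measurable_cst.
by apply: mg; apply: measurable_funD_rV => //; exact: measurableT_comp.
Qed.

(** [xi] and [kappa] are kept general because three cases are instances: positions of a fixed
    configuration, pairs of a position and a mark, and the process itself cut to a bounded set, with
    [xi] equal to 0. *)
Lemma measurable_rel_dir_event u0 (t : R) (C : set V) : 0 <= t -> measurable C ->
  measurable [set x | (rel_dist B 0 (translate (kappa x) (xi x)) <= t%:E)%E /\
    C (rel_dir u0 B (translate (kappa x) (xi x)) 0)].
Proof.
move=> t0 mC.
have lf x : locally_finite (translate (kappa x) (xi x)).
  by apply: finite_locally_finite; exact: finite_translate.
pose U := [set p : X * V | 0 < g (p.2 + xi p.1) /\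
  ~ exists2 z, kappa p.1 z & z <> p.2 /\ g (z + xi p.1) <= g (p.2 + xi p.1)].
have mU : measurable U by exact: measurable_unique_min_sub.
have m1 : measurable_fun [set: X * V] (fun p => p.2 + xi p.1).
  by apply: measurable_funD_rV => //; exact: measurableT_comp.
pose A := U `&` ([set p | g (p.2 + xi p.1) <= t] `&`
  ((fun p : X * V => - (g (p.2 + xi p.1))^-1 *: (p.2 + xi p.1)) @^-1` C)).
have mA : measurable A.
  apply: measurableI => //; apply: measurableI.
    by apply: measurable_set_le; [exact: mg|exact: measurable_cst].
  rewrite -[X in measurable X]setTI; apply: measurable_funZ_rV => //.
  under eq_fun do rewrite -powR_inv1 ?gauge_ge0//.
  apply: (@measurable_funN _ _ R).
  exact: (measurableT_comp (@measurable_powR R (-1)) (mg m1)).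
rewrite (_ : [set x | _] = [set x | exists2 y, kappa x y & A (x, y)] `|`
   ([set x | exists2 y, kappa x y & g (y + xi x) <= t] `&`
   (~` [set x | exists2 y, kappa x y & U (x, y)] `&` [set x | C u0]))).
  apply: measurableU; first exact: measurable_exists_config.
  apply: measurableI; first exact: measurable_hit.
  apply: measurableI; first by apply: measurableC; exact: measurable_exists_config.
  have [Cu|nCu] := pselect (C u0).
    by rewrite (_ : [set _ | _] = setT)//; apply/seteqP; split.
  by rewrite (_ : [set _ | _] = set0)//; apply/seteqP; split.
have exU x : (exists y, unique_min B (translate (kappa x) (xi x)) y) <->
    exists2 y, kappa x y & U (x, y).
  split => [[_ [[y ky <-] gy Hy]]|[y ky Uy]].
    by exists y => //; apply/unique_min_translate => //; split => //; exists y.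
  by exists (y + xi x); apply/unique_min_translate.
apply/seteqP; split => x /=; rewrite (rel_dir_event Bcompact Bconvex B0)//.
  move=> [[_ [[[y ky <-] gy Hy] gt Cy]]|[[_ [y ky <-] gt] nU Cu0]].
    left; exists y => //; split => //; apply/unique_min_translate => //.
    by split => //; exists y.
  right; split; first by exists y.
  by split => // /exU.
move=> [[y ky [Uy [gt Cy]]]|[[y ky gt] [nU Cu0]]].
  by left; exists (y + xi x); split => //; exact/unique_min_translate.
right; split => //; last by move=> /exU.
by exists (y + xi x) => //; exists y.
Qed.

Lemma measurable_tie : measurable [set x | exists2 y, kappa x y &
  exists2 z, kappa x z & y <> z /\ g (xi x + (y - z)) = g (xi x)].
Proof.
pose D := [set p : X * V | exists2 z, kappa p.1 z & p.2 <> z /\ g (xi p.1 + (p.2 - z)) = g (xi p.1)].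
apply: (measurable_exists_config mkappa fkappa (D := D)).
pose D' := [set q : (X * V) * V | q.1.2 <> q.2 /\
    g (xi q.1.1 + (q.1.2 - q.2)) = g (xi q.1.1)].
apply: (@measurable_exists_config R d _ _ (kappa \o fst) _ _ D').
- exact: measurableT_comp.
- by move=> p; exact: fkappa.
have ms1 : measurable_fun [set: (X * V) * V] (fun q => q.1.1) by exact: measurableT_comp.
have ms2 : measurable_fun [set: (X * V) * V] (fun q => q.1.2) by exact: measurableT_comp.
have mxi1 : measurable_fun [set: (X * V) * V] (fun q => xi q.1.1) by exact: measurableT_comp.
have mB : measurable_fun [set: (X * V) * V] (fun q => q.1.2 - q.2).
  exact: measurable_funB_rV.
apply: (measurableI [set q : (X * V) * V | q.1.2 <> q.2]
  [set q : (X * V) * V | g (xi q.1.1 + (q.1.2 - q.2)) = g (xi q.1.1)]).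
  rewrite (_ : [set q | _] = (fun q : (X * V) * V => q.1.2 - q.2) @^-1` ~` [set 0]).
    rewrite -[X in measurable X]setTI; apply: mB => //.
    by apply: measurableC; exact: measurable_rV1.
  apply/seteqP; split => q; rewrite /preimage/= => H.
    by move=> /eqP; rewrite subr_eq0 => /eqP.
  by move=> qE; apply: H; rewrite qE subrr.
by apply: measurable_set_eq; apply: mg => //; exact: measurable_funD_rV.
Qed.

End cluster_events.

Lemma lebesgue_rV_translate (R : realType) d (b : 'rV[R]_d) (A : set 'rV[R]_d) :
  measurable A -> lebesgue_rV d [set x | A (b + x)] = lebesgue_rV d A.
Proof.
move=> mA; have := @lebesgue_rV_affine R d 1 b A (oner_neq0 _) mA.
rewrite normr1 expr1n invr1 mul1e => <-; congr (lebesgue_rV d _).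
by apply/funext => x; rewrite /preimage/= scale1r addrC.
Qed.

(** * Positions at which a fixed finite configuration is hit *)

Section fixed_configuration.
Context {R : realType} {d : nat} (d_gt0 : (0 < d)%N) (B : set 'rV[R]_d).
Hypotheses (Bcompact : compact B) (Bconvex : convex_set B)
  (B0 : nbhs (0 : 'rV[R]_d) B).
Local Notation V := 'rV[R]_d.
Local Notation g := (gauge B).
Local Notation Leb := (@lebesgue_rV R d).

Let gD := gaugeD Bcompact Bconvex B0.
Let gZ := gaugeZ Bcompact Bconvex B0.
Let g_ge0 := gauge_ge0 B0.

Definition star_shaped (S : set V) :=
  forall (r : R) y, 0 < r <= 1 -> S y -> S (r *: y).

(* The part of S of gauge in ]t1, t2] contains, and that of gauge in ]t2, t3] is
   contained in, the cone over the section of S at gauge t2. *)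
Lemma star_shaped_shells (S : set V) (t1 t2 t3 : R) : measurable S ->
  star_shaped S -> S `<=` [set y | 0 < g y] -> 0 <= t1 -> t1 < t2 -> t2 < t3 ->
  (((t2 ^+ d - t1 ^+ d)%:E * Leb (S `&` [set y | (g y <= t3)%R]) +
    (t3 ^+ d - t2 ^+ d)%:E * Leb (S `&` [set y | (g y <= t1)%R]))
  <= (t3 ^+ d - t1 ^+ d)%:E * Leb (S `&` [set y | (g y <= t2)%R]))%E.
Proof.
move=> mS starS S0 t1_ge0 t12 t23.
have t2_gt0 : 0 < t2 by exact: le_lt_trans t12.
have mg := measurable_gauge Bcompact Bconvex B0.
have mSr r : measurable (S `&` [set y | g y <= r]).
  by apply: measurableI => //; exact: measurable_gauge_le.
have fin r : Leb (S `&` [set y | g y <= r]) \is a fin_num.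
  rewrite ge0_fin_numE ?measure_ge0//.
  by apply: (lebesgue_gauge_le_fin Bcompact Bconvex B0 (t := r)) => // y [].
pose G := [set y : V | 0 < g y /\ S ((t2 * (g y)^-1) *: y)].
have mG : measurable G.
  apply: measurableI.
    by apply: measurable_set_lt => //; exact: measurable_cst.
  rewrite -[X in measurable X]setTI; apply: measurable_funZ_rV => //.
  under eq_fun do rewrite -powR_inv1 ?gauge_ge0//.
  apply: (@measurable_funM _ _ R); first exact: measurable_cst.
  exact: (measurableT_comp (@measurable_powR R (-1)) mg).
have coneG (r : R) y : 0 < r -> G y -> G (r *: y).
  move=> r0 [gy Sy]; split; first by rewrite gZ// mulr_gt0.
  rewrite gZ// scalerA (_ : _ * r = t2 / g y)//.
  by field; rewrite !gt_eqF.
pose c := fine (Leb (G `&` [set y | g y <= 1])).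
have cE : Leb (G `&` [set y | g y <= 1]) = c%:E.
  rewrite fineK// ge0_fin_numE ?measure_ge0//.
  apply: (lebesgue_gauge_le_fin Bcompact Bconvex B0 (t := 1)) => [|y []//].
  by apply: measurableI => //; exact: measurable_gauge_le.
have msh s t : measurable [set y | s < g y <= t].
  rewrite (_ : [set _ | _] = g @^-1` `]s, t]%classic); last first.
    by apply/seteqP; split => y /=; rewrite in_itv.
  by rewrite -[X in measurable X]setTI; exact: mg.
have shell s t : 0 <= s -> s <= t ->
    Leb (G `&` [set y | s < g y <= t]) = ((t ^+ d - s ^+ d) * c)%:E.
  by move=> s0 st; rewrite (lebesgue_cone_shell Bcompact Bconvex B0)// cE EFinM.
have split_at s t : s <= t -> Leb (S `&` [set y | g y <= t]) =
    (Leb (S `&` [set y | (g y <= s)%R]) + Leb (S `&` [set y | (s < g y <= t)%R]))%E.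
  move=> st; rewrite -measureU//; last 2 first.
  - by apply: measurableI.
  - apply/seteqP; split => // y [[_ /= gs] [_ /= /andP[sg _]]].
    by move: gs; rewrite leNgt sg.
  congr (Leb _); apply/seteqP; split => y.
    move=> [Sy /= gy]; have [gs|gs] := leP (g y) s; first by left.
    by right; split => //=; rewrite gs gy.
  move=> [[Sy /= gy]|[Sy /= /andP[_ gy]]]; split => //=.
  exact: le_trans st.
pose m t := fine (Leb (S `&` [set y | g y <= t])).
have mE t : Leb (S `&` [set y | g y <= t]) = (m t)%:E by rewrite fineK.
have I1 : m t1 + (t2 ^+ d - t1 ^+ d) * c <= m t2.
  rewrite -lee_fin EFinD -!mE (split_at _ _ (ltW t12)) leeD2l// -shell//; last exact: ltW.
  apply: le_measure.
  - by apply/mem_set; apply: measurableI => //; exact: msh.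
  - by apply/mem_set; apply: measurableI => //; exact: msh.
  move=> y [[gy Sy] /= /andP[tg gt]]; split => //=; last by rewrite tg gt.
  have -> : y = (g y / t2) *: (t2 / g y *: y).
    by rewrite scalerA mulrA divfK ?gt_eqF// divff ?scale1r// gt_eqF.
  apply: starS => //; apply/andP; split; first by rewrite divr_gt0.
  by rewrite ler_pdivrMr// mul1r.
have I2 : m t3 <= m t2 + (t3 ^+ d - t2 ^+ d) * c.
  rewrite -lee_fin EFinD -!mE (split_at _ _ (ltW t23)) leeD2l// -shell//; [|exact: ltW|exact: ltW].
  apply: le_measure.
  - by apply/mem_set; apply: measurableI => //; exact: msh.
  - by apply/mem_set; apply: measurableI => //; exact: msh.
  move=> y [Sy /= /andP[tg gt]]; split => //=; last by rewrite tg gt.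
  have gy : 0 < g y by exact: lt_trans tg.
  split => //; apply: starS => //; apply/andP; split; first by rewrite divr_gt0.
  by rewrite ler_pdivrMr// mul1r ltW.
rewrite !mE -!EFinM -EFinD lee_fin.
have h1 : 0 <= t2 ^+ d - t1 ^+ d by rewrite subr_ge0 lerXn2r ?nnegrE ?(ltW t2_gt0) ?(ltW t12).
have h2 : 0 <= t3 ^+ d - t2 ^+ d.
  by rewrite subr_ge0 lerXn2r ?nnegrE ?(ltW t2_gt0) ?(ltW t23) ?(ltW (lt_trans t2_gt0 t23)).
(* With these weights the contributions of the cone, both equal to (t2 ^ d - t1 ^ d) (t3 ^ d - t2 ^
   d) c, cancel in the sum of [I1] and [I2]. *)
have := ler_wpM2l h1 I2; have := ler_wpM2l h2 I1.
move: (t1 ^+ d) (t2 ^+ d) (t3 ^+ d) (m t1) (m t2) (m t3) => a1 a2 a3 m1 m2 m3.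
lra.
Qed.

Lemma measurable_gauge_dir (C : set V) : measurable C ->
  measurable [set y : V | C (- (g y)^-1 *: y)].
Proof.
move=> mC; rewrite -[X in measurable X]setTI; apply: measurable_funZ_rV => //.
under eq_fun do rewrite -powR_inv1 ?gauge_ge0//.
apply: (@measurable_funN _ _ R).
have mg := measurable_gauge Bcompact Bconvex B0.
exact: (measurableT_comp (@measurable_powR R (-1)) mg).
Qed.

Lemma measurable_gauge_gt0 : measurable [set y : V | 0 < g y].
Proof.
apply: measurable_set_lt; first exact: measurable_cst.
exact: measurable_gauge.
Qed.

(* The contact direction of the one-point configuration y is - y / g y. *)
Definition dir_cone (C : set V) : set V :=
  [set y | 0 < g y] `&` [set y | C (- (g y)^-1 *: y)].

Lemma measurable_dir_cone C : measurable C -> measurable (dir_cone C).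
Proof.
by move=> mC; apply: measurableI; [exact: measurable_gauge_gt0|exact: measurable_gauge_dir].
Qed.

Lemma gauge_dirZ (r : R) y : 0 < r -> - (g (r *: y))^-1 *: (r *: y) = - (g y)^-1 *: y.
Proof.
move=> r0; rewrite gZ// scalerA invfM mulNr mulrAC mulVf ?mul1r//.
by rewrite gt_eqF.
Qed.

Lemma dir_coneZ C (r : R) y : 0 < r -> dir_cone C y -> dir_cone C (r *: y).
Proof.
by move=> r0 [/= gy Cy]; split => /=; rewrite ?gauge_dirZ// gZ// mulr_gt0.
Qed.

Section finite_K.
Variable K : set V.
Hypothesis fK : finite_set K.

(** When the cluster is placed so that its point [z] sits at [y], its point [k] sits at
    [y + (k - z)]; both are then reached at the same time. *)
Definition tie_set : set V := [set y | exists2 k, K k &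
  exists2 z, K z & k <> z /\ g (y + (k - z)) = g y].

(** The locations [y] of the point [l] for which [l] is the only first contact of the cluster, with
    direction in C. These are the star-shaped sets of the argument. *)
Definition strict_min_set (C : set V) (l : V) : set V :=
  dir_cone C `&` [set y | ~ exists2 z, K z & z <> l /\ g (y + (z - l)) <= g y].

Lemma measurable_tie_set : measurable tie_set.
Proof.
have := measurable_tie Bcompact Bconvex B0 (X := V) (xi := id) (kappa := cst K).
apply => //; exact: measurable_cst.
Qed.

Lemma measurable_strict_min_set C l : measurable C ->
  measurable (strict_min_set C l).
Proof.
move=> mC; apply: measurableI; first exact: measurable_dir_cone.
apply: (measurableC (A := [set y | exists2 z, K z & z <> l /\ g (y + (z - l)) <= g y])).
have mg := measurable_gauge Bcompact Bconvex B0.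
pose D := [set p : V * V | p.2 <> l] `&` [set p : V * V | g (p.1 + (p.2 - l)) <= g p.1].
apply: (@measurable_exists_config R d _ _ (cst K) _ _ D).
- exact: measurable_cst.
- by move=> x; exact: fK.
apply: measurableI.
  rewrite -[X in measurable X]setTI.
  apply: (@measurable_snd _ _ V V measurableT (~` [set l])).
  by apply: measurableC; exact: measurable_rV1.
apply: measurable_set_le; last exact: measurableT_comp.
apply: (measurableT_comp mg); apply: measurable_funD_rV => //.
by apply: measurable_funB_rV => //; exact: measurable_cst.
Qed.

(** Because y + (z - l) = (1 - r) y + (r y + (z - l)), subadditivity shows that a point z competing
    with l at r y already competes with it at y. The direction does not change along a ray. *)
Lemma star_shaped_strict_min_set C l : star_shaped (strict_min_set C l).
Proof.
move=> r y /andP[r0 r1] [Cy Hy]; split; first exact: dir_coneZ.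
move=> [z Kz [zl gz]]; apply: Hy; exists z => //; split => //.
rewrite (_ : y + (z - l) = (1 - r) *: y + (r *: y + (z - l))); last first.
  by rewrite [RHS]addrA -scalerDl subrK scale1r.
rewrite (le_trans (gD _ _))//.
have g1 : g ((1 - r) *: y) = (1 - r) * g y.
  move: r1; rewrite le_eqVlt => /predU1P[->|r1]; last by rewrite gZ// subr_gt0.
  by rewrite subrr scale0r mul0r gauge_at0.
rewrite g1; move: gz; rewrite [leRHS]gZ//; lra.
Qed.

Variable u0 : V.

Definition hit_dir_set (t : R) (C : set V) : set V :=
  [set x | (rel_dist B 0 (translate K x) <= t%:E)%E /\ C (rel_dir u0 B (translate K x) 0)].

Lemma measurable_hit_dir_set t C : 0 <= t -> measurable C ->
  measurable (hit_dir_set t C).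
Proof.
move=> t0 mC.
have := measurable_rel_dir_event Bcompact Bconvex B0 (X := V) (xi := id) (kappa := cst K).
by apply => //; exact: measurable_cst.
Qed.

Let A t C l := [set x | (strict_min_set C l `&` [set y | g y <= t]) (l + x)].

Let mA t C l : measurable C -> measurable (A t C l).
Proof.
move=> mC.
rewrite /A (_ : [set x | _] = (fun x => 1 *: x + l) @^-1` (strict_min_set C l `&` [set y | g y <= t])).
  apply: measurable_preimage_affine; apply: measurableI.
    exact: measurable_strict_min_set.
  exact: measurable_gauge_le.
by apply/funext => x; rewrite /preimage/= scale1r addrC.
Qed.

Let LebA t C l : measurable C ->
  Leb (A t C l) = Leb (strict_min_set C l `&` [set y | g y <= t]).
Proof.
move=> mC; rewrite lebesgue_rV_translate//; apply: measurableI.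
  exact: measurable_strict_min_set.
exact: measurable_gauge_le.
Qed.

Let A_sub t C l : K l -> 0 <= t -> A t C l `<=` hit_dir_set t C.
Proof.
move=> Kl t0 x [[[/= gy Cy] Hy] /= gt].
have lf : locally_finite (translate K x).
  by apply: finite_locally_finite; exact: finite_translate.
apply: (rel_dir_event Bcompact Bconvex B0 u0 C lf t0).2.
left; exists (l + x); split => //; apply/unique_min_translate => //.
split; first exact: gy.
move=> [z Kz [zl gz]]; apply: Hy; exists z => //; split => //.
by rewrite (_ : l + x + (z - l) = z + x)// addrC addrA subrK.
Qed.

Let A_triv t C : trivIset K (A t C).
Proof.
apply/trivIsetP => l m Kl Km lm; apply/seteqP; split => // x [[[_ Hl] _] [[_ Hm] _]].
have [lx|lx] := leP (g (l + x)) (g (m + x)).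
  apply: Hm; exists l => //; split; first exact/eqP.
  by rewrite (_ : m + x + (l - m) = l + x)// addrC addrA subrK.
apply: Hl; exists m => //; split; first by apply/eqP; rewrite eq_sym.
by rewrite (_ : l + x + (m - l) = m + x) ?ltW// addrC addrA subrK.
Qed.

Definition tieless := Leb tie_set = 0%E.

Hypothesis tieK : tieless.

(** Exceptional positions, of measure zero: if the cluster is hit without having a strict minimum,
    then any minimiser [l] is at the origin or tied with another point. *)
Let Nul l := [set x | (tie_set `|` [set 0]) (l + x)].

Let mNul l : measurable (Nul l).
Proof.
rewrite /Nul (_ : [set x | _] = (fun x => 1 *: x + l) @^-1` (tie_set `|` [set 0])).
  apply: measurable_preimage_affine; apply: measurableU; first exact: measurable_tie_set.
  exact: measurable_rV1.
by apply/funext => x; rewrite /preimage/= scale1r addrC.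
Qed.

Let LebNul l : Leb (Nul l) = 0%E.
Proof.
have mT := measurable_tie_set.
have m0 := @measurable_rV1 R d 0.
rewrite lebesgue_rV_translate; last exact: measurableU.
apply/eqP; rewrite eq_le measure_ge0 andbT.
rewrite (le_trans (measureU2 _ _ _))// [X in (X + _)%E](_ : _ = 0%E)// add0e.
by rewrite [leLHS](lebesgue_rV1 Bcompact Bconvex B0).
Qed.

Let sub_A t C : 0 <= t ->
  hit_dir_set t C `<=` \bigcup_(l in K) A t C l `|` \bigcup_(l in K) Nul l.
Proof.
move=> t0 x.
have lf : locally_finite (translate K x).
  by apply: finite_locally_finite; exact: finite_translate.
move=> /(rel_dir_event Bcompact Bconvex B0 u0 _ lf t0)[].
  move=> [_ [[[l Kl <-] gl Hl] gt Cl]]; left; exists l => //; split => //; split => //.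
  move=> [z Kz [zl]]; rewrite (_ : l + x + (z - l) = z + x); last by rewrite addrC addrA subrK.
  rewrite leNgt Hl//; first by exists z.
  by apply/eqP => /addIr.
move=> [[_ [l0 Kl0 <-] _] nU _]; right.
have [|_ [l Kl <-] Hl] := locally_finite_min Bcompact Bconvex B0 lf.
  by exists (l0 + x); exists l0.
exists l => //; rewrite /Nul/=.
have [lx0|lx0] := eqVneq (l + x) 0; first by right.
left; have gl : 0 < g (l + x) by exact: gauge_gt0.
apply: contrapT => nt; apply: nU; exists (l + x); split => //; first by exists l.
move=> _ [z Kz <-] zl; rewrite lt_neqAle Hl ?andbT; last by exists z.
apply/eqP => gE; apply: nt; exists z => //; exists l => //; split.
  by move=> zE; rewrite zE eqxx in zl.
by rewrite gE; congr (g _); rewrite addrC addrA subrK.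
Qed.

Lemma lebesgue_hit_dir_set t C : 0 <= t -> measurable C ->
  Leb (hit_dir_set t C) =
  (\sum_(l \in K) Leb (strict_min_set C l `&` [set y | (g y <= t)%R]))%E.
Proof.
move=> t0 mC.
have <- : Leb (\bigcup_(l in K) A t C l) =
    (\sum_(l \in K) Leb (strict_min_set C l `&` [set y | (g y <= t)%R]))%E.
  rewrite measure_fin_bigcup//; first by apply: eq_fsbigr => l _; exact: LebA.
  by move=> l _; exact: mA.
have mU : measurable (\bigcup_(l in K) A t C l).
  by apply: fin_bigcup_measurable => // l _; exact: mA.
have mN : measurable (\bigcup_(l in K) Nul l).
  by apply: fin_bigcup_measurable => // l _; exact: mNul.
have mH := measurable_hit_dir_set t0 mC.
apply/eqP; rewrite eq_le; apply/andP; split; last first.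
  apply: le_measure.
  - by apply/mem_set.
  - by apply/mem_set.
  by move=> x [l Kl]; exact: A_sub.
have N0 : Leb (\bigcup_(l in K) Nul l) = 0%E.
  apply/eqP; rewrite eq_le measure_ge0 andbT.
  apply: (le_trans (content_sub_fsum (A_ := Nul) (D := K) _ _ _ _ _)) => //.
  by rewrite fsbig1// => l _; exact: LebNul.
apply: (@le_trans _ _ (Leb (\bigcup_(l in K) A t C l `|` \bigcup_(l in K) Nul l))).
  apply: le_measure.
  - by apply/mem_set.
  - by apply/mem_set; exact: measurableU.
  exact: sub_A.
apply: (le_trans (measureU2 _ _ _)) => //.
by rewrite [X in (_ + X)%E]N0 adde0.
Qed.

Lemma hit_dir_set_shells t1 t2 t3 C : measurable C ->
  0 <= t1 -> t1 < t2 -> t2 < t3 ->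
  (((t2 ^+ d - t1 ^+ d)%:E * Leb (hit_dir_set t3 C) +
    (t3 ^+ d - t2 ^+ d)%:E * Leb (hit_dir_set t1 C))
  <= (t3 ^+ d - t1 ^+ d)%:E * Leb (hit_dir_set t2 C))%E.
Proof.
move=> mC t1_ge0 t12 t23.
have t20 : 0 <= t2 by exact/ltW/(le_lt_trans t1_ge0).
have t30 : 0 <= t3 by exact/(le_trans t20)/ltW.
rewrite !lebesgue_hit_dir_set// !ge0_mule_fsumr//.
rewrite -fsbig_split//; apply: lee_fsum => // l _.
apply: star_shaped_shells => //.
- exact: measurable_strict_min_set.
- exact: star_shaped_strict_min_set.
- by move=> y [[]].
Qed.

(* Otherwise every k in K has some z in K with g (y + (z - k)) < g y; following
   these z leads to a cycle of some length n in K, along which subadditivity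
   gives g (n y) < n g y. *)
Lemma exists_strict_min C y : K !=set0 -> dir_cone C y -> ~ tie_set y ->
  exists2 l, K l & strict_min_set C l y.
Proof.
move=> [k0 Kk0] Cy nt; apply: contrapT => nex.
have gy : 0 < g y by case: Cy.
have step k : K k -> exists z, K z /\ g (y + (z - k)) < g y.
  move=> Kk; apply: contrapT => nz; apply: nex; exists k => //; split => //.
  move=> [z Kz [zk gz]]; apply: nz; exists z; split => //.
  rewrite lt_neqAle gz andbT; apply/eqP => gE; apply: nt.
  by exists z => //; exists k.
have [f fP] : exists f : V -> V, forall k, K k -> K (f k) /\ g (y + (f k - k)) < g y.
  suff /choice[f fP] : forall k, exists z, K k -> K z /\ g (y + (z - k)) < g y by exists f.
  move=> k; have [/step[z Hz]|nKk] := pselect (K k); first by exists z.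
  by exists 0 => /nKk.
pose u n := iter n f k0.
have Ku n : K (u n) by elim: n => //= n /fP[].
have sumlt n m : g ((m.+1)%:R *: y + (u (n + m.+1)%N - u n)) < m.+1%:R * g y.
  elim: m => [|m IH].
    by rewrite scale1r mul1r addn1; have [_] := fP _ (Ku n).
  rewrite (_ : _ + _ = (m.+1%:R *: y + (u (n + m.+1)%N - u n)) +
     (y + (u (n + m.+2)%N - u (n + m.+1)%N))); last first.
    have -> : u (n + m.+2)%N - u n =
        (u (n + m.+1)%N - u n) + (u (n + m.+2)%N - u (n + m.+1)%N).
      by rewrite [RHS]addrC subrKA.
    by rewrite -[in LHS]natr1 scalerDl scale1r addrACA.
  rewrite (le_lt_trans (gD _ _))// -[in X in _ < X]natr1 mulrDl mul1r ltrD//.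
  by rewrite [in X in u X]addnS; have [_] := fP _ (Ku (n + m.+1)%N).
have [s sE] := (finite_seqP _).1 fK.
have /(uniqPn 0)[i [j [ij js]]] : ~~ uniq (mkseq u (size s).+1).
  apply/negP => us; have sub : {subset mkseq u (size s).+1 <= s}.
    by move=> _ /mapP[n _ ->]; have := Ku n; rewrite [X in X _ -> _]sE.
  by have := uniq_leq_size us sub; rewrite size_mkseq ltnn.
rewrite size_mkseq in js; rewrite !nth_mkseq ?(ltn_trans ij)// => uij.
have := sumlt i (j - i).-1.
rewrite prednK ?subn_gt0// subnKC ?(ltnW ij)// uij subrr addr0 gZ ?ltxx//.
by rewrite ltr0n subn_gt0.
Qed.

Lemma lebesgue_hit_dir_set_ge t C : 0 <= t -> measurable C -> K !=set0 ->
  ((t ^+ d)%:E * Leb (dir_cone C `&` [set y | (g y <= 1)%R]) <=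
   Leb (hit_dir_set t C))%E.
Proof.
move=> t0 mC K0; rewrite lebesgue_hit_dir_set//.
rewrite -(lebesgue_cone_le Bcompact Bconvex B0 d_gt0 _ _ t0); last 2 first.
- exact: measurable_dir_cone.
- by move=> r y; exact: dir_coneZ.
pose S l := strict_min_set C l `&` [set y | g y <= t].
have mS l : measurable (S l).
  by apply: measurableI; [exact: measurable_strict_min_set|exact: measurable_gauge_le].
have mSU : measurable (\bigcup_(l in K) S l) by exact: fin_bigcup_measurable.
have mT := measurable_tie_set.
apply: (@le_trans _ _ (Leb (\bigcup_(l in K) S l `|` tie_set))).
  apply: le_measure.
  - apply/mem_set; apply: measurableI; first exact: measurable_dir_cone.
    exact: measurable_gauge_le.
  - by apply/mem_set; exact: measurableU.
  move=> y [Cy gy]; have [ty|nty] := pselect (tie_set y); first by right.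
  by left; have [l Kl Sl] := exists_strict_min K0 Cy nty; exists l.
apply: (le_trans (measureU2 _ _ _)) => //.
have tie0 : Leb tie_set = 0%E by exact: tieK.
rewrite [X in (_ + X)%E]tie0 adde0.
have := @content_sub_fsum _ _ _ Leb V K _ S fK (fun l _ => mS l) mSU (@subset_refl _ _).
exact.
Qed.

Lemma hit_dir_setTE t : 0 <= t ->
  hit_dir_set t setT = \bigcup_(l in K) [set x | g (l + x) <= t].
Proof.
move=> t0; apply/seteqP; split => x.
  have lf : locally_finite (translate K x).
    by apply: finite_locally_finite; exact: finite_translate.
  move=> [/(rel_dist_leP Bcompact Bconvex B0 lf t0)[_ [l Kl <-] gl] _].
  by exists l.
move=> [l Kl gl]; split => //; apply: rel_dist_le => //.
by exists (l + x) => //; exists l.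
Qed.

Let mT t l : measurable [set x | g (l + x) <= t].
Proof.
rewrite (_ : [set x | _] = (fun x => 1 *: x + l) @^-1` [set y | g y <= t]).
  by apply: measurable_preimage_affine; exact: measurable_gauge_le.
by apply/funext => x; rewrite /preimage/= scale1r addrC.
Qed.

Lemma lebesgue_gauge_leE t : 0 <= t ->
  Leb [set y | g y <= t] = ((t ^+ d)%:E * Leb [set y | (g y <= 1)%R])%E.
Proof.
move=> t0; have := lebesgue_cone_le Bcompact Bconvex B0 d_gt0 measurableT _ t0.
by rewrite !setTI; exact.
Qed.

Lemma lebesgue_unit_body_fin : Leb [set y | g y <= 1] \is a fin_num.
Proof.
rewrite ge0_fin_numE ?measure_ge0//.
apply: (lebesgue_gauge_le_fin Bcompact Bconvex B0 (t := 1)) => //.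
exact: measurable_gauge_le.
Qed.

(** A coarse bound, but linear in the number of points, hence integrable over the clusters since
    their mean size is finite. It gives finiteness of the intensity and later the dominating
    function. *)
Lemma lebesgue_hit_dir_set_le t : 0 <= t ->
  (Leb (hit_dir_set t setT) <=
   counting K * ((t ^+ d)%:E * Leb [set y | (g y <= 1)%R]))%E.
Proof.
move=> t0; have := @content_sub_fsum _ _ _ Leb V K _
  (fun l => [set x | g (l + x) <= t]) fK (fun l _ => mT t l)
  (measurable_hit_dir_set t0 measurableT).
rewrite hit_dir_setTE// => /(_ (@subset_refl _ _))/le_trans; apply.
rewrite countingE// -(fineK lebesgue_unit_body_fin) -!EFinM.
rewrite (eq_fsbigr (fun=> (t ^+ d * fine (Leb [set y | g y <= 1]))%:E)).
  rewrite fsbig_finite//= sumEFin lee_fin big_const_seq iter_addr_0 count_predT.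
  by rewrite mulr_natl.
move=> l _; rewrite [LHS](@lebesgue_rV_translate R d l [set y | g y <= t]); last first.
  exact: measurable_gauge_le.
by rewrite lebesgue_gauge_leE// EFinM fineK// lebesgue_unit_body_fin.
Qed.

Lemma lebesgue_hit_dir_setT_ge t : 0 <= t -> K !=set0 ->
  ((t ^+ d)%:E * Leb [set y | (g y <= 1)%R] <= Leb (hit_dir_set t setT))%E.
Proof.
move=> t0 [l Kl]; rewrite -lebesgue_gauge_leE//.
rewrite -(lebesgue_rV_translate l); last exact: measurable_gauge_le.
apply: le_measure.
- by apply/mem_set; exact: mT.
- by apply/mem_set; exact: measurable_hit_dir_set.
by move=> x gx; rewrite hit_dir_setTE//; exists l.
Qed.

Lemma lebesgue_hit_dir_setT_le : exists2 r : R, 0 <= r & forall t, 0 <= t ->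
  (Leb (hit_dir_set t setT) <=
   ((t + r) ^+ d)%:E * Leb [set y | (g y <= 1)%R])%E.
Proof.
have [r r0 Hr] : exists2 r : R, 0 <= r & forall l, K l -> g (- l) <= r.
  have [s sE] := (finite_seqP _).1 fK.
  (* Any common bound on the gauges of the [- l] would do, since only its ratio to t matters as t
     grows; the sum is a convenient one. *)
  exists (\sum_(l <- s) g (- l)); first by apply: sumr_ge0.
  move=> l; rewrite sE/= => ls; rewrite (big_rem _ ls)/= lerDl.
  exact: sumr_ge0.
exists r => // t t0; rewrite -lebesgue_gauge_leE ?addr_ge0//.
apply: le_measure.
- by apply/mem_set; exact: measurable_hit_dir_set.
- by apply/mem_set; exact: measurable_gauge_le.
rewrite hit_dir_setTE// => x [l Kl /= gx].
rewrite (_ : x = (l + x) + (- l)); last by rewrite addrAC subrr add0r.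
by rewrite (le_trans (gD _ _))// lerD// Hr.
Qed.

Lemma hit_dir_set0 t C : K = set0 -> hit_dir_set t C = set0.
Proof.
move=> K0; apply/seteqP; split => // x [].
have lf : locally_finite (translate K x).
  by apply: finite_locally_finite; exact: finite_translate.
have [t0|/ltW t0] := leP 0 t.
  by move=> /(rel_dist_leP Bcompact Bconvex B0 lf t0)[y [l Kl _] _]; rewrite K0 in Kl.
move=> xt; have /(rel_dist_leP Bcompact Bconvex B0 lf (lexx 0))[y [l Kl _] _] :
    (rel_dist B 0 (translate K x) <= 0%:E)%E by rewrite (le_trans xt).
by rewrite K0 in Kl.
Qed.

End finite_K.

End fixed_configuration.

(** * Infinite products and independent marks *)

Section bounded_convergence.
Context {disp : measure_display} {T : measurableType disp} {R : realType}.
Variable P : probability T R.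

Lemma expectation_cvg (f : nat -> T -> R) (h : T -> R) :
  (forall n, measurable_fun [set: T] (f n)) ->
  (forall n w, 0 <= f n w <= 1) ->
  (forall w, f n w @[n --> \oo] --> h w) ->
  (\int[P]_w (f n w)%:E)%E @[n --> \oo] --> (\int[P]_w (h w)%:E)%E.
Proof.
move=> mf f01 fh.
have mh : measurable_fun [set: T] h.
  by apply: (measurable_fun_cvg mf) => w _; exact: fh.
have [] := @dominated_convergence _ T R P setT measurableT
  (fun n w => (f n w)%:E) (fun w => (h w)%:E) (cst 1%E).
- by move=> n; exact/measurable_EFinP.
- exact/measurable_EFinP.
- by apply: aeW => w _; apply: cvg_EFin; [exact: nearW|exact: fh].
- exact: finite_measure_integrable_cst.
- apply: aeW => w n _; rewrite abse_EFin lee_fin /=.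
  by have /andP[f0 f1] := f01 n w; rewrite ger0_norm.
- by [].
Qed.

End bounded_convergence.

Section infinite_product.
Context {R : realType}.
Implicit Type a : nat -> R.

(** Stands for a product over all points of an infinite process. With factors in [0, 1] the partial
    products are nonincreasing, so the limit exists. *)
Definition prod_lim a : R := limn (fun M => \prod_(0 <= n < M) a n).

Section unit_factors.
Variable a : nat -> R.
Hypothesis a01 : forall n, 0 <= a n <= 1.

Let a_ge0 n : 0 <= a n. Proof. by case/andP: (a01 n). Qed.
Let a_le1 n : a n <= 1. Proof. by case/andP: (a01 n). Qed.

Lemma prod01 M : 0 <= \prod_(0 <= n < M) a n <= 1.
Proof.
elim: M => [|M /andP[IH0 IH1]]; first by rewrite big_nil ler01 lexx.
by rewrite big_nat_recr//= mulr_ge0// mulr_ile1.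
Qed.

Lemma prod_nonincreasing : nonincreasing_seq (fun M => \prod_(0 <= n < M) a n).
Proof.
apply/nonincreasing_seqP => M; rewrite big_nat_recr//=.
by have /andP[p0 _] := prod01 M; rewrite ler_piMr.
Qed.

Lemma prod_lim_is_cvg : cvgn (fun M => \prod_(0 <= n < M) a n).
Proof.
apply: nonincreasing_is_cvgn; first exact: prod_nonincreasing.
by exists 0 => _ [M _ <-]; have /andP[] := prod01 M.
Qed.

Lemma prod_lim_cvg : (\prod_(0 <= n < M) a n) @[M --> \oo] --> prod_lim a.
Proof. exact: prod_lim_is_cvg. Qed.

Lemma prod_lim_ge0 : 0 <= prod_lim a.
Proof.
apply: limr_ge; first exact: prod_lim_is_cvg.
by apply: nearW => M; have /andP[] := prod01 M.
Qed.

Lemma prod_lim_le M : prod_lim a <= \prod_(0 <= n < M) a n.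
Proof.
apply: nonincreasing_cvgn_ge; first exact: prod_nonincreasing.
exact: prod_lim_is_cvg.
Qed.

Lemma prod_lim_le_factor n : prod_lim a <= a n.
Proof.
apply: le_trans (prod_lim_le n.+1) _; rewrite big_nat_recr//=.
by have /andP[p0 p1] := prod01 n; rewrite ler_piMl.
Qed.

(** Serves to detect two clusters that are both hit. *)
Lemma prod_lim_le_factor2 m n : (m < n)%N -> prod_lim a <= a m * a n.
Proof.
move=> mn; apply: le_trans (prod_lim_le n.+1) _; rewrite big_nat_recr//=.
rewrite ler_wpM2r//; rewrite (big_cat_nat (n := m.+1))//= big_nat_recr//=.
have /andP[p0 p1] := prod01 m.
have q1 : \prod_(m.+1 <= i < n) a i <= 1.
  by elim/big_rec : _ => // i x _ x1; rewrite (le_trans (ler_wpM2l _ x1))// mulr1.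
have q0 : 0 <= \prod_(m.+1 <= i < n) a i by apply: prodr_ge0.
rewrite (le_trans (ler_wpM2l _ q1)) ?mulr_ge0// mulr1.
by rewrite ler_piMl.
Qed.

End unit_factors.

Lemma le_prod_lim a b : (forall n, 0 <= a n <= 1) -> (forall n, 0 <= b n <= 1) ->
  (forall n, a n <= b n) -> prod_lim a <= prod_lim b.
Proof.
move=> a01 b01 ab; apply: ler_lim; [exact: prod_lim_is_cvg|exact: prod_lim_is_cvg|].
by apply: nearW => M; apply: ler_prod => n _; rewrite ab andbT; case/andP: (a01 n).
Qed.

Lemma prod_lim1 : prod_lim (fun=> 1) = 1.
Proof.
rewrite /prod_lim; under eq_fun do rewrite big1//.
by apply/cvg_lim => //; exact: cvg_cst.
Qed.

Lemma prod_lim_single a n0 : (forall n, n != n0 -> a n = 1) -> prod_lim a = a n0.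
Proof.
move=> a1; apply/cvg_lim => //; apply: cvg_near_cst.
exists n0.+1 => //= M n0M.
rewrite (bigD1_seq n0) ?mem_index_iota ?iota_uniq//=.
by rewrite big1 ?mulr1// => n /a1.
Qed.

End infinite_product.

Lemma emeasurable_prod_seq disp (X : measurableType disp) (R : realType)
    (I : eqType) (J : seq I) (F : I -> X -> \bar R) :
  (forall j, j \in J -> measurable_fun [set: X] (F j)) ->
  measurable_fun [set: X] (fun x => \prod_(j <- J) F j x)%E.
Proof.
elim: J => [_|j J IH mF].
  by under eq_fun do rewrite big_nil; exact: measurable_cst.
under eq_fun do rewrite big_cons.
apply: emeasurable_funM; first by apply: mF; rewrite mem_head.
by apply: IH => k kJ; apply: mF; rewrite inE kJ orbT.
Qed.

Lemma measurable_prod_lim disp (X : measurableType disp) (R : realType)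
    (a : nat -> X -> R) : (forall n, measurable_fun [set: X] (a n)) ->
  (forall n x, 0 <= a n x <= 1) ->
  measurable_fun [set: X] (fun x => prod_lim (a ^~ x)).
Proof.
move=> ma a01.
apply: (@measurable_fun_cvg _ _ _ _ (fun M x => \prod_(0 <= n < M) a n x)).
  by move=> M; apply: measurable_prod => n _.
by move=> x _; apply: prod_lim_cvg.
Qed.

(** * Integration under mutual independence *)

Section independence.
Context {disp : measure_display} {T : measurableType disp} {R : realType}.
Variable P : probability T R.

(** With E fixed, A |-> P (A [&] E) and A |-> P A * P E are finite measures that agree on finite
    intersections of events from the families in J. These form a pi-system generating the
    sigma-algebra, so the measures agree on it. *)
Lemma mutually_independent_generated (I : choiceType) (F : I -> set_system T)
    (J : seq I) (i : I) :
  mutually_independent P F -> uniq (i :: J) ->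
  (forall j, F j setT) -> (forall j, setI_closed (F j)) ->
  (forall j, F j `<=` measurable) ->
  forall A E, <<s \bigcup_(j in [set` J]) F j >> A -> F i E ->
  P (A `&` E) = (P A * P E)%E.
Proof.
move=> indF /andP[iJ uJ] FT FI Fm A E sA FE.
have mE : measurable E by exact: Fm FE.
pose G := [set \bigcap_(j in [set` J]) X j | X in [set X : I -> set T | forall j, F j (X j)]].
have mG : G `<=` measurable.
  move=> _ [X FX <-]; apply: fin_bigcap_measurable; first exact: finite_seq.
  by move=> j _; apply: Fm; exact: FX.
pose m1 : {measure set T -> \bar R} := mrestr P mE.
pose PE := fine (P E).
have PE0 : 0 <= PE by exact: fine_ge0.
have PEE : P E = PE%:E by rewrite fineK// fin_num_measure.
pose m2 : {measure set T -> \bar R} := mscale (NngNum PE0) P.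
suff -> : P (A `&` E) = m1 A.
  transitivity (m2 A); last by rewrite /m2 /= /mscale/= PEE muleC.
  apply: (@g_sigma_algebra_measure_unique _ _ T G mG (fun=> setT)) => //.
  - move=> k; exists (fun=> setT) => //; apply/seteqP; split => // w _ j _ //.
  - by rewrite bigcup_const//; exists 0%N.
  - move=> _ _ [X FX <-] [Y FY <-]; exists (fun j => X j `&` Y j).
      by move=> j; exact: FI.
    by rewrite bigcapI.
  - move=> _ [X FX <-]; rewrite /m1 /m2 /= /mrestr /mscale/=.
    rewrite (indF J X uJ (fun j _ => FX j)).
    have uiJ : uniq (i :: J) by apply/andP.
    have := indF (i :: J) (fun j => if j == i then E else X j) uiJ.
    rewrite big_cons eqxx => H.
    rewrite setIC (_ : _ `&` _ = \bigcap_(j in [set` i :: J]) (if j == i then E else X j)).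
      rewrite H; last by move=> j; case: eqP => [->//|_ _]; exact: FX.
      rewrite PEE; congr (_ * _)%E; apply: eq_big_seq => j jJ.
      by case: eqP => // ji; rewrite -ji jJ in iJ.
    apply/seteqP; split => w.
      move=> [Ew Xw] j; rewrite /= inE => /predU1P[->|jJ]; first by rewrite eqxx.
      by case: eqP => // _; exact: Xw.
    move=> H'; split; first by have := H' i; rewrite /= eqxx; apply; rewrite inE eqxx.
    move=> j jJ; have := H' j; rewrite /= inE jJ orbT => /(_ isT).
    by case: eqP => // ji; rewrite -ji jJ in iJ.
  - move=> k; by rewrite /m1/= /mrestr setTI ltey_eq fin_num_measure.
  - apply: (smallest_sub _ _ sA); first exact: smallest_sigma_algebra.
    move=> X [j jJ FX]; apply: sub_sigma_algebra.
    exists (fun k => if k == j then X else setT).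
      by move=> k /=; case: eqP => [->|_] //; exact: FT.
    apply/seteqP; split => w; first by move=> /(_ j jJ); rewrite eqxx.
    by move=> Xw k _; case: ifPn.
by [].
Qed.

(** The joint law is a product, so the two variables can be integrated one after the other, and W
    may be replaced by any W' with the same law. *)
Lemma independent_integral d1 d2 (X1 : measurableType d1) (X2 : measurableType d2)
    (U : T -> X1) (W W' : T -> X2) (f : X1 * X2 -> \bar R) :
  measurable_fun [set: T] U -> measurable_fun [set: T] W ->
  measurable_fun [set: T] W' ->
  (forall A B, measurable A -> measurable B ->
    P (U @^-1` A `&` W @^-1` B) = (P (U @^-1` A) * P (W @^-1` B))%E) ->
  (forall B, measurable B -> P (W @^-1` B) = P (W' @^-1` B)) ->
  measurable_fun [set: X1 * X2] f -> (forall x, 0 <= f x)%E ->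
  (\int[P]_w f (U w, W w) = \int[P]_w \int[P]_w' f (U w, W' w'))%E.
Proof.
move=> mU mW mW' ind lawW mf f0.
have mUW : measurable_fun [set: T] (fun w => (U w, W w)) by exact: measurable_fun_pair.
pose Um : {mfun T >-> X1} := HB.pack U (isMeasurableFun.Build _ _ _ _ U mU).
pose Wm : {mfun T >-> X2} := HB.pack W (isMeasurableFun.Build _ _ _ _ W mW).
pose Wm' : {mfun T >-> X2} := HB.pack W' (isMeasurableFun.Build _ _ _ _ W' mW').
pose UWm : {mfun T >-> (X1 * X2)%type} :=
  HB.pack (fun w => (U w, W w)) (isMeasurableFun.Build _ _ _ _ _ mUW).
transitivity (\int[distribution P UWm]_z f z)%E.
  by rewrite ge0_integral_distribution.
transitivity (\int[(distribution P Um \x distribution P Wm)%E]_z f z)%E.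
  apply: eq_measure_integral => A mA _; apply/esym.
  by apply: product_measure_unique => // A1 A2 mA1 mA2; exact: ind.
rewrite fubini_tonelli1//.
transitivity (\int[distribution P Um]_x \int[distribution P Wm']_y f (x, y))%E.
  apply: eq_integral => x _; apply: eq_measure_integral => A mA _.
  exact: lawW.
rewrite ge0_integral_distribution//; last 2 first.
- exact: (measurable_fun_fubini_tonelli_F (m2 := distribution P Wm')).
- by move=> x; exact: integral_ge0.
apply: eq_integral => w _ /=; rewrite ge0_integral_distribution//.
exact: measurableT_comp.
Qed.

Lemma independent_integral_prod (I : choiceType) d' (X : measurableType d')
    (N : I -> T -> X) (h : I -> X -> \bar R) (J : seq I) :
  (forall i, measurable_fun [set: T] (N i)) ->
  mutually_independent P (fun i => g_sigma_algebra_preimage (N i)) ->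
  (forall i, measurable_fun [set: X] (h i)) -> (forall i x, 0 <= h i x)%E ->
  uniq J ->
  (\int[P]_w \prod_(i <- J) h i (N i w) = \prod_(i <- J) \int[P]_w h i (N i w))%E.
Proof.
move=> mN ind mh h0; elim: J => [_|i J IH /[dup] uiJ /andP[iJ uJ]].
  rewrite big_nil; under eq_integral do rewrite big_nil.
  rewrite integral_cst// [X in (_ * X)%E]probability_setT; exact: mule1.
rewrite big_cons -(IH uJ); under eq_integral do rewrite big_cons.
pose F j := g_sigma_algebra_preimage (N j).
have Fm j : F j `<=` measurable.
  by move=> _ [A mA <-]; exact: mN.
have FT j : F j setT by exists setT => //; rewrite setTI preimage_setT.
have FI j : setI_closed (F j).
  move=> _ _ [A mA <-] [A' mA' <-]; exists (A `&` A'); first exact: measurableI.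
  by rewrite !setTI preimage_setI.
pose G := \bigcup_(j in [set` J]) F j.
(* The sample space with the coarser sigma-algebra of the remaining variables. The identity into it
   acts as a single random element, so [independent_integral] separates [N i] from their whole
   product at once. *)
pose T1 := g_sigma_algebraType G.
have mG : <<s G >> `<=` measurable.
  by apply: smallest_sub => [|A [j _ /Fm]//]; exact: sigma_algebra_measurable.
have mid : measurable_fun [set: T] (id : T -> T1).
  by move=> _ A mA; rewrite setTI; exact: mG.
have mNT1 j : j \in J -> measurable_fun [set: T1] (N j : T1 -> X).
  move=> jJ _ A mA; rewrite setTI; apply: sub_sigma_algebra.
  by exists j => //; exists A => //; rewrite setTI.
pose f (z : T1 * X) : \bar R := (h i z.2 * \prod_(j <- J) h j (N j z.1))%E.
have mf : measurable_fun [set: T1 * X] f.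
  apply: emeasurable_funM; first exact: measurableT_comp.
  apply: emeasurable_prod_seq => j jJ.
  by apply: (measurableT_comp (mh j)); apply: (measurableT_comp (mNT1 j jJ)).
have p0 w : (0 <= \prod_(j <- J) h j (N j w))%E by apply: prode_ge0.
transitivity (\int[P]_w f (w, N i w))%E; first by [].
rewrite (@independent_integral _ _ T1 X id (N i) (N i) f)//; last 2 first.
- move=> A E mA mE; apply: (mutually_independent_generated ind uiJ) => //.
  by exists E => //; rewrite setTI.
- by move=> z; rewrite mule_ge0.
rewrite /f /= -ge0_integralZl//.
- apply: eq_integral => w _.
  rewrite ge0_integralZr//; last exact: measurableT_comp.
- by apply: emeasurable_prod_seq => j _; exact: measurableT_comp.
- by apply: integral_ge0.
Qed.

End independence.

(** * Averaging independent marks out of a product *)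

Section marked_sequence.
Context {disp : measure_display} {T : measurableType disp} {R : realType}.
Variable P : probability T R.
Context {d1 d2 : measure_display} {X1 : measurableType d1} {X2 : measurableType d2}.
Variables (xi : nat -> T -> X1) (mark : nat -> T -> X2) (mark0 : T -> X2).
Hypotheses (mxi : forall n, measurable_fun [set: T] (xi n))
  (mmark : forall n, measurable_fun [set: T] (mark n))
  (mmark0 : measurable_fun [set: T] mark0)
  (law_mark : forall n E, measurable E -> P (mark n @^-1` E) = P (mark0 @^-1` E))
  (indep : mutually_independent P (fun i : option nat =>
    if i is Some n then g_sigma_algebra_preimage (mark n)
    else <<s \bigcup_n g_sigma_algebra_preimage (xi n) >>)).
Variable v : X1 * X2 -> R.
Hypotheses (mv : measurable_fun [set: X1 * X2] v) (v01 : forall z, 0 <= v z <= 1).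

Let v_ge0 z : 0 <= v z. Proof. by case/andP: (v01 z). Qed.
Let v_le1 z : v z <= 1. Proof. by case/andP: (v01 z). Qed.

Definition mark_mean (x : X1) : R := fine (\int[P]_w (v (x, mark0 w))%:E).

Let Ev_ge0 x : (0 <= \int[P]_w (v (x, mark0 w))%:E)%E.
Proof. by apply: integral_ge0 => w _; rewrite lee_fin. Qed.

Let mvx x : measurable_fun [set: T] (fun w => v (x, mark0 w)).
Proof. by apply: (measurableT_comp mv); exact: measurable_fun_pair. Qed.

Let Ev_le1 x : (\int[P]_w (v (x, mark0 w))%:E <= 1)%E.
Proof.
apply: (@le_trans _ _ (\int[P]_w (cst 1%E w))%E); last first.
  by rewrite integral_cst// [X in (_ * X)%E]probability_setT mule1.
apply: ge0_le_integral => //.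
- by move=> w _; rewrite lee_fin.
- by apply/measurable_EFinP; exact: mvx.
- by move=> w _; rewrite lee_fin.
Qed.

Lemma mark_meanE x : (\int[P]_w (v (x, mark0 w))%:E = (mark_mean x)%:E)%E.
Proof.
rewrite fineK// ge0_fin_numE//; exact: le_lt_trans (Ev_le1 x) (ltry 1).
Qed.

Lemma mark_mean01 x : 0 <= mark_mean x <= 1.
Proof. by rewrite -!lee_fin -mark_meanE Ev_ge0 Ev_le1. Qed.

Lemma measurable_mark_mean : measurable_fun [set: X1] mark_mean.
Proof.
apply: (measurableT_comp (fine_measurable measurableT)).
have mf : measurable_fun [set: X1 * T] (fun z : X1 * T => (v (z.1, mark0 z.2))%:E).
  apply/measurable_EFinP; apply: (measurableT_comp mv).
  by apply: measurable_fun_pair => //; exact: measurableT_comp.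
apply: (@measurable_fun_fubini_tonelli_F _ _ X1 T R P _ mf) => z /=.
by rewrite lee_fin.
Qed.

(** A hybrid of the two sides: marks with index below m are kept, the others are replaced by their
    mean at the given position. [step] trades one mark for its mean. *)
Let mixed m n w := if (n < m)%N then v (xi n w, mark n w) else mark_mean (xi n w).

Let step M m : (m < M)%N ->
  (\int[P]_w (\prod_(0 <= n < M) mixed m.+1 n w)%:E =
   \int[P]_w (\prod_(0 <= n < M) mixed m n w)%:E)%E.
Proof.
move=> mM.
pose F (i : option nat) : set_system T :=
  if i is Some n then g_sigma_algebra_preimage (mark n)
  else <<s \bigcup_n g_sigma_algebra_preimage (xi n) >>.
(* The other factors of the hybrid product involve only the positions and the marks of index below
   m, all independent of the mark m. *)
pose J := None :: [seq Some n | n <- iota 0 m].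
have uJ : uniq (Some m :: J).
  have inj : injective (@Some nat) by move=> ? ? [].
  rewrite /J !cons_uniq inE/= (mem_map inj) mem_iota add0n ltnn/=.
  rewrite (map_inj_uniq inj) iota_uniq andbT.
  by apply/negP => /mapP[].
have sF i : sigma_algebra setT (F i).
  case: i => [n|]; last exact: smallest_sigma_algebra.
  have := @sigma_algebra_measurable _ (g_sigma_algebra_preimageType (mark n)).
  by [].
have Fm i : F i `<=` measurable.
  case: i => [n|]; first by move=> _ [A mA <-]; exact: mmark.
  apply: smallest_sub; first exact: sigma_algebra_measurable.
  by move=> _ [n _ [A mA <-]]; exact: mxi.
have FT i : F i setT.
  by have [F0 FC _] := sF i; have := FC _ F0; rewrite setD0.
have FI i : setI_closed (F i).
  case: i => [n|].
    move=> _ _ [A mA <-] [A' mA' <-]; exists (A `&` A'); first exact: measurableI.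
    by rewrite !setTI preimage_setI.
  exact: (@measurableI _ (g_sigma_algebraType (\bigcup_n g_sigma_algebra_preimage (xi n)))).
pose G := \bigcup_(j in [set` J]) F j.
pose T1 := g_sigma_algebraType G.
have mG : <<s G >> `<=` measurable.
  by apply: smallest_sub => [|A [j _ /Fm]//]; exact: sigma_algebra_measurable.
have mid : measurable_fun [set: T] (id : T -> T1).
  by move=> _ A mA; rewrite setTI; exact: mG.
have mxi1 n : measurable_fun [set: T1] (xi n : T1 -> X1).
  move=> _ A mA; rewrite setTI; apply: sub_sigma_algebra.
  exists None => //; apply: sub_sigma_algebra; exists n => //.
  by exists A => //; rewrite setTI.
have mmark1 n : (n < m)%N -> measurable_fun [set: T1] (mark n : T1 -> X2).
  move=> nm _ A mA; rewrite setTI; apply: sub_sigma_algebra.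
  exists (Some n); last by exists A => //; rewrite setTI.
  by rewrite /= inE/= mem_map ?mem_iota// => a b [].
pose a w := \prod_(n <- index_iota 0 M | n != m) mixed m n w.
have ma : measurable_fun [set: T1] (a : T1 -> R).
  rewrite /a; under eq_fun do rewrite -big_filter.
  apply: measurable_prod => n _; rewrite /mixed; case: ltnP => nm.
    by apply: (measurableT_comp mv); apply: measurable_fun_pair => //; exact: mmark1.
  exact: (measurableT_comp measurable_mark_mean).
have a0 w : 0 <= a w.
  apply: prodr_ge0 => n _; rewrite /mixed; case: ifPn => // _.
  by case/andP: (mark_mean01 (xi n w)).
have prodE m' : (m' = m \/ m' = m.+1) -> forall w,
    \prod_(0 <= n < M) mixed m' n w = mixed m' m w * a w.
  move=> m'E w; rewrite (bigD1_seq m) ?mem_index_iota ?iota_uniq//=.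
  congr (_ * _); apply: eq_bigr => n nm; rewrite /mixed.
  case: m'E => -> //; rewrite ltnS leq_eqVlt (negbTE nm)//.
under eq_integral do rewrite (prodE m.+1 (or_intror erefl)).
under [RHS]eq_integral do rewrite (prodE m (or_introl erefl)).
pose f (z : T1 * X2) : \bar R := (v (xi m z.1, z.2) * a z.1)%:E.
have mf : measurable_fun [set: T1 * X2] f.
  apply/measurable_EFinP; apply: measurable_funM; last exact: measurableT_comp.
  apply: (measurableT_comp mv); apply: measurable_fun_pair => //.
  exact: (measurableT_comp (mxi1 m)).
transitivity (\int[P]_w f (w, mark m w))%E.
  by apply: eq_integral => w _; rewrite /mixed ltnSn.
rewrite (@independent_integral _ _ _ P _ _ T1 X2 id (mark m) mark0 f)//; last 3 first.
- move=> A E mA mE; apply: (mutually_independent_generated indep uJ) => //.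
  by exists E => //; rewrite setTI.
- exact: law_mark.
- by move=> z; rewrite lee_fin mulr_ge0.
apply: eq_integral => w _; rewrite /f /= /mixed ltnn.
under eq_integral do rewrite EFinM.
rewrite ge0_integralZr//; first by rewrite mark_meanE.
- by apply/measurable_EFinP; exact: mvx.
- by move=> w' _; rewrite lee_fin.
- by rewrite lee_fin.
Qed.

Lemma marked_expectation M :
  (\int[P]_w (\prod_(0 <= n < M) v (xi n w, mark n w))%:E =
   \int[P]_w (\prod_(0 <= n < M) mark_mean (xi n w))%:E)%E.
Proof.
transitivity (\int[P]_w (\prod_(0 <= n < M) mixed M n w)%:E)%E.
  apply: eq_integral => w _; congr EFin; apply: eq_big_nat => n /andP[_ nM].
  by rewrite /mixed nM.
have H m : (m <= M)%N -> (\int[P]_w (\prod_(0 <= n < M) mixed m n w)%:E =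
    \int[P]_w (\prod_(0 <= n < M) mixed 0 n w)%:E)%E.
  by elim: m => // m IH mM; rewrite step// IH// ltnW.
by rewrite H.
Qed.

Lemma marked_prod_lim_expectation :
  (\int[P]_w (prod_lim (fun n => v (xi n w, mark n w)))%:E =
   \int[P]_w (prod_lim (fun n => mark_mean (xi n w)))%:E)%E.
Proof.
have c1 : (\int[P]_w (\prod_(0 <= n < M) v (xi n w, mark n w))%:E @[M --> \oo] -->
    \int[P]_w (prod_lim (fun n => v (xi n w, mark n w)))%:E)%E.
  apply: (@expectation_cvg _ _ _ P (fun M w => \prod_(0 <= n < M) v (xi n w, mark n w))).
  - move=> M; apply: measurable_prod => n _.
    by apply: (measurableT_comp mv); exact: measurable_fun_pair.
  - by move=> M w; exact: prod01.
  - by move=> w; exact: prod_lim_cvg.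
have c2 : (\int[P]_w (\prod_(0 <= n < M) mark_mean (xi n w))%:E @[M --> \oo] -->
    \int[P]_w (prod_lim (fun n => mark_mean (xi n w)))%:E)%E.
  apply: (@expectation_cvg _ _ _ P (fun M w => \prod_(0 <= n < M) mark_mean (xi n w))).
  - move=> M; apply: measurable_prod => n _.
    exact: (measurableT_comp measurable_mark_mean).
  - by move=> M w; apply: prod01 => n; exact: mark_mean01.
  - by move=> w; apply: prod_lim_cvg => n; exact: mark_mean01.
rewrite -(funext marked_expectation) in c2.
exact: (cvg_unique _ c1 c2).
Qed.

End marked_sequence.

(** * The Laplace functional of a Poisson process *)

Section point_enumeration.
Context {R : realType} {d : nat}.
Local Notation V := 'rV[R]_d.
Variable x : nat -> V.
Hypothesis xinj : injective x.

(** By injectivity exactly k indices fall in A. Beyond the last of them every factor is 1, so the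
    partial products are eventually constant. *)
Lemma prod_thinning_near (A : set V) (c : R) (k : nat) :
  counting (range x `&` A) = k%:R%:E :> \bar R ->
  \forall M \near \oo, \prod_(0 <= n < M) (1 - c * \1_A (x n)) = (1 - c) ^+ k.
Proof.
pose S := [set n | A (x n)].
have SE : x @` S = range x `&` A.
  apply/seteqP; split => y; first by move=> [n Sn <-]; split => //; exists n.
  by move=> [[n _ <-] An]; exists n.
rewrite -SE /counting; case: asboolP => // fxS [] /eqP; rewrite eqr_nat => /eqP <-.
have fS : finite_set S.
  by rewrite (eq_finite_set (inj_card_eq (A := S) (f := x) _)) in fxS => // ? ? _ _; exact: xinj.
have [m mS] : exists m, forall n, S n -> (n < m)%N.
  have [s sE] := (finite_seqP _).1 fS.
  exists (\max_(n <- s) n).+1 => n; rewrite sE/= => ns.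
  by rewrite ltnS; exact: leq_bigmax_seq.
exists m => // M /= mM.
rewrite (eq_bigr (fun n => if n \in S then 1 - c else 1)); last first.
  move=> n _; rewrite indicE; case: ifPn => [/set_mem Sn|nS].
    by rewrite mem_set// mulr1.
  rewrite memNset ?mulr0 ?subr0// => An; move/negP : nS; apply.
  exact: mem_set.
rewrite -big_mkcond/= -big_filter big_const_seq.
rewrite count_predT iter_mulr_1; congr (_ ^+ _).
rewrite fset_set_image// card_imfset//=.
apply: perm_size; apply: uniq_perm.
- by rewrite filter_uniq// iota_uniq.
- exact: fset_uniq.
move=> n; rewrite mem_filter mem_index_iota in_fset_set//=.
have [nS|//] := boolP (n \in S).
by rewrite (leq_trans (mS n (set_mem nS)) mM).
Qed.

End point_enumeration.

Section poisson_pgf.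
Context {R : realType}.
Local Open Scope ereal_scope.

(** The power z ^ N of an extended real count N, as a series over its possible values so that its
    expectation is computed term by term. It is 0 at +oo. *)
Definition pgf_fun (z : R) (x : \bar R) : \bar R :=
  \sum_(k <oo) (z ^+ k * \1_[set k%:R%:E] x)%:E.

Lemma pgf_fun_nat z k : pgf_fun z k%:R%:E = (z ^+ k)%:E.
Proof.
apply/cvg_lim => //; apply: cvg_near_cst; exists k.+1 => //= n kn.
rewrite (bigD1_seq k) ?mem_index_iota ?iota_uniq//= big1 ?adde0.
  by rewrite indicE mem_set// mulr1.
move=> i ik; rewrite indicE memNset ?mulr0//= => -[] /eqP.
by rewrite eqr_nat eq_sym (negbTE ik).
Qed.

Lemma pgf_fun_ge0 z x : (0 <= z)%R -> 0 <= pgf_fun z x.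
Proof.
by move=> z0; apply: nneseries_ge0 => k _ _; rewrite lee_fin mulr_ge0// exprn_ge0.
Qed.

Lemma measurable_pgf_term (z : R) (k : nat) :
  measurable_fun [set: \bar R] (fun x : \bar R => (z ^+ k * \1_[set (k%:R%:E : \bar R)] x)%:E).
Proof.
by apply/measurable_EFinP; apply: measurable_funM.
Qed.

Lemma measurable_pgf_fun z : (0 <= z)%R -> measurable_fun [set: \bar R] (pgf_fun z).
Proof.
move=> z0; apply: ge0_emeasurable_sum => [k x _ _|k _].
  by rewrite lee_fin mulr_ge0// exprn_ge0.
exact: measurable_pgf_term.
Qed.

Lemma poisson_pgf (r z : R) : (0 <= r)%R -> (0 <= z)%R ->
  \sum_(k <oo) (z ^+ k)%:E * poisson_prob r 0 [set k] = (expR (- (r * (1 - z))))%:E.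
Proof.
rewrite le_eqVlt => /predU1P[<-|r0] z0.
  rewrite mul0r oppr0 expR0; apply/cvg_lim => //; apply: cvg_near_cst.
  exists 1%N => // -[//|n] _; rewrite big_nat_recl//= big1 ?adde0.
    by rewrite /poisson_prob ltxx diracE mem_set// mule1.
  move=> k _; rewrite /poisson_prob ltxx diracE memNset ?mule0//.
transitivity (\sum_(k <oo) ((expR (- r))%:E * ((z * r) ^+ k * k`!%:R^-1)%:E)).
  apply: eq_eseriesr => k _.
  rewrite /poisson_prob r0 esum_set1 ?lee_fin ?poisson_pmf_ge0//.
  rewrite /poisson_pmf r0 -!EFinM; congr EFin; rewrite exprMn; ring.
rewrite nneseriesZl/=; last first.
  by move=> k _; rewrite lee_fin divr_ge0// exprn_ge0// mulr_ge0// ltW.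
have -> : \sum_(k <oo) ((z * r) ^+ k * k`!%:R^-1)%:E = (expR (z * r))%:E.
  rewrite expRE -EFin_lim; last first.
    rewrite /pseries/=; under eq_fun do rewrite mulrC.
    exact: is_cvg_series_exp_coeff.
  apply/congr_lim/funext => n/=; rewrite /pseries/= /series/= -sumEFin//.
  by under eq_bigr do rewrite mulrC.
by rewrite -EFinM -expRD; congr (expR _)%:E; ring.
Qed.

End poisson_pgf.

Section poisson_laplace.
Context {disp : measure_display} {T : measurableType disp} {R : realType}.
Variable P : probability T R.
Context {d : nat}.
Local Notation V := 'rV[R]_d.
Local Notation Leb := (@lebesgue_rV R d).
Variables (lambda : R) (Pi : T -> set V) (xi : nat -> T -> V).
Hypotheses (lambda_gt0 : 0 < lambda)
  (poissonPi : stationary_poisson_process P lambda Pi)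
  (mxi : forall n, measurable_fun [set: T] (xi n))
  (xiP : {ae P, forall w, injective (xi ^~ w) /\ Pi w = range (xi ^~ w)}).

Let N (A : set V) (w : T) : \bar R := counting (Pi w `&` A).

Let mN A : measurable A -> measurable_fun [set: T] (N A).
Proof.
move=> mA; have [[mPi _] _ _] := poissonPi.
exact: (measurable_counting mPi mA).
Qed.

Let mNk A k : measurable A -> measurable [set w | N A w = k%:R%:E].
Proof.
move=> mA; rewrite -[X in measurable X]setTI.
exact: (mN mA measurableT (emeasurable_set1 _)).
Qed.

Let rate_ge0 (A : set V) : 0 <= lambda * fine (Leb A).
Proof. by rewrite mulr_ge0 ?fine_ge0 ?measure_ge0// ltW. Qed.

Lemma poisson_count_pgf (A : set V) (z : R) : measurable A -> (Leb A < +oo)%E ->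
  0 <= z ->
  (\int[P]_w pgf_fun z (N A w) = (expR (- (lambda * fine (Leb A) * (1 - z))))%:E)%E.
Proof.
move=> mA Afin z0; have [_ HP _] := poissonPi.
rewrite -(poisson_pgf (rate_ge0 A) z0).
rewrite /pgf_fun integral_nneseries//; last 2 first.
- by move=> k; apply: (measurableT_comp (@measurable_pgf_term R z k)); exact: mN.
- by move=> k w _; rewrite lee_fin mulr_ge0// exprn_ge0.
apply: eq_eseriesr => k _; rewrite -HP//.
under eq_integral do rewrite EFinM.
have -> : (fun w => (z ^+ k)%:E * (\1_[set k%:R%:E] (N A w))%:E)%E =
    (fun w => (z ^+ k)%:E * (\1_[set w | N A w = k%:R%:E] w)%:E)%E.
  by [].
rewrite ge0_integralZl//; last 2 first.
- by apply/measurable_EFinP; apply: measurable_indic; exact: mNk.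
- by rewrite lee_fin exprn_ge0.
by rewrite integral_indic ?setIT//; exact: mNk.
Qed.

(** Local finiteness controls bounded sets only. For a set of finite volume, the Poisson
    probabilities of the finite values add up to 1. *)
Lemma poisson_count_fin (A : set V) : measurable A -> (Leb A < +oo)%E ->
  {ae P, forall w, exists k : nat, N A w = k%:R%:E}.
Proof.
move=> mA Afin; have [_ HP _] := poissonPi.
have mU : measurable (\bigcup_(k in [set: nat]) [set w | N A w = k%:R%:E]).
  by apply: bigcupT_measurable => k; exact: mNk.
exists (~` \bigcup_(k in [set: nat]) [set w | N A w = k%:R%:E]); split.
- exact: measurableC.
- rewrite probability_setC//.
  have tN : trivIset [set: nat] (fun k : nat => [set w | N A w = k%:R%:E]).
    apply/trivIsetP => i j _ _ ij; apply/seteqP; split => // w [/= -> []] /eqP.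
    by rewrite eqr_nat (negbTE ij).
  rewrite measure_bigcup//; last by move=> k _; exact: mNk.
  have : poisson_prob (lambda * fine (Leb A)) 0 (\bigcup_(k in [set: nat]) [set k]) = 1%E.
    rewrite (_ : \bigcup_(k in _) _ = setT); first exact: probability_setT.
    by apply/seteqP; split => // k _; exists k.
  rewrite measure_bigcup//; last first.
    by apply/trivIsetP => i j _ _ ij; apply/seteqP; split => // k [/= -> /eqP]; rewrite (negbTE ij).
  move=> H; rewrite [X in (1 - X)%E](_ : _ = 1%E) ?subee//.
  by rewrite -[RHS]H; apply: eq_eseriesr => k _; exact: HP.
- by move=> w /= nk [k _ Nk]; apply: nk; exists k.
Qed.

Section simple_laplace.
Variables (m : nat) (A : 'I_m -> set V) (c : 'I_m -> R).
Hypotheses (mA : forall i, measurable (A i)) (tA : trivIset [set: 'I_m] A)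
  (Afin : forall i, (Leb (A i) < +oo)%E) (c01 : forall i, 0 <= c i <= 1).

(** At most one term is nonzero at x. The product form lets the product over points be exchanged
    with the one over the sets A i, whose counts are independent. *)
Lemma disjoint_thinning (x : V) :
  1 - \sum_(i < m) c i * \1_(A i) x = \prod_(i < m) (1 - c i * \1_(A i) x).
Proof.
have [[i Aix]|nA] := pselect (exists i, A i x).
  have nAj j : j != i -> \1_(A j) x = 0 :> R.
    move=> ji; rewrite indicE memNset// => Ajx.
    by move/trivIsetP : tA => /(_ j i Logic.I Logic.I ji) /seteqP[+ _] => /(_ x); apply.
  rewrite (bigD1 i)//= big1 ?addr0; last by move=> j ji; rewrite nAj// mulr0.
  by rewrite (bigD1 i)//= big1 ?mulr1// => j ji; rewrite nAj// mulr0 subr0.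
have nAj j : \1_(A j) x = 0 :> R.
  by rewrite indicE memNset// => Ajx; apply: nA; exists j.
rewrite big1; last by move=> j _; rewrite nAj mulr0.
by rewrite big1 ?subr0// => j _; rewrite nAj mulr0 subr0.
Qed.

Lemma poisson_simple_laplace :
  (\int[P]_w (prod_lim (fun n => 1 - \sum_(i < m) c i * \1_(A i) (xi n w)))%:E =
   (expR (- (lambda * \sum_(i < m) c i * fine (Leb (A i)))))%:E)%E.
Proof.
have z0 i : 0 <= 1 - c i by rewrite subr_ge0; case/andP: (c01 i).
(* Almost surely the product over the points equals the product over i of (1 - c i) to the power of
   the number of points in A i. *)
transitivity (\int[P]_w \prod_(i < m) pgf_fun (1 - c i) (N (A i) w))%E.
  apply: ae_eq_integral => //.
  - apply/measurable_EFinP; apply: measurable_prod_lim => [n|n w].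
      apply: measurable_funB => //; apply: measurable_sum => i _.
      apply: measurable_funM => //.
      by apply: (measurableT_comp (measurable_indic (mA i))).
    rewrite disjoint_thinning; have f01 i : 0 <= 1 - c i * \1_(A i) (xi n w) <= 1.
      have /andP[c0 c1] := c01 i.
      by rewrite indicE; case: (_ \in _); rewrite ?mulr1 ?mulr0 ?subr0 ?lexx ?ler01// subr_ge0 c1 gerBl.
    apply/andP; split; first by apply: prodr_ge0 => i _; case/andP: (f01 i).
    elim/big_rec : _ => // i x _ x1; have /andP[f0 f1] := f01 i.
    by rewrite (le_trans (ler_wpM2l f0 x1))// mulr1.
  - apply: emeasurable_prod_seq => i _.
    by apply: (measurableT_comp (measurable_pgf_fun (z0 i))); exact: mN.
  have fin : {ae P, forall w, forall i, exists k : nat, N (A i) w = k%:R%:E}.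
    apply: filter_forall => i; exact: poisson_count_fin.
  apply: filterS2 fin xiP => w Nfin [inj PiE] _.
  have /choice[k kE] : forall i, exists k : nat, N (A i) w = k%:R%:E by [].
  rewrite (eq_bigr (fun i => ((1 - c i) ^+ k i)%:E)); last first.
    by move=> i _; rewrite kE pgf_fun_nat.
  rewrite prodEFin; congr EFin; apply/cvg_lim => //; apply: cvg_near_cst.
  have : \forall M \near \oo, forall i, \prod_(0 <= n < M) (1 - c i * \1_(A i) (xi n w)) =
      (1 - c i) ^+ k i.
    apply: filter_forall => i; apply: prod_thinning_near => //.
    by rewrite -kE /N PiE.
  apply: filterS => M HM.
  under eq_bigr do rewrite disjoint_thinning.
  by rewrite exchange_big/=; apply: eq_bigr.
have [_ _ indN] := poissonPi.
have := @independent_integral_prod _ _ _ P 'I_m _ (\bar R : measurableType _)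
  (fun i => N (A i)) (fun i => pgf_fun (1 - c i)) (index_enum 'I_m).
move=> ->//.
- rewrite (eq_bigr (fun i => (expR (- (lambda * fine (Leb (A i)) * c i)))%:E)).
    rewrite prodEFin -expR_sum; congr (expR _)%:E.
    by rewrite sumrN mulr_sumr; congr (- _); apply: eq_bigr => i _; ring.
  by move=> i _; rewrite poisson_count_pgf// subKr.
- by move=> i; exact: mN.
- exact: indN.
- by move=> i; exact: measurable_pgf_fun.
- by move=> i x; exact: pgf_fun_ge0.
- exact: index_enum_uniq.
Qed.

End simple_laplace.

Lemma poisson_nnsfun_laplace (s : {nnsfun V >-> R}) : (forall x, s x <= 1) ->
  (\int[Leb]_x (s x)%:E < +oo)%E ->
  (\int[P]_w (prod_lim (fun n => 1 - s (xi n w)))%:E =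
   (expR (- (lambda * fine (\int[Leb]_x (s x)%:E))))%:E)%E.
Proof.
move=> s1 sfin.
(* The value 0 is discarded: its level set may have infinite volume, and it contributes nothing to
   s. *)
pose vs := [seq r <- enum_fset (fset_set (range s)) | r != 0].
have uvs : uniq vs by exact/filter_uniq/fset_uniq.
have vs0 r : r \in vs -> r != 0 by rewrite mem_filter => /andP[].
have vsP x : s x != 0 -> s x \in vs.
  by move=> sx0; rewrite mem_filter sx0 in_fset_set//; apply/mem_set; exists x.
have vsr r : r \in vs -> exists x, r = s x.
  by rewrite mem_filter => /andP[_]; rewrite in_fset_set// => /set_mem[x _ <-]; exists x.
pose c (i : 'I_(size vs)) := vs`_i.
have cvs i : c i \in vs by exact: mem_nth.
pose A (i : 'I_(size vs)) : set V := s @^-1` [set c i].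
have mA i : measurable (A i).
  by rewrite /A -[X in measurable X]setTI; exact: measurable_funP.
have c01 i : 0 <= c i <= 1 by have [x ->] := vsr _ (cvs i); rewrite s1 andbT.
have tA : trivIset [set: 'I_(size vs)] A.
  apply/trivIsetP => i j _ _ ij; apply/seteqP; split => // x [Ai Aj].
  have : c i == c j by rewrite -Ai -Aj.
  by rewrite nth_uniq// => /eqP/val_inj ijE; rewrite ijE eqxx in ij.
have sE x : s x = \sum_(i < size vs) c i * \1_(A i) x.
  have [sx0|sx0] := eqVneq (s x) 0.
    rewrite sx0 big1// => i _; rewrite indicE memNset ?mulr0// => /= sxi.
    by have := vs0 _ (cvs i); rewrite -sxi sx0 eqxx.
  have ix : (index (s x) vs < size vs)%N by rewrite index_mem vsP.
  rewrite (bigD1 (Ordinal ix))//= big1 ?addr0.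
    by rewrite /c/= nth_index ?vsP// indicE mem_set ?mulr1//= /A/= /c/= nth_index ?vsP.
  move=> j ji; rewrite indicE memNset ?mulr0// => /= sxj; move/negP : ji; apply.
  by apply/eqP/val_inj => /=; rewrite sxj index_uniq.
have intE : (\int[Leb]_x (s x)%:E = \sum_(i < size vs) (c i)%:E * Leb (A i))%E.
  under eq_integral do rewrite sE -sumEFin.
  rewrite ge0_integral_sum//.
  - apply: eq_bigr => i _; under eq_integral do rewrite EFinM.
    rewrite ge0_integralZl//.
    + by rewrite integral_indic// setIT.
    + by apply/measurable_EFinP; exact: measurable_indic.
    + by rewrite lee_fin; case/andP: (c01 i).
  - by move=> i; apply/measurable_EFinP; apply: measurable_funM.
  - by move=> i x _; rewrite lee_fin mulr_ge0//; case/andP: (c01 i).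
have Afin i : (Leb (A i) < +oo)%E.
  have ci0 : 0 < c i.
    by rewrite lt_neqAle eq_sym vs0//; case/andP: (c01 i).
  have : ((c i)%:E * Leb (A i) < +oo)%E.
    apply: le_lt_trans sfin; rewrite intE (bigD1 i)//= leeDl//.
    by apply: sume_ge0 => j _; rewrite mule_ge0// lee_fin; case/andP: (c01 j).
  by rewrite ltNge; apply: contraTT; rewrite -!leNgt !leye_eq => /eqP ->; rewrite gt0_muley ?lte_fin.
rewrite (_ : fine _ = \sum_(i < size vs) c i * fine (Leb (A i))).
  rewrite -poisson_simple_laplace//; apply: eq_integral => w _.
  by congr (prod_lim _)%:E; apply/funext => n; rewrite sE.
rewrite intE (eq_bigr (fun i => (c i * fine (Leb (A i)))%:E)) ?sumEFin//.
by move=> i _; rewrite EFinM fineK// ge0_fin_numE.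
Qed.

(** Simple functions s k increase to u, but the infinite product and the limit in k do not commute
    for free. One inequality holds since the product decreases in its argument. For the other, the
    product is truncated at M factors, then k and afterwards M tend to infinity. *)
Lemma poisson_laplace (u : V -> R) : measurable_fun [set: V] u ->
  (forall x, 0 <= u x <= 1) -> (\int[Leb]_x (u x)%:E < +oo)%E ->
  (\int[P]_w (prod_lim (fun n => 1 - u (xi n w)))%:E =
   (expR (- (lambda * fine (\int[Leb]_x (u x)%:E))))%:E)%E.
Proof.
move=> mu u01 ufin.
have u0 x : 0 <= u x by case/andP: (u01 x).
have mu' : measurable_fun [set: V] (EFin \o u) by exact/measurable_EFinP.
have u0' x : (0 <= (EFin \o u) x)%E by rewrite lee_fin.
pose s := nnsfun_approx measurableT mu'.
have s_cvg x : s k x @[k --> \oo] --> u x.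
  have := @cvg_nnsfun_approx _ _ _ _ measurableT _ mu' (fun x _ => u0' x) x Logic.I.
  by move=> /fine_cvg.
have s_nd x : nondecreasing_seq (s ^~ x).
  by move=> m n mn; exact/lefP/nd_nnsfun_approx.
have s_le k x : s k x <= u x.
  rewrite -(cvg_lim _ (s_cvg x))//; apply: nondecreasing_cvgn_le => //.
  by apply/cvg_ex; exists (u x); exact: s_cvg.
have s1 k x : s k x <= 1 by rewrite (le_trans (s_le k x))//; case/andP: (u01 x).
have s_ge0 k x : 0 <= s k x by [].
have us01 k x : 0 <= 1 - s k x <= 1 by rewrite subr_ge0 s1 gerBl s_ge0.
have uu01 x : 0 <= 1 - u x <= 1 by rewrite subr_ge0 gerBl andbC u01.
have iu : Leb.-integrable setT (EFin \o u).
  apply/integrableP; split => //.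
  by under eq_integral do rewrite /= ger0_norm//.
have Icvg : (\int[Leb]_x (s k x)%:E)%E @[k --> \oo] --> (\int[Leb]_x (u x)%:E)%E.
  have [] := @dominated_convergence _ V R Leb setT measurableT
    (fun k x => (s k x)%:E) (EFin \o u) (EFin \o u).
  - by move=> k; apply/measurable_EFinP; exact: measurable_funPT.
  - by [].
  - by apply: aeW => x _; apply: cvg_EFin; [exact: nearW|exact: s_cvg].
  - by [].
  - by apply: aeW => x k _; rewrite abse_EFin lee_fin ger0_norm.
  - by [].
have Ifin k : (\int[Leb]_x (s k x)%:E < +oo)%E.
  apply: le_lt_trans ufin; apply: ge0_le_integral => //.
  - by move=> x _; rewrite lee_fin.
  - by apply/measurable_EFinP; exact: measurable_funPT.
  - by move=> x _; rewrite lee_fin.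
pose e k := expR (- (lambda * fine (\int[Leb]_x (s k x)%:E)%E)).
pose e0 := expR (- (lambda * fine (\int[Leb]_x (u x)%:E)%E)).
have e_cvg : (e k)%:E @[k --> \oo] --> e0%:E.
  apply: cvg_EFin; first exact: nearW.
  apply: continuous_cvg; first exact: continuous_expR.
  apply: cvgN; apply: cvgMl_tmp; apply: fine_cvg.
  rewrite fineK; first exact: Icvg.
  by rewrite ge0_fin_numE//; apply: integral_ge0 => x _; rewrite lee_fin.
have Wk k : (\int[P]_w (prod_lim (fun n => 1 - s k (xi n w)))%:E = (e k)%:E)%E.
  exact: poisson_nnsfun_laplace.
have mxu : forall n, measurable_fun [set: T] (fun w => 1 - u (xi n w)).
  by move=> n; apply: measurable_funB => //; exact: measurableT_comp.
have mxs k : forall n, measurable_fun [set: T] (fun w => 1 - s k (xi n w)).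
  move=> n; apply: measurable_funB => //.
  exact: (measurableT_comp (@measurable_funPT _ _ _ _ (s k)) (mxi n)).
apply/eqP; rewrite eq_le; apply/andP; split.
  apply: (cvge_to_ge e_cvg); apply: nearW => k; rewrite -Wk.
  apply: ge0_le_integral => //.
  - by move=> w _; rewrite lee_fin prod_lim_ge0.
  - by apply/measurable_EFinP; apply: measurable_prod_lim.
  - by apply/measurable_EFinP; apply: measurable_prod_lim.
  - by move=> w _; rewrite lee_fin; apply: le_prod_lim => // n; rewrite lerD2l lerN2.
have c1 : (\int[P]_w (\prod_(0 <= n < M) (1 - u (xi n w)))%:E @[M --> \oo] -->
    \int[P]_w (prod_lim (fun n => 1 - u (xi n w)))%:E)%E.
  apply: (@expectation_cvg _ _ _ P (fun M w => \prod_(0 <= n < M) (1 - u (xi n w)))).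
  - by move=> M; apply: measurable_prod => n _.
  - by move=> M w; exact: prod01.
  - by move=> w; exact: prod_lim_cvg.
apply: (cvge_to_ge c1); apply: nearW => M.
have c2 : (\int[P]_w (\prod_(0 <= n < M) (1 - s k (xi n w)))%:E @[k --> \oo] -->
    \int[P]_w (\prod_(0 <= n < M) (1 - u (xi n w)))%:E)%E.
  apply: (@expectation_cvg _ _ _ P (fun k w => \prod_(0 <= n < M) (1 - s k (xi n w)))).
  - by move=> k; apply: measurable_prod => n _.
  - by move=> k w; exact: prod01.
  - move=> w; elim: M {c1} => [|M IH].
      by under eq_fun do rewrite big_nil; rewrite big_nil; exact: cvg_cst.
    under eq_fun do rewrite big_nat_recr//=; rewrite big_nat_recr//=.
    by apply: cvgM => //; apply: cvgB; [exact: cvg_cst|exact: s_cvg].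
apply: (lee_cvg_to e_cvg c2); apply: nearW => k; rewrite -Wk.
apply: ge0_le_integral => //.
- by move=> w _; rewrite lee_fin prod_lim_ge0.
- by apply/measurable_EFinP; apply: measurable_prod_lim.
- by apply/measurable_EFinP; apply: measurable_prod => n _.
- by move=> w _; rewrite lee_fin; exact: prod_lim_le.
Qed.

End poisson_laplace.

(** * Functions concave in t ^ d *)

Section concave_in_power.
Context {R : realType} (d : nat) (d_gt0 : (0 < d)%N).
Variables (f : R -> R) (l : R).
Hypotheses (f0 : f 0 = 0)
  (f_conc : forall t1 t2 t3, 0 <= t1 -> t1 < t2 -> t2 < t3 ->
    (t2 ^+ d - t1 ^+ d) * f t3 + (t3 ^+ d - t2 ^+ d) * f t1 <=
    (t3 ^+ d - t1 ^+ d) * f t2)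
  (f_lim : f n.+1%:R / n.+1%:R ^+ d @[n --> \oo] --> l).

Let powlt (s t : R) : 0 <= s -> s < t -> s ^+ d < t ^+ d.
Proof. by move=> s0 st; rewrite ltrXn2r ?gtn_eqF// nnegrE (le_trans s0)// ltW. Qed.

(** Difference quotient of f in the variable t ^ d; [f_conc] is concavity in that variable with
    denominators cleared. *)
Let slope t h := (f (t + h) - f t) / ((t + h) ^+ d - t ^+ d).

(** By concavity [slope t] is nonincreasing in h, so for t > 0 this supremum is its limit as h
    decreases to 0. *)
Definition right_slope t := sup (slope t @` `]0, +oo[%classic).

Let slope_nonincreasing t h k : 0 <= t -> 0 < h -> h <= k -> slope t k <= slope t h.
Proof.
move=> t0 h0; rewrite le_eqVlt => /predU1P[->//|hk].
have th : t < t + h by rewrite ltrDl.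
have hk' : t + h < t + k by rewrite ltrD2l.
have H := f_conc t0 th hk'.
have p1 := powlt t0 th.
have p2 := powlt t0 (lt_trans th hk').
rewrite /slope ler_pdivrMr ?subr_gt0// mulrAC ler_pdivlMr ?subr_gt0//.
move: H; move: ((t + h) ^+ d) ((t + k) ^+ d) (t ^+ d) (f (t + h)) (f (t + k)) (f t) => a b c x y z.
lra.
Qed.

Let slope_le t h : 0 < t -> 0 < h -> slope t h <= f t / t ^+ d.
Proof.
move=> t0 h0; have th : t < t + h by rewrite ltrDl.
have := f_conc (lexx 0) t0 th; rewrite f0 expr0n gtn_eqF//= !subr0 mulr0 addr0 => H.
have p1 := powlt (ltW t0) th.
rewrite /slope ler_pdivrMr ?subr_gt0// mulrAC ler_pdivlMr ?exprn_gt0//.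
lra.
Qed.

Let has_sup_slope t : 0 < t -> has_sup (slope t @` `]0, +oo[%classic).
Proof.
move=> t0; split; first by exists (slope t 1), 1 => //=; rewrite in_itv/= ltr01.
exists (f t / t ^+ d) => _ [h /= +] <-; rewrite in_itv/= andbT => h0.
exact: slope_le.
Qed.

Lemma right_slope_le t : 0 < t -> right_slope t <= f t / t ^+ d.
Proof.
move=> t0; apply: ge_sup; first by case: (has_sup_slope t0).
by move=> _ [h /= +] <-; rewrite in_itv/= andbT => h0; exact: slope_le.
Qed.

Let inv_pow_cvg0 : (n.+1%:R ^+ d)^-1 @[n --> \oo] --> (0 : R).
Proof.
rewrite (_ : 0 = 0 ^+ d :> R); last by rewrite expr0n gtn_eqF.
under eq_fun do rewrite -exprVn.
exact: (cvg_comp _ _ (@cvg_harmonic R) (@exprn_continuous R d 0)).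
Qed.

(** The slope at infinity is a lower bound for all slopes: the concavity inequality at t, t + 1 and
    n + 1 is divided by (n + 1) ^ d, and n tends to infinity. The increment 1 is arbitrary. *)
Lemma right_slope_ge t : 0 < t -> l <= right_slope t.
Proof.
move=> t0.
have ts : t < t + 1 by rewrite ltrDl.
have H : ((t + 1) ^+ d - t ^+ d) * l + f t <= f (t + 1).
  pose u n : R := n.+1%:R ^+ d.
  have cl : ((t + 1) ^+ d - t ^+ d) * (f n.+1%:R / u n) +
      (1 - (t + 1) ^+ d * (u n)^-1) * f t @[n --> \oo] -->
      ((t + 1) ^+ d - t ^+ d) * l + (1 - (t + 1) ^+ d * 0) * f t.
    apply: cvgD; first exact: cvgMl_tmp.
    by apply: cvgMr_tmp; apply: cvgB; [exact: cvg_cst|exact: cvgMl_tmp].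
  have cr : (1 - t ^+ d * (u n)^-1) * f (t + 1) @[n --> \oo] -->
      (1 - t ^+ d * 0) * f (t + 1).
    by apply: cvgMr_tmp; apply: cvgB; [exact: cvg_cst|exact: cvgMl_tmp].
  rewrite !mulr0 !subr0 !mul1r in cl cr.
  apply: (ler_cvg_to cl cr).
  exists (Num.truncn (t + 1)).+1 => // n /= tn.
  have sn : t + 1 < n.+1%:R.
    rewrite (lt_trans (truncnS_gt _))// ltr_nat ltnS.
    exact: tn.
  have un0 : 0 < u n by rewrite exprn_gt0// ltr0n.
  have := f_conc (ltW t0) ts sn; rewrite -/(u n) => HH.
  rewrite -(ler_pM2r un0).
  have un1 : u n != 0 by rewrite gt_eqF.
  have -> : (((t + 1) ^+ d - t ^+ d) * (f n.+1%:R / u n) +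
      (1 - (t + 1) ^+ d * (u n)^-1) * f t) * u n =
    ((t + 1) ^+ d - t ^+ d) * f n.+1%:R + (u n - (t + 1) ^+ d) * f t by field.
  by have -> : (1 - t ^+ d * (u n)^-1) * f (t + 1) * u n = (u n - t ^+ d) * f (t + 1) by field.
have : l <= slope t 1.
  have p := powlt (ltW t0) ts.
  rewrite /slope ler_pdivlMr ?subr_gt0//.
  by move: H; lra.
move=> /le_trans; apply; apply: ub_le_sup; first by case: (has_sup_slope t0).
by exists 1 => //=; rewrite in_itv/= ltr01.
Qed.

(** Chain rule through t ^ d; the quotient in t ^ d converges because it is monotone in h and
    bounded above. *)
Lemma right_derivative_concave_in_power t : 0 < t ->
  h^-1 * (f (t + h) - f t) @[h --> 0^'+] --> d%:R * t ^+ d.-1 * right_slope t.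
Proof.
move=> t0.
have cs : slope t h @[h --> 0^'+] --> right_slope t.
  apply: nonincreasing_at_right_cvgr => //.
    move=> h k; rewrite !in_itv/= !andbT => h0 k0 hk.
    by apply: slope_nonincreasing => //; exact: ltW.
  by case: (has_sup_slope t0).
have cd : h^-1 * ((t + h) ^+ d - t ^+ d) @[h --> 0^'+] --> d%:R * t ^+ d.-1.
  have cD : h^-1 *: (((@GRing.exp R ^~ d) \o shift t) (h *: 1) - t ^+ d)
      @[h --> 0^'] --> d%:R *: t ^+ d.-1 *: (1 : R).
    by rewrite -exp_derive; exact: exprn_derivable.
  have right_dnbhs : (0 : R)^'+ --> (0 : R)^'.
    by move=> A [e e0 He]; exists e => // x xe x0; apply: He => //; rewrite gt_eqF.
  have {cD} := cvg_trans (cvg_app _ right_dnbhs) cD.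
  rewrite (_ : d%:R *: _ *: _ = d%:R * t ^+ d.-1); last by rewrite [LHS]mulr1.
  rewrite (_ : (fun h => _) = (fun h => h^-1 * ((t + h) ^+ d - t ^+ d)))//.
  by apply/funext => h /=; rewrite [h *: 1]mulr1 [h + t]addrC.
apply: cvg_trans (cvgM cd cs).
apply: near_eq_cvg; near=> h.
have h0 : 0 < h by near: h; exact: nbhs_right_gt.
have p : (t + h) ^+ d - t ^+ d != 0 by rewrite gt_eqF// subr_gt0 powlt ?ltW// ltrDl.
rewrite /slope /=; move: p; move: ((t + h) ^+ d - t ^+ d) => q p.
by field; rewrite p gt_eqF.
Unshelve. all: by end_near. Qed.

(** [right_slope t] lies between l and f t / t ^ d, and this ratio is nonincreasing by concavity and
    f 0 = 0. Closeness to l at one integer therefore persists beyond it, so a limit along integers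
    is enough. *)
Lemma right_slope_cvg : right_slope t @[t --> +oo] --> l.
Proof.
apply/cvgrPdist_lt => e e0.
have [n _ Hn] : \forall n \near \oo, `|l - f n.+1%:R / n.+1%:R ^+ d| < e.
  by move/cvgrPdist_lt : f_lim => /(_ e e0).
have {}Hn := Hn n (leqnn n).
near=> t.
have nt : n.+1%:R < t by near: t; exact: nbhs_pinfty_gt.
have t0 : 0 < t by rewrite (lt_trans _ nt)// ltr0n.
rewrite ler0_norm ?subr_le0 ?right_slope_ge// opprB.
apply: le_lt_trans Hn; rewrite distrC; apply: le_trans (ler_norm _).
rewrite lerD2r (le_trans (right_slope_le t0))//.
have n0 : 0 < n.+1%:R :> R by rewrite ltr0n.
have := f_conc (lexx 0) n0 nt; rewrite f0 expr0n gtn_eqF//= !subr0 mulr0 addr0 => H.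
by rewrite ler_pdivrMr ?exprn_gt0// mulrAC ler_pdivlMr ?exprn_gt0// mulrC (le_trans H)// mulrC.
Unshelve. all: by end_near. Qed.

End concave_in_power.

Lemma xsection_setE (X Y : Type) (S : set (X * Y)) (x : X) :
  [set y | S (x, y)] = xsection S x.
Proof. by apply/predeqP => y; split => [H|/xsectionP//]; apply/xsectionP. Qed.

Lemma ysection_setE (X Y : Type) (S : set (X * Y)) (y : Y) :
  [set x | S (x, y)] = ysection S y.
Proof. by apply/predeqP => x; split => [H|/ysectionP//]; apply/ysectionP. Qed.

(** * The typical cluster *)

Section typical_cluster.
Context {disp : measure_display} {T : measurableType disp} {R : realType}.
Variable P : probability T R.
Context {d : nat} (d_gt0 : (0 < d)%N) (B : set 'rV[R]_d).
Hypotheses (Bcompact : compact B) (Bconvex : convex_set B)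
  (B0 : nbhs (0 : 'rV[R]_d) B).
Local Notation V := 'rV[R]_d.
Local Notation g := (gauge B).
Local Notation Leb := (@lebesgue_rV R d).
Variables (L0 : T -> set V) (u0 : V).
Hypotheses (mL0 : random_points L0) (fL0 : forall w, finite_set (L0 w))
  (L0_fin : (mean_cluster_size P L0 < +oo)%E)
  (L0_ac : difference_measure P L0 `<< lebesgue_rV d).

Let mL0' : measurable_fun [set: T] (L0 : T -> @config R d). Proof. exact: mL0. Qed.

Let mLx disp' (Y : measurableType disp') (h : Y -> T) : measurable_fun [set: Y] h ->
  measurable_fun [set: Y] (fun y => L0 (h y) : @config R d).
Proof. by move=> mh; exact: (measurableT_comp mL0' mh). Qed.

Let tie_event : set (V * T) := [set z | tie_set B (L0 z.2) z.1].

Let measurable_tie_event : measurable tie_event.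
Proof.
have := measurable_tie Bcompact Bconvex B0 (X := (V * T)%type) (xi := fst)
  (kappa := fun z => L0 z.2).
by apply => //; apply: mLx.
Qed.

(** For a fixed x, a tie forces some difference k - z into the set of y with g (x + y) = g x, a
    translated gauge sphere. This set is null, so absolute continuity makes the mean number of such
    differences 0. *)
Lemma tie_event_null (x : V) : P [set w | tie_set B (L0 w) x] = 0%E.
Proof.
pose D := [set y : V | g (x + y) = g x].
have mg := measurable_gauge Bcompact Bconvex B0.
have mD : measurable D.
  apply: measurable_set_eq; last exact: measurable_cst.
  apply: (measurableT_comp mg); apply: measurable_funD_rV => //; exact: measurable_cst.
have D0 : Leb D = 0%E by exact: lebesgue_gauge_eq_translate.
have diff0 : difference_measure P L0 D = 0%E.
  have nD : Leb.-null_set D by apply/measure0_null_setP.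
  exact: (L0_ac nD mD (@subset_refl _ _)).
have mE : measurable [set w | tie_set B (L0 w) x].
  by rewrite [X in measurable X](xsection_setE tie_event); exact: measurable_xsection.
apply/eqP; rewrite eq_le measure_ge0 andbT -diff0 /difference_measure.
(* The integral is a supremum over simple functions below the integrand, and the indicator of the
   tie event is one of them, as a single tied pair already contributes 1 to the sum. *)
rewrite ge0_integralTE; last first.
  by move=> w; apply: esum_ge0 => p _; rewrite lee_fin.
apply: ereal_sup_ubound; exists (indic_nnsfun R mE); last exact: sintegral_indic.
move=> w; have -> : indic_nnsfun R mE w = \1_[set w | tie_set B (L0 w) x] w by [].
have [tw|ntw] := pselect (tie_set B (L0 w) x); last first.
  by rewrite indicE memNset//; apply: esum_ge0 => p _; rewrite lee_fin.
rewrite indicE mem_set//; case: tw => k Lk [z Lz [kz gkz]].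
apply: esum_ge; exists [set (k, z)].
  by split => // _ ->; split => //; exact/eqP.
by rewrite fsbig_set1/= indicE mem_set.
Qed.

(** [tie_event_null] fixes the position and varies the cluster; exchanging the integrals fixes the
    cluster instead. *)
Lemma ae_tieless : {ae P, forall w, tieless B (L0 w)}.
Proof.
pose f (z : V * T) : \bar R := (\1_tie_event z)%:E.
have mf : measurable_fun [set: V * T] f by exact/measurable_EFinP/measurable_indic.
have f0 z : (0 <= f z)%E by rewrite lee_fin.
have LE w : (\int[Leb]_x f (x, w) = Leb (tie_set B (L0 w)))%E.
  rewrite /f (_ : (fun x => _) = fun x => (\1_(tie_set B (L0 w)) x)%:E)//.
  rewrite integral_indic// ?setIT//.
  exact: (measurable_tie_set Bcompact Bconvex B0 (fL0 w)).
have mLE : measurable_fun [set: T] (fun w => Leb (tie_set B (L0 w))).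
  have := @measurable_fun_fubini_tonelli_G _ _ V T R Leb _ mf f0.
  by apply: eq_measurable_fun => w _; rewrite /fubini_G LE.
have int0 : (\int[P]_w Leb (tie_set B (L0 w)) = 0)%E.
  have := @fubini_tonelli _ _ V T R Leb P _ mf f0.
  under [in X in _ = X -> _]eq_integral do rewrite LE.
  move=> <-; apply: integral0_eq => x _.
  rewrite /f (_ : (fun w => _) = fun w => (\1_[set w | tie_set B (L0 w) x] w)%:E)//.
  have mE : measurable [set w | tie_set B (L0 w) x].
    by rewrite [X in measurable X](xsection_setE tie_event); exact: measurable_xsection.
  by rewrite integral_indic// setIT; exact: tie_event_null.
have := (ae_eq_integral_abs P measurableT mLE).1.
under eq_integral do rewrite gee0_abs//.
by move=> /(_ int0); apply: filterS => w /(_ Logic.I).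
Qed.

Definition hit_event (t : R) (C : set V) : set (V * @config R d) :=
  [set z | hit_dir_set B (finite_part z.2) u0 t C z.1].

Lemma measurable_hit_event t C : 0 <= t -> measurable C ->
  measurable (hit_event t C).
Proof.
move=> t0 mC.
have := measurable_rel_dir_event Bcompact Bconvex B0 (X := (V * @config R d)%type)
  (xi := fst) (kappa := fun z => finite_part z.2).
apply => //; last by move=> z; exact: finite_part_finite.
exact: (measurableT_comp measurable_finite_part).
Qed.

(* the intensity measure of the marked Poisson process, up to the factor lambda *)
Definition mark_intensity (S : set (V * @config R d)) : \bar R :=
  (\int[P]_w Leb [set x | S (x, L0 w)])%E.

Lemma measurable_mark_section (S : set (V * @config R d)) : measurable S ->
  measurable [set z : V * T | S (z.1, L0 z.2)].
Proof.
move=> mS; rewrite -[X in measurable X]setTI.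
have mh : measurable_fun [set: V * T] (fun z => (z.1, L0 z.2 : @config R d)).
  by apply: measurable_fun_pair => //; exact: mLx.
exact: mh.
Qed.

Let measurable_mark_slice (S : set (V * @config R d)) w : measurable S ->
  measurable [set x | S (x, L0 w)].
Proof.
move=> mS.
rewrite [X in measurable X](ysection_setE [set z : V * T | S (z.1, L0 z.2)]).
by apply: measurable_ysection; exact: measurable_mark_section.
Qed.

Let mark_integral_inner (S : set (V * @config R d)) w : measurable S ->
  (\int[Leb]_x (\1_S (x, L0 w : @config R d))%:E = Leb [set x | S (x, L0 w)])%E.
Proof.
move=> mS; rewrite (_ : (fun x => _) = fun x => (\1_[set x | S (x, L0 w)] x)%:E)//.
by rewrite integral_indic// ?setIT//; exact: measurable_mark_slice.
Qed.

Let mark_indicator (S : set (V * @config R d)) (z : V * T) : \bar R :=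
  (\1_S (z.1, L0 z.2 : @config R d))%:E.

Let measurable_mark_indicator S : measurable S ->
  measurable_fun [set: V * T] (mark_indicator S).
Proof.
move=> mS; apply/measurable_EFinP.
rewrite (_ : (fun z => _) = \1_[set z : V * T | S (z.1, L0 z.2)])//.
by apply: measurable_indic; exact: measurable_mark_section.
Qed.

Let mark_indicator_ge0 S z : (0 <= mark_indicator S z)%E.
Proof. by rewrite lee_fin. Qed.

Lemma measurable_fun_mark_volume (S : set (V * @config R d)) : measurable S ->
  measurable_fun [set: T] (fun w => Leb [set x | S (x, L0 w)]).
Proof.
move=> mS.
have := @measurable_fun_fubini_tonelli_G _ _ V T R Leb _
  (measurable_mark_indicator mS) (mark_indicator_ge0 S).
by apply: eq_measurable_fun => w _; rewrite /fubini_G mark_integral_inner.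
Qed.

(** The Laplace functional integrates over marks at a fixed position, while the geometry of a fixed
    cluster requires integrating over positions first. This exchanges the two orders. *)
Lemma mark_intensityE (S : set (V * @config R d)) : measurable S ->
  (\int[Leb]_x \int[P]_w (\1_S (x, L0 w : @config R d))%:E = mark_intensity S)%E.
Proof.
move=> mS.
have := @fubini_tonelli _ _ V T R Leb P _ (measurable_mark_indicator mS) (mark_indicator_ge0 S).
move=> ->; rewrite /mark_intensity; apply: eq_integral => w _.
exact: mark_integral_inner.
Qed.

Lemma mark_intensity_le (S S' : set (V * @config R d)) : measurable S ->
  measurable S' -> S `<=` S' -> (mark_intensity S <= mark_intensity S')%E.
Proof.
move=> mS mS' SS'; apply: ge0_le_integral => //.
- exact: measurable_fun_mark_volume.
- exact: measurable_fun_mark_volume.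
move=> w _; apply: le_measure; last by move=> x; exact: SS'.
- by apply/mem_set; exact: measurable_mark_slice.
- by apply/mem_set; exact: measurable_mark_slice.
Qed.

Lemma mark_intensityU (S S' : set (V * @config R d)) : measurable S ->
  measurable S' -> S `&` S' = set0 ->
  mark_intensity (S `|` S') = (mark_intensity S + mark_intensity S')%E.
Proof.
move=> mS mS' SS'; rewrite /mark_intensity -ge0_integralD//; last 2 first.
- exact: measurable_fun_mark_volume.
- exact: measurable_fun_mark_volume.
apply: eq_integral => w _; rewrite -measureU//; try exact: measurable_mark_slice.
apply/seteqP; split => // x /= Sx; have : set0 (x, L0 w) by rewrite -SS'.
by [].
Qed.

Local Notation vol := (fine (Leb [set y | (g y <= 1)%R])).

Let volE : Leb [set y | g y <= 1] = vol%:E.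
Proof. by rewrite fineK// (lebesgue_unit_body_fin Bcompact Bconvex B0). Qed.

Let slice_hit t C w : [set x | hit_event t C (x, L0 w)] = hit_dir_set B (L0 w) u0 t C.
Proof. by rewrite /hit_event/= finite_part_id. Qed.

Lemma mark_intensity_hitE t C :
  mark_intensity (hit_event t C) = (\int[P]_w Leb (hit_dir_set B (L0 w) u0 t C))%E.
Proof. by apply: eq_integral => w _; rewrite slice_hit. Qed.

Lemma mark_intensity_hit_fin t C : 0 <= t -> measurable C ->
  (mark_intensity (hit_event t C) < +oo)%E.
Proof.
move=> t0 mC; apply: (@le_lt_trans _ _ (mark_intensity (hit_event t setT))).
  apply: mark_intensity_le; [exact: measurable_hit_event|exact: measurable_hit_event|].
  by move=> z [].
apply: (@le_lt_trans _ _ (\int[P]_w (counting (L0 w) * (t ^+ d * vol)%:E))%E).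
  rewrite mark_intensity_hitE; apply: ge0_le_integral => //.
  - have := measurable_fun_mark_volume (measurable_hit_event t0 measurableT).
    by under eq_fun do rewrite slice_hit.
  - apply: emeasurable_funM => //.
    have := measurable_counting mL0' measurableT.
    by under eq_fun do rewrite setIT.
  - move=> w _; have := lebesgue_hit_dir_set_le d_gt0 Bcompact Bconvex B0 (fL0 w) u0 t0.
    by rewrite volE -EFinM.
rewrite ge0_integralZr//.
- rewrite lte_mul_pinfty ?integral_ge0 ?lee_fin//.
  + rewrite ge0_fin_numE; first exact: L0_fin.
    by apply: integral_ge0.
  + by rewrite ltry.
- have := measurable_counting mL0' measurableT.
  by under eq_fun do rewrite setIT.
- by rewrite lee_fin mulr_ge0 ?exprn_ge0 ?fine_ge0.
Qed.

Definition hit_intensity t C : R := fine (mark_intensity (hit_event t C)).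

Lemma hit_intensityE t C : 0 <= t -> measurable C ->
  mark_intensity (hit_event t C) = (hit_intensity t C)%:E.
Proof.
move=> t0 mC; rewrite fineK// ge0_fin_numE ?mark_intensity_hit_fin//.
by apply: integral_ge0.
Qed.

Let mhit t C : 0 <= t -> measurable C ->
  measurable_fun [set: T] (fun w => Leb (hit_dir_set B (L0 w) u0 t C)).
Proof.
move=> t0 mC; have := measurable_fun_mark_volume (measurable_hit_event t0 mC).
by under eq_fun do rewrite slice_hit.
Qed.

Lemma hit_intensity_concave C t1 t2 t3 : measurable C ->
  0 <= t1 -> t1 < t2 -> t2 < t3 ->
  (t2 ^+ d - t1 ^+ d) * hit_intensity t3 C + (t3 ^+ d - t2 ^+ d) * hit_intensity t1 C <=
  (t3 ^+ d - t1 ^+ d) * hit_intensity t2 C.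
Proof.
move=> mC t1_ge0 t12 t23.
have t2_ge0 : 0 <= t2 by rewrite (le_trans t1_ge0)// ltW.
have t3_ge0 : 0 <= t3 by rewrite (le_trans t2_ge0)// ltW.
have pow (s t : R) : 0 <= s -> s < t -> 0 <= t ^+ d - s ^+ d.
  by move=> s0 st; rewrite subr_ge0 lerXn2r ?nnegrE ?(ltW st)// (le_trans s0)// ltW.
have c21 := pow _ _ t1_ge0 t12; have c32 := pow _ _ t2_ge0 t23.
have c31 := pow _ _ t1_ge0 (lt_trans t12 t23).
rewrite -lee_fin EFinD !EFinM -!hit_intensityE// !mark_intensity_hitE.
rewrite -!ge0_integralZl//; try exact: mhit.
rewrite -ge0_integralD//; last 4 first.
- by move=> w _; rewrite mule_ge0.
- by apply: emeasurable_funM => //; exact: mhit.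
- by move=> w _; rewrite mule_ge0.
- by apply: emeasurable_funM => //; exact: mhit.
apply: ae_ge0_le_integral => //.
- by move=> w _; rewrite adde_ge0// mule_ge0.
- by apply: emeasurable_funD; apply: emeasurable_funM => //; exact: mhit.
- by move=> w _; rewrite mule_ge0.
- by apply: emeasurable_funM => //; exact: mhit.
apply: filterS ae_tieless => w tw _.
exact: hit_dir_set_shells.
Qed.

Lemma hit_intensity0 C : measurable C -> hit_intensity 0 C = 0.
Proof.
move=> mC; rewrite /hit_intensity mark_intensity_hitE integral0_eq// => w _.
apply/eqP; rewrite eq_le measure_ge0 andbT.
apply: (@le_trans _ _ (Leb (hit_dir_set B (L0 w) u0 0 setT))).
  apply: le_measure; last by move=> x [].
  - by apply/mem_set; exact: measurable_hit_dir_set.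
  - by apply/mem_set; exact: measurable_hit_dir_set.
apply: (le_trans (lebesgue_hit_dir_set_le d_gt0 Bcompact Bconvex B0 (fL0 w) u0 (lexx 0))).
by rewrite expr0n gtn_eqF// mul0e mule0.
Qed.

(** Growth rate per unit of t ^ d contributed asymptotically by a nonempty cluster. The factor d of
    [nu] is absent here; it appears on differentiating t ^ d. *)
Definition dir_volume C : R := fine (Leb (dir_cone B C `&` [set y | (g y <= 1)%R])).

Let nonempty_event : set T := [set w | L0 w !=set0].

Let measurable_nonempty : measurable nonempty_event.
Proof.
have mc := measurable_counting mL0' measurableT.
rewrite (_ : nonempty_event = ~` ((fun w => counting (L0 w `&` setT) : \bar R) @^-1` [set 0%E])).
  by apply: measurableC; rewrite -[X in measurable X]setTI; apply: mc.
apply/seteqP; split => w /=; rewrite setIT.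
  by move=> [x Lx] /counting_eq0 E0; rewrite E0 in Lx.
by move=> nE; apply/set0P/eqP => E0; apply: nE; apply/counting_eq0.
Qed.

Local Notation p0 := (fine (P nonempty_event)).

Let p0E : P nonempty_event = p0%:E.
Proof. by rewrite fineK// fin_num_measure. Qed.

Let dir_volumeE C : measurable C ->
  Leb (dir_cone B C `&` [set y | g y <= 1]) = (dir_volume C)%:E.
Proof.
move=> mC; rewrite fineK// ge0_fin_numE//.
apply: (lebesgue_gauge_le_fin Bcompact Bconvex B0 (t := 1)) => [|y []//].
apply: measurableI; first exact: measurable_dir_cone.
exact: measurable_gauge_le.
Qed.

Lemma dir_volumeC C : measurable C -> dir_volume C + dir_volume (~` C) = vol.
Proof.
move=> mC; have mCc := measurableC mC.
apply/EFin_inj; rewrite EFinD -!dir_volumeE//.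
have mD E : measurable E -> measurable (dir_cone B E `&` [set y | g y <= 1]).
  move=> mE; apply: measurableI; first exact: measurable_dir_cone.
  exact: measurable_gauge_le.
pose U := (dir_cone B C `&` [set y | g y <= 1]) `|`
  (dir_cone B (~` C) `&` [set y | g y <= 1]).
have mU : measurable U by apply: measurableU; exact: mD.
rewrite -measureU; [|exact: mD|exact: mD|].
  rewrite -volE; apply/eqP; rewrite eq_le; apply/andP; split.
    apply: le_measure; first exact/mem_set.
    - by apply/mem_set; exact: measurable_gauge_le.
    - by move=> y [[]//|[]//].
  (* The origin lies in no direction cone and is added back as a null set. *)
  apply: (@le_trans _ _ (Leb (U `|` [set 0]))); last first.
    apply: (le_trans (measureU2 _ _ _)) => //; first exact: measurable_rV1.
    by rewrite [X in (_ + X)%E](lebesgue_rV1 Bcompact Bconvex B0 d_gt0) adde0.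
  apply: le_measure.
  - by apply/mem_set; exact: measurable_gauge_le.
  - by apply/mem_set; apply: measurableU => //; exact: measurable_rV1.
  move=> y /= gy; have [->|y0] := eqVneq y 0; first by right.
  have gy0 := gauge_gt0 Bcompact Bconvex B0 y0; left.
  by have [Cy|nCy] := pselect (C (- (g y)^-1 *: y)); [left|right]; split.
by apply/seteqP; split => // y [[[_ Cy] _] [[_ nCy] _]]; apply: nCy.
Qed.

Lemma hit_intensity_ge t C : 0 <= t -> measurable C ->
  p0 * (t ^+ d * dir_volume C) <= hit_intensity t C.
Proof.
move=> t0 mC; rewrite -lee_fin -hit_intensityE// mark_intensity_hitE.
have c0 : (0 <= (t ^+ d * dir_volume C)%:E)%E.
  by rewrite lee_fin mulr_ge0 ?exprn_ge0 ?fine_ge0.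
have -> : (p0 * (t ^+ d * dir_volume C))%:E =
    (\int[P]_w ((\1_nonempty_event w)%:E * (t ^+ d * dir_volume C)%:E))%E.
  rewrite ge0_integralZr//; last by apply/measurable_EFinP/measurable_indic.
  by rewrite integral_indic// setIT [X in _ = (X * _)%E]p0E -EFinM.
apply: ae_ge0_le_integral => //.
- by move=> w _; rewrite mule_ge0.
- by apply: emeasurable_funM => //; apply/measurable_EFinP/measurable_indic.
- exact: mhit.
apply: filterS ae_tieless => w tw _.
have [Lw|nLw] := pselect (L0 w !=set0); last by rewrite indicE memNset// mul0e.
rewrite indicE mem_set// mul1e EFinM -dir_volumeE//.
exact: lebesgue_hit_dir_set_ge.
Qed.

Lemma hit_intensityC t C : 0 <= t -> measurable C ->
  hit_intensity t C + hit_intensity t (~` C) = hit_intensity t setT.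
Proof.
move=> t0 mC; have mCc := measurableC mC.
apply/EFin_inj; rewrite EFinD -!hit_intensityE//.
rewrite -mark_intensityU; [|exact: measurable_hit_event|exact: measurable_hit_event|].
  congr mark_intensity; apply/seteqP; split => z; first by move=> [[]|[]].
  move=> [dz _]; have [Cz|nCz] := pselect (C (rel_dir u0 B (translate (finite_part z.2) z.1) 0)).
    by left.
  by right.
by apply/seteqP; split => // z [[_ Cz] [_ nCz]]; apply: nCz.
Qed.

(** Dominated convergence over clusters, with the cluster size times [vol] as dominating function.
    For a nonempty cluster the ratio lies between [vol] and (1 + r / (n + 1)) ^ d [vol]; for an
    empty one it is 0. *)
Lemma hit_intensityT_lim :
  hit_intensity n.+1%:R setT / n.+1%:R ^+ d @[n --> \oo] --> p0 * vol.
Proof.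
pose s n : R := n.+1%:R.
have s0 n : 0 <= s n by [].
have sd0 n : 0 < s n ^+ d by rewrite exprn_gt0// ltr0n.
pose f n w : \bar R := ((s n ^+ d)^-1%:E * Leb (hit_dir_set B (L0 w) u0 (s n) setT))%E.
pose h w : \bar R := ((\1_nonempty_event w)%:E * vol%:E)%E.
have fE n : (\int[P]_w f n w = (hit_intensity (s n) setT / s n ^+ d)%:E)%E.
  rewrite ge0_integralZl//.
  - by rewrite -mark_intensity_hitE hit_intensityE// -EFinM mulrC.
  - exact: mhit.
  - by rewrite lee_fin invr_ge0 ltW.
have hE : (\int[P]_w h w = (p0 * vol)%:E)%E.
  rewrite ge0_integralZr//.
  - by rewrite integral_indic// setIT [X in (X * _)%E]p0E -EFinM.
  - by apply/measurable_EFinP/measurable_indic.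
  - by rewrite lee_fin fine_ge0.
have [] := @dominated_convergence _ T R P setT measurableT f h
  (fun w => counting (L0 w) * vol%:E)%E.
- by move=> n; apply: emeasurable_funM => //; exact: mhit.
- by apply: emeasurable_funM => //; apply/measurable_EFinP/measurable_indic.
- apply: aeW => w _.
  have [Lw|nLw] := pselect (L0 w !=set0); last first.
    rewrite /h indicE memNset// mul0e; apply: cvg_near_cst; apply: nearW => n.
    rewrite /f hit_dir_set0 ?measure0 ?mule0//.
    by apply/eqP; rewrite -(negbK (_ == _)); apply/negP => /set0P.
  rewrite /h indicE mem_set// mul1e.
  have [r r0 Hr] := lebesgue_hit_dir_setT_le d_gt0 Bcompact Bconvex B0 (fL0 w) u0.
  apply: (@squeeze_cvge _ _ _ _ (fun=> vol%:E) _ (fun n => ((1 + r * (n.+1%:R)^-1) ^+ d * vol)%:E)).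
  + apply: nearW => n; apply/andP; split.
      have e : (vol%:E = (s n ^+ d)^-1%:E * ((s n ^+ d)%:E * vol%:E))%E.
        by rewrite muleA -[X in (X * _)%E]EFinM mulVf ?gt_eqF// mul1e.
      rewrite /f [X in (X <= _)%E]e lee_pmul2l ?lte_fin ?invr_gt0//.
      rewrite -volE; exact: lebesgue_hit_dir_setT_ge.
    have -> : ((1 + r * (n.+1%:R)^-1) ^+ d * vol)%:E =
        ((s n ^+ d)^-1%:E * ((s n + r) ^+ d * vol)%:E)%E.
      rewrite -EFinM mulrA; congr (_ * _)%:E.
      by rewrite -exprVn -exprMn; congr (_ ^+ _); rewrite mulrDr mulVf ?pnatr_eq0// mulrC.
    rewrite /f lee_pmul2l ?lte_fin ?invr_gt0// EFinM -volE.
    exact: Hr.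
  + exact: cvg_cst.
  + apply: cvg_EFin; first exact: nearW.
    rewrite -[X in _ --> X]mul1r; apply: cvgMr_tmp.
    have c : 1 + r * n.+1%:R^-1 @[n --> \oo] --> 1 + r * (0 : R).
      apply: cvgD; first exact: cvg_cst.
      by apply: cvgMl_tmp; exact: cvg_harmonic.
    have := cvg_comp _ _ c (@exprn_continuous R d _).
    by rewrite mulr0 addr0 expr1n.
- apply/integrableP; split.
    apply: emeasurable_funM => //.
    have := measurable_counting mL0' measurableT.
    by under eq_fun do rewrite setIT.
  under eq_integral do rewrite gee0_abs ?mule_ge0 ?lee_fin ?fine_ge0//.
  rewrite ge0_integralZr//.
  + rewrite lte_mul_pinfty ?integral_ge0 ?ltry//.
    by rewrite ge0_fin_numE; [exact: L0_fin|exact: integral_ge0].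
  + have := measurable_counting mL0' measurableT.
    by under eq_fun do rewrite setIT.
  + by rewrite lee_fin fine_ge0.
- apply: aeW => w n _; rewrite gee0_abs; last first.
    by apply: mule_ge0 => //; rewrite lee_fin invr_ge0 ltW.
  have := lebesgue_hit_dir_set_le d_gt0 Bcompact Bconvex B0 (fL0 w) u0 (s0 n).
  rewrite volE /f => H.
  rewrite lee_pdivrMl//.
  by rewrite muleCA.
move=> _ _; rewrite hE; under eq_fun do rewrite fE.
by move=> /fine_cvg.
Qed.

Lemma hit_intensity_lim C : measurable C ->
  hit_intensity n.+1%:R C / n.+1%:R ^+ d @[n --> \oo] --> p0 * dir_volume C.
Proof.
move=> mC; have mCc := measurableC mC.
have sd0 n : 0 < n.+1%:R ^+ d :> R by rewrite exprn_gt0// ltr0n.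
apply: (@squeeze_cvgr _ _ _ _ (fun=> p0 * dir_volume C)
  (fun n => hit_intensity n.+1%:R setT / n.+1%:R ^+ d - p0 * dir_volume (~` C))).
- apply: nearW => n; apply/andP; split.
    by rewrite ler_pdivlMr// -mulrA [dir_volume C * _]mulrC hit_intensity_ge.
  rewrite -(hit_intensityC _ mC)// mulrDl -addrA lerDl subr_ge0.
  by rewrite ler_pdivlMr// -mulrA [dir_volume (~` C) * _]mulrC hit_intensity_ge.
- exact: cvg_cst.
rewrite (_ : p0 * dir_volume C = p0 * vol - p0 * dir_volume (~` C)); last first.
  by rewrite -(dir_volumeC mC) mulrDr addrK.
by apply: cvgB; [exact: hit_intensityT_lim|exact: cvg_cst].
Qed.

End typical_cluster.

(** * The cluster process *)

Section restriction.
Context {R : realType} {d : nat} (B : set 'rV[R]_d).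
Hypotheses (Bcompact : compact B) (Bconvex : convex_set B)
  (B0 : nbhs (0 : 'rV[R]_d) B).
Local Notation V := 'rV[R]_d.
Local Notation g := (gauge B).

Let unique_min_imply (K K' : set V) t y :
  K `&` [set z | g z <= t] = K' `&` [set z | g z <= t] ->
  unique_min B K y -> g y <= t -> unique_min B K' y.
Proof.
move=> KK [Ky gy0 ymin] gyt; split => //.
  by have [] : (K' `&` [set z | g z <= t]) y by rewrite -KK.
move=> z K'z zy; have [zt|] := leP (g z) t; last exact: le_lt_trans.
by apply: ymin => //; have [] : (K `&` [set z | g z <= t]) z by rewrite KK.
Qed.

(** Whether contact occurs within t, and in which direction, depends only on the points of gauge at
    most t. This reduces a locally finite set to a finite one for measurability, and [N] to a single
    cluster when no other is hit. *)
Lemma rel_dir_event_restrict u0 (K K' : set V) t (C : set V) : locally_finite K ->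
  locally_finite K' -> 0 <= t ->
  K `&` [set z | g z <= t] = K' `&` [set z | g z <= t] ->
  ((rel_dist B 0 K <= t%:E)%E /\ C (rel_dir u0 B K 0)) ->
  ((rel_dist B 0 K' <= t%:E)%E /\ C (rel_dir u0 B K' 0)).
Proof.
move=> lK lK' t0 KK.
rewrite !(rel_dir_event Bcompact Bconvex B0)// => -[[y [uy yt Cy]]|[[y Ky yt] nu Cu]].
  by left; exists y; split => //; exact: unique_min_imply KK _ _.
have K'y : K' y by have [] : (K' `&` [set z | g z <= t]) y by rewrite -KK.
right; split => //; first by exists y.
move=> [z uz]; apply: nu; exists z.
apply: (unique_min_imply (esym KK)) => //.
case: uz => K'z _ zmin; have [->|yz] := eqVneq z y; first exact: yt.
by apply: ltW; apply: lt_le_trans yt; apply: zmin => //; rewrite eq_sym.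
Qed.

Lemma bounded_restrict_finite (K : set V) t : locally_finite K ->
  finite_set (K `&` [set z | g z <= t]).
Proof. by apply; exact: (bounded_gauge_le Bcompact Bconvex B0). Qed.

Lemma measurable_contact_event {disp : measure_display} {X : measurableType disp}
    (Z : X -> set V) u0 t (C : set V) : random_points Z ->
  (forall x, locally_finite (Z x)) -> 0 <= t -> measurable C ->
  measurable [set x | (rel_dist B 0 (Z x) <= t%:E)%E /\ C (rel_dir u0 B (Z x) 0)].
Proof.
move=> mZ lZ t0 mC.
pose Zt x : @config R d := Z x `&` [set z | g z <= t].
have mZ' : measurable_fun [set: X] (Z : X -> @config R d) := mZ.
have mZt : measurable_fun [set: X] Zt.
  apply: (measurableT_comp (measurable_config_restrict _) mZ').
  exact: measurable_gauge_le.
have fZt x : finite_set (Zt x) by exact: bounded_restrict_finite.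
have := measurable_rel_dir_event Bcompact Bconvex B0 (X := X) (xi := fun=> 0)
  (kappa := Zt) (measurable_cst _) mZt fZt u0 t0 mC.
move=> mE; rewrite [X in measurable X](_ : _ = [set x |
    (rel_dist B 0 (translate (Zt x) 0) <= t%:E)%E /\ C (rel_dir u0 B (translate (Zt x) 0) 0)])//.
apply/funext => x; apply/propext => /=.
have -> : translate (Zt x) 0 = Zt x.
  apply/seteqP; split => [_ [y Zy <-]|y Zy]; first by rewrite addr0.
  by exists y => //; rewrite addr0.
have lZt : locally_finite (Zt x) by exact: finite_locally_finite.
split; apply: rel_dir_event_restrict => //; rewrite /Zt -setIA setIid//.
Qed.

End restriction.

(** * Contact events as functionals of the clusters *)

Section union_of_clusters.
Context {R : realType} {d : nat} (B : set 'rV[R]_d).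
Hypotheses (Bcompact : compact B) (Bconvex : convex_set B)
  (B0 : nbhs (0 : 'rV[R]_d) B).
Local Notation V := 'rV[R]_d.
Local Notation g := (gauge B).
Variables (x : nat -> V) (K : nat -> set V) (N : set V) (u0 : V).
Hypotheses (fK : forall n, finite_set (K n)) (lN : locally_finite N)
  (NE : N = \bigcup_n translate (K n) (x n)).

(** The indicator that no pair (x n, K n) lies in S, in the product form on which the Laplace
    functional acts. *)
Definition survival (S : set (V * @config R d)) : R :=
  prod_lim (fun n => 1 - \1_S (x n, K n : @config R d)).

(** For S contained in S', a pair in S makes this vanish; if there is none, it is 2 ^ (- k), where k
    pairs lie in S'. The value 1/2 at k = 1 is what cancels the case of a single new cluster. *)
Definition survival2 (S S' : set (V * @config R d)) : R :=
  prod_lim (fun n => 1 - (\1_S (x n, K n : @config R d) + \1_S' (x n, K n : @config R d)) / 2).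

Let hitE t C n : hit_event B u0 t C (x n, K n) <->
  (rel_dist B 0 (translate (K n) (x n)) <= t%:E)%E /\ C (rel_dir u0 B (translate (K n) (x n)) 0).
Proof. by rewrite /hit_event/= finite_part_id. Qed.

Let lK n : locally_finite (translate (K n) (x n)).
Proof. by apply: finite_locally_finite; exact: finite_translate. Qed.

Let far t : 0 <= t -> (forall n, ~ hit_event B u0 t setT (x n, K n)) ->
  ~ (rel_dist B 0 N <= t%:E)%E.
Proof.
move=> t0 nh /(rel_dist_leP Bcompact Bconvex B0 lN t0)[y].
rewrite NE => -[n _ Ky] yt; apply: (nh n); apply/hitE; split => //.
by apply/(rel_dist_leP Bcompact Bconvex B0 (lK n) t0); exists y.
Qed.

Let near t n : 0 <= t -> hit_event B u0 t setT (x n, K n) -> (rel_dist B 0 N <= t%:E)%E.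
Proof.
move=> t0 /hitE[/(rel_dist_leP Bcompact Bconvex B0 (lK n) t0)[y Ky yt] _].
apply/(rel_dist_leP Bcompact Bconvex B0 lN t0); exists y => //.
by rewrite NE; exists n.
Qed.

Let b01 S n : 0 <= (1 - \1_S (x n, K n : @config R d) : R) <= 1.
Proof. by rewrite indicE; case: (_ \in _) => /=; lra. Qed.

Let c01 S S' n :
  0 <= (1 - (\1_S (x n, K n : @config R d) + \1_S' (x n, K n : @config R d)) / 2 : R) <= 1.
Proof. by rewrite !indicE; do 2 case: (_ \in _) => /=; lra. Qed.

Let survival0 S n : S (x n, K n : @config R d) -> survival S = 0.
Proof.
move=> Sn; apply/eqP; rewrite eq_le prod_lim_ge0 ?andbT//.
by apply: (le_trans (prod_lim_le_factor (b01 S) n)); rewrite indicE mem_set// subrr.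
Qed.

Let survival1 S : (forall n, ~ S (x n, K n : @config R d)) -> survival S = 1.
Proof.
move=> nS; rewrite -prod_lim1 /survival; congr prod_lim; apply/funext => n.
by rewrite indicE memNset// subr0.
Qed.

Lemma survival_dist t : 0 <= t ->
  \1_[set r : \bar R | (r <= t%:E)%E] (rel_dist B 0 N) = 1 - survival (hit_event B u0 t setT).
Proof.
move=> t0; have [[n hn]|nh] := pselect (exists n, hit_event B u0 t setT (x n, K n)).
  by rewrite indicE mem_set/= ?(survival0 hn) ?subr0//; exact: near hn.
rewrite indicE memNset/= ?survival1 ?subrr//.
  by move=> n hn; apply: nh; exists n.
by apply: far => // n hn; apply: nh; exists n.
Qed.

(* The bound is 0 unless no cluster is hit at time t and at least two clusters
   are hit at time t + h, and it is then at least 1. *)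
Lemma survival_contact t h (C : set V) : 0 <= t -> 0 <= h ->
  `| \1_[set K : set V | ((t%:E < rel_dist B 0 K)%E /\ (rel_dist B 0 K <= (t + h)%:E)%E) /\
       C (rel_dir u0 B K 0)] N -
     (survival (hit_event B u0 t setT) -
      survival (hit_event B u0 t setT `|` hit_event B u0 (t + h) C)) | <=
  2 * (survival (hit_event B u0 t setT) + survival (hit_event B u0 (t + h) setT) -
       2 * survival2 (hit_event B u0 t setT) (hit_event B u0 (t + h) setT)).
Proof.
move=> t0 h0; set S0 := hit_event B u0 t setT; set SA := hit_event B u0 (t + h) setT.
set S1 := _ `|` _; set E := [set K : set V | _].
have th0 : 0 <= t + h by rewrite addr_ge0.
have S0A n : S0 (x n, K n) -> SA (x n, K n).
  move=> /hitE[d0 _]; apply/hitE; split => //.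
  by rewrite (le_trans d0)// lee_fin lerDl.
have S1A n : S1 (x n, K n) -> SA (x n, K n).
  by move=> [|/hitE[dC _]]; [exact: S0A|apply/hitE].
have [[n hn]|nh] := pselect (exists n, S0 (x n, K n)).
  have nE : ~ E N by move=> [[]]; rewrite ltNge => /negP nd _ _; apply: nd; exact: near hn.
  rewrite indicE memNset// (survival0 hn) (survival0 (S0A _ hn)).
  rewrite (@survival0 S1 n); last by left.
  suff -> : survival2 S0 SA = 0 by rewrite !(subr0, mulr0, addr0) normr0.
  apply/eqP; rewrite eq_le prod_lim_ge0 ?andbT//.
  apply: (le_trans (prod_lim_le_factor (c01 S0 SA) n)).
  by rewrite !indicE !mem_set//; [rewrite /=; lra|exact: S0A].
have nS0 n : ~ S0 (x n, K n) by move=> hn; apply: nh; exists n.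
have dN : (t%:E < rel_dist B 0 N)%E by rewrite ltNge; apply/negP; exact: far.
rewrite [survival S0]survival1//.
have [[n hn]|nhA] := pselect (exists n, SA (x n, K n)); last first.
  have nSA n : ~ SA (x n, K n) by move=> hn; apply: nhA; exists n.
  rewrite !survival1//; last by move=> n /S1A; exact: nSA.
  have nE : ~ E N by move=> [[_ dt] _]; exact: (far th0 nSA dt).
  rewrite indicE memNset//; suff -> : survival2 S0 SA = 1.
    by rewrite subrr subr0 normr0; lra.
  rewrite -prod_lim1 /survival2; congr prod_lim; apply/funext => n.
  by rewrite !indicE !memNset// addr0 mul0r subr0.
rewrite (survival0 hn).
have [[m [mn hm]]|nother] := pselect (exists m, m != n /\ SA (x m, K m)).
  (* Each of the two clusters contributes a factor 1/2, so the right-hand side is at least 2 (1 - 2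
     / 4) = 1, while the left-hand side compares two numbers in [0, 1]. *)
  have S2 : survival2 S0 SA <= 2^-1 * 2^-1.
    have half k : SA (x k, K k) ->
        1 - (\1_S0 (x k, K k : @config R d) + \1_SA (x k, K k : @config R d)) / 2 = 2^-1 :> R.
      by move=> hk; rewrite !indicE memNset// mem_set//=; lra.
    move: mn; rewrite neq_lt => /orP[] kl.
      by have := prod_lim_le_factor2 (c01 S0 SA) kl; rewrite !half.
    by have := prod_lim_le_factor2 (c01 S0 SA) kl; rewrite !half.
  have := prod_lim_ge0 (b01 S1); have := prod_lim_le_factor (b01 S1) 0.
  have /andP[_] := b01 S1 0; rewrite -/(survival S1) => b1 s1 s0.
  rewrite ler_norml indicE; case: (_ \in _) => /=; lra.
have SAn m : m != n -> ~ SA (x m, K m).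
  by move=> mn hm; apply: nother; exists m.
have -> : survival2 S0 SA = 2^-1.
  rewrite /survival2 (@prod_lim_single _ _ n) => [|m mn].
    by rewrite !indicE memNset// mem_set//=; lra.
  by rewrite !indicE !memNset ?addr0 ?mul0r ?subr0//; exact: SAn.
have -> : survival S1 = 1 - \1_S1 (x n, K n : @config R d).
  rewrite /survival (@prod_lim_single _ _ n)// => m mn.
  by rewrite indicE memNset ?subr0// => /S1A; exact: SAn.
suff EN : E N <-> S1 (x n, K n).
  have -> : \1_E N = \1_S1 (x n, K n : @config R d) :> R.
    have [en|nen] := pselect (E N); first by rewrite !indicE !mem_set//; exact/EN.
    by rewrite !indicE !memNset// => /EN.
  by rewrite subKr subrr normr0; lra.
(* Only the cluster n reaches gauge t + h, so up to that gauge [N] coincides with it and contact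
   events of the two agree. *)
have NK : N `&` [set z | g z <= t + h] = translate (K n) (x n) `&` [set z | g z <= t + h].
  apply/seteqP; split=> y [Ny yt]; split => //; last by rewrite NE; exists n.
  move: Ny; rewrite NE => -[m _ Ky].
  have [<-//|mn] := eqVneq m n; exfalso; apply: (SAn m mn); apply/hitE; split => //.
  by apply/(rel_dist_leP Bcompact Bconvex B0 (lK m) th0); exists y.
split => [[[_ d1] Cd]|[/nS0//|/hitE hC]].
  right; apply/hitE.
  exact: (rel_dir_event_restrict Bcompact Bconvex B0 lN (lK n) th0 NK).
have [] := rel_dir_event_restrict Bcompact Bconvex B0 (lK n) lN th0 (esym NK) hC.
by move=> ? ?; split.
Qed.

End union_of_clusters.

Section cluster_process.
Context {disp : measure_display} {T : measurableType disp} {R : realType}.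
Variable P : probability T R.
Context {d : nat} (d_gt0 : (0 < d)%N).
Local Notation V := 'rV[R]_d.
Local Notation Leb := (@lebesgue_rV R d).
Variables (lambda : R) (Pi : T -> set V) (xi : nat -> T -> V)
  (mark : nat -> T -> @config R d) (L0 : T -> set V).
Hypotheses (lambda_gt0 : 0 < lambda)
  (poissonPi : stationary_poisson_process P lambda Pi)
  (mxi : forall n, measurable_fun [set: T] (xi n))
  (xiP : {ae P, forall w, injective (xi ^~ w) /\ Pi w = range (xi ^~ w)})
  (mmark : forall n, measurable_fun [set: T] (mark n))
  (mL0 : random_points L0)
  (law_mark : forall n E, measurable E -> P (mark n @^-1` E) = P (L0 @^-1` E))
  (indep : mutually_independent P (fun i : option nat =>
    if i is Some n then g_sigma_algebra_preimage (mark n)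
    else <<s \bigcup_n g_sigma_algebra_preimage (xi n) >>)).

Let mL0' : measurable_fun [set: T] (L0 : T -> @config R d). Proof. exact: mL0. Qed.

(** Independent marks are averaged out first, which leaves the Laplace functional of the positions
    at the mean of q over the typical cluster. *)
Lemma marked_poisson_laplace (q : V * @config R d -> R) :
  measurable_fun [set: V * @config R d] q -> (forall z, 0 <= q z <= 1) ->
  (\int[Leb]_x \int[P]_w (q (x, L0 w : @config R d))%:E < +oo)%E ->
  (\int[P]_w (prod_lim (fun n => 1 - q (xi n w, mark n w)))%:E =
   (expR (- (lambda * fine (\int[Leb]_x \int[P]_w (q (x, L0 w : @config R d))%:E))))%:E)%E.
Proof.
move=> mq q01 qfin.
pose v z := 1 - q z.
have mv : measurable_fun [set: V * @config R d] v.
  by apply: measurable_funB => //; exact: measurable_cst.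
have v01 z : 0 <= v z <= 1 by have := q01 z; rewrite /v; lra.
have := marked_prod_lim_expectation mxi mmark mL0' law_mark indep mv v01.
rewrite /v => ->.
have qE x := mark_meanE P mL0' mq q01 x.
have vq x : mark_mean P (L0 : T -> @config R d) v x = 1 - mark_mean P (L0 : T -> @config R d) q x.
  apply/EFin_inj; rewrite EFinB -!mark_meanE// /v.
  under eq_integral do rewrite EFinB.
  have mqx : measurable_fun [set: T] (fun w => q (x, L0 w : @config R d)).
    apply: (measurableT_comp mq); apply: measurable_fun_pair => //.
  have iq : P.-integrable setT (fun w => (q (x, L0 w : @config R d))%:E).
    apply: (@le_integrable _ _ _ P _ measurableT _ (fun=> 1%E)).
    - exact/measurable_EFinP.
    - move=> w _; rewrite /= normr1 lee_fin ger0_norm; have := q01 (x, L0 w : @config R d); lra.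
    - exact: finite_measure_integrable_cst.
  rewrite integralB_EFin//.
    by rewrite integral_cst// mul1e [X in (X - _)%E]probability_setT.
  exact: finite_measure_integrable_cst.
under eq_integral do under eq_fun do rewrite vq.
rewrite (poisson_laplace lambda_gt0 poissonPi mxi xiP (u := mark_mean P (L0 : T -> @config R d) q)).
- by under eq_integral do rewrite -qE.
- exact: measurable_mark_mean.
- by move=> x; exact: mark_mean01.
- by under eq_integral do rewrite -qE.
Qed.

Lemma survival_expectation (S : set (V * @config R d)) : measurable S ->
  (mark_intensity P L0 S < +oo)%E ->
  (\int[P]_w (survival (xi ^~ w) (mark ^~ w) S)%:E =
   (expR (- (lambda * fine (mark_intensity P L0 S))))%:E)%E.
Proof.
move=> mS Sfin; have SE := mark_intensityE P mL0 mS.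
rewrite -SE; apply: (marked_poisson_laplace (q := \1_S)).
- exact: measurable_indic.
- by move=> z; rewrite indicE; case: (_ \in _); rewrite /= lexx ler01.
- by rewrite SE.
Qed.

Lemma survival2_expectation (S S' : set (V * @config R d)) : measurable S -> measurable S' ->
  (mark_intensity P L0 S < +oo)%E -> (mark_intensity P L0 S' < +oo)%E ->
  (\int[P]_w (survival2 (xi ^~ w) (mark ^~ w) S S')%:E =
   (expR (- (lambda * ((fine (mark_intensity P L0 S) + fine (mark_intensity P L0 S')) / 2))))%:E)%E.
Proof.
move=> mS mS' Sfin S'fin.
pose q (z : V * @config R d) : R := (\1_S z + \1_S' z) / 2.
have mi x (A : set (V * @config R d)) : measurable A ->
    measurable_fun [set: T] (fun w => (\1_A (x, L0 w : @config R d))%:E : \bar R).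
  move=> mA; apply/measurable_EFinP; apply: (measurableT_comp (measurable_indic mA)).
  exact: measurable_fun_pair.
have mI (A : set (V * @config R d)) : measurable A ->
    measurable_fun [set: V] (fun x => \int[P]_w (\1_A (x, L0 w : @config R d))%:E)%E.
  move=> mA; have A01 z : 0 <= (\1_A z : R) <= 1.
    by rewrite indicE; case: (_ \in _); rewrite /= lexx ler01.
  under eq_fun do rewrite (mark_meanE P mL0' (measurable_indic mA) A01).
  by apply/measurable_EFinP; apply: measurable_mark_mean => //; exact: measurable_indic.
have qE x : (\int[P]_w (q (x, L0 w : @config R d))%:E =
    (2^-1)%:E * (\int[P]_w (\1_S (x, L0 w : @config R d))%:E +
    \int[P]_w (\1_S' (x, L0 w : @config R d))%:E))%E.
  rewrite -ge0_integralD//; try exact: mi; try by move=> *; rewrite lee_fin.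
  rewrite -ge0_integralZl//; [|by apply: emeasurable_funD; exact: mi|by move=> *; rewrite adde_ge0// lee_fin].
  by apply: eq_integral => w _; rewrite /q mulrC EFinM EFinD.
have qI : (\int[Leb]_x \int[P]_w (q (x, L0 w : @config R d))%:E =
    ((fine (mark_intensity P L0 S) + fine (mark_intensity P L0 S')) / 2)%:E)%E.
  under eq_integral do rewrite qE.
  have i0 (A : set (V * @config R d)) x : (0 <= \int[P]_w (\1_A (x, L0 w : @config R d))%:E)%E.
    by apply: integral_ge0 => w _; rewrite lee_fin.
  rewrite ge0_integralZl//; [|by apply: emeasurable_funD; exact: mI|by move=> *; rewrite adde_ge0].
  rewrite ge0_integralD//; [|exact: mI|exact: mI].
  rewrite !mark_intensityE// mulrC EFinM EFinD.
  have mi0 A : (0 <= mark_intensity P L0 A)%E by apply: integral_ge0.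
  by rewrite !fineK// ge0_fin_numE.
have -> : (fine (mark_intensity P L0 S) + fine (mark_intensity P L0 S')) / 2 =
    fine (\int[Leb]_x \int[P]_w (q (x, L0 w : @config R d))%:E)%E by rewrite qI.
apply: (marked_poisson_laplace (q := q)).
- apply: measurable_funM; last exact: measurable_cst.
  by apply: measurable_funD; exact: measurable_indic.
- by move=> z; rewrite /q !indicE; do 2 case: (_ \in _) => /=; lra.
- by rewrite qI ltry.
Qed.

End cluster_process.

Section bounded_expectation.
Context {disp : measure_display} {T : measurableType disp} {R : realType}.
Variable P : probability T R.

Lemma bounded_integrable (f : T -> R) (c : R) : measurable_fun [set: T] f ->
  (forall w, `|f w| <= c) -> P.-integrable setT (EFin \o f).
Proof.
move=> mf fc; apply: measurable_bounded_integrable => //.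
  by rewrite [X in (X < _)%E]probability_setT ltry.
exists c; split; first by rewrite num_real.
by move=> x cx w _; apply: (le_trans (fc w)); exact: ltW.
Qed.

Lemma le_Rintegral_ae (f h : T -> R) : P.-integrable setT (EFin \o f) ->
  P.-integrable setT (EFin \o h) -> {ae P, forall w, f w <= h w} ->
  \int[P]_w f w <= \int[P]_w h w.
Proof.
move=> fi hi fh; rewrite -subr_ge0 -RintegralB//.
have hfi : P.-integrable setT (EFin \o (fun w => h w - f w)).
  by have := integrableB measurableT hi fi.
have mhf := measurable_int P hfi.
rewrite (_ : \int[P]_w (h w - f w) = \int[P]_w `|h w - f w|).
  by apply: Rintegral_ge0 => w _; exact: normr_ge0.
congr fine; apply: ae_eq_integral => //.
  by apply/measurable_EFinP; apply: measurableT_comp => //; exact/measurable_EFinP.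
by apply: filterS fh => w fhw _; rewrite ger0_norm// subr_ge0.
Qed.

Lemma normr_Rintegral_le_ae (f h : T -> R) : P.-integrable setT (EFin \o f) ->
  P.-integrable setT (EFin \o h) -> {ae P, forall w, `|f w| <= h w} ->
  `|\int[P]_w f w| <= \int[P]_w h w.
Proof.
move=> fi hi fh; rewrite ler_norml; apply/andP; split; last first.
  apply: le_Rintegral_ae => //; apply: filterS fh => w; exact: le_trans (ler_norm _).
rewrite lerNl -mulN1r -RintegralZl//; apply: le_Rintegral_ae => //.
  by have := integrableZl measurableT (-1) fi.
by apply: filterS fh => w; rewrite mulN1r; apply: le_trans; rewrite -normrN ler_norm.
Qed.

Lemma Rintegral_indic_event (E : set T) : measurable E ->
  \int[P]_w (\1_E w : R) = fine (P E).
Proof. by move=> mE; rewrite /Rintegral integral_indic// setIT. Qed.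

End bounded_expectation.

(** * Void probability and increments of the contact distribution *)

Section contact.
Context {disp : measure_display} {T : measurableType disp} {R : realType}.
Variable P : probability T R.
Context {d : nat} (d_gt0 : (0 < d)%N) (B : set 'rV[R]_d).
Hypotheses (Bcompact : compact B) (Bconvex : convex_set B)
  (B0 : nbhs (0 : 'rV[R]_d) B).
Local Notation V := 'rV[R]_d.
Local Notation g := (gauge B).
Local Notation Leb := (@lebesgue_rV R d).
Variables (lambda : R) (Pi : T -> set V) (xi : nat -> T -> V)
  (mark : nat -> T -> @config R d) (L0 N : T -> set V) (u0 : V).
Hypotheses (lambda_gt0 : 0 < lambda)
  (poissonPi : stationary_poisson_process P lambda Pi)
  (mxi : forall n, measurable_fun [set: T] (xi n))
  (xiP : {ae P, forall w, injective (xi ^~ w) /\ Pi w = range (xi ^~ w)})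
  (mmark : forall n, measurable_fun [set: T] (mark n))
  (fmark : forall n w, finite_set (mark n w))
  (mL0 : random_points L0) (fL0 : forall w, finite_set (L0 w))
  (L0_fin : (mean_cluster_size P L0 < +oo)%E)
  (law_mark : forall n E, measurable E -> P (mark n @^-1` E) = P (L0 @^-1` E))
  (indep : mutually_independent P (fun i : option nat =>
    if i is Some n then g_sigma_algebra_preimage (mark n)
    else <<s \bigcup_n g_sigma_algebra_preimage (xi n) >>))
  (mN : random_points N) (lN : forall w, locally_finite (N w))
  (NE : {ae P, forall w, N w = \bigcup_n translate (mark n w) (xi n w)}).

Local Notation G := (fun t C => lambda * hit_intensity P B L0 u0 t C).
Local Notation surv S := (fun w => survival (xi ^~ w) (mark ^~ w) S).
Local Notation surv2 S S' := (fun w => survival2 (xi ^~ w) (mark ^~ w) S S').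
Local Notation hit t C := (hit_event B u0 t C).

Let measurable_point n (S : set (V * @config R d)) : measurable S ->
  measurable_fun [set: T] (fun w => \1_S (xi n w, mark n w) : R).
Proof.
move=> mS; apply: (measurableT_comp (measurable_indic mS)).
exact: measurable_fun_pair.
Qed.

Let surv_int S : measurable S -> P.-integrable setT (EFin \o surv S).
Proof.
move=> mS; have b01 n w : 0 <= (1 - \1_S (xi n w, mark n w) : R) <= 1.
  by rewrite indicE; case: (_ \in _) => /=; lra.
apply: (@bounded_integrable _ _ _ _ _ 1).
  apply: (measurable_prod_lim (a := fun n w => 1 - \1_S (xi n w, mark n w))) => // n.
  by apply: measurable_funB; [exact: measurable_cst|exact: measurable_point].
move=> w; rewrite ger0_norm ?prod_lim_ge0//.
apply: (le_trans (prod_lim_le_factor (b01 ^~ w) 0)).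
by case/andP: (b01 0 w).
Qed.

Let surv2_int S S' : measurable S -> measurable S' -> P.-integrable setT (EFin \o surv2 S S').
Proof.
move=> mS mS'.
have b01 n w : 0 <= (1 - (\1_S (xi n w, mark n w) + \1_S' (xi n w, mark n w)) / 2 : R) <= 1.
  by rewrite !indicE; do 2 case: (_ \in _) => /=; lra.
apply: (@bounded_integrable _ _ _ _ _ 1).
  apply: (measurable_prod_lim (a := fun n w =>
    1 - (\1_S (xi n w, mark n w) + \1_S' (xi n w, mark n w)) / 2)) => // n.
  apply: measurable_funB; first exact: measurable_cst.
  apply: measurable_funM; last exact: measurable_cst.
  by apply: measurable_funD; exact: measurable_point.
move=> w; rewrite ger0_norm ?prod_lim_ge0//.
apply: (le_trans (prod_lim_le_factor (b01 ^~ w) 0)).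
by case/andP: (b01 0 w).
Qed.

Let surv_mean S m : measurable S -> mark_intensity P L0 S = m%:E ->
  \int[P]_w surv S w = expR (- (lambda * m)).
Proof.
move=> mS Sm; rewrite /Rintegral (survival_expectation lambda_gt0 poissonPi mxi xiP mmark mL0)//.
  by rewrite Sm.
by rewrite Sm ltry.
Qed.

Let surv2_mean S S' m m' : measurable S -> measurable S' ->
  mark_intensity P L0 S = m%:E -> mark_intensity P L0 S' = m'%:E ->
  \int[P]_w surv2 S S' w = expR (- (lambda * m + lambda * m') / 2).
Proof.
move=> mS mS' Sm Sm'.
rewrite /Rintegral (survival2_expectation lambda_gt0 poissonPi mxi xiP mmark mL0)//.
- by rewrite Sm Sm'/= mulrA mulrDr mulNr.
- by rewrite Sm ltry.
- by rewrite Sm' ltry.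
Qed.

Let mhit t C : 0 <= t -> measurable C -> measurable (hit t C).
Proof. by move=> ? ?; exact: measurable_hit_event. Qed.

Let hitE t C : 0 <= t -> measurable C ->
  mark_intensity P L0 (hit t C) = (hit_intensity P B L0 u0 t C)%:E.
Proof. by move=> ? ?; exact: hit_intensityE. Qed.

Let contact_event t C := [set w | (rel_dist B 0 (N w) <= t%:E)%E /\ C (rel_dir u0 B (N w) 0)].

Let mcontact t C : 0 <= t -> measurable C -> measurable (contact_event t C).
Proof. by move=> ? ?; exact: measurable_contact_event. Qed.

Let contactE t C : 0 <= t -> measurable C ->
  contact_distribution P N B u0 t C = \int[P]_w (\1_(contact_event t C) w : R).
Proof. by move=> t0 mC; rewrite Rintegral_indic_event//; exact: mcontact. Qed.

Let indic_int (E : set T) : measurable E -> P.-integrable setT (EFin \o (\1_E : T -> R)).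
Proof.
move=> mE; apply: (@bounded_integrable _ _ _ _ _ 1); first exact: measurable_indic.
by move=> w; rewrite indicE; case: (_ \in _); rewrite ?normr1 ?normr0.
Qed.

Let cst1_int : P.-integrable setT (EFin \o (fun=> 1 : R)).
Proof.
by apply: (@bounded_integrable _ _ _ _ _ 1) => // w; rewrite normr1.
Qed.

Lemma void_probability t : 0 <= t ->
  1 - contact_distribution P N B u0 t setT = expR (- G t setT).
Proof.
move=> t0; rewrite contactE//.
have mh := mhit t0 (@measurableT _ V).
rewrite -(surv_mean mh (hitE t0 measurableT)).
have -> : \int[P]_w (\1_(contact_event t setT) w : R) = \int[P]_w (1 - surv (hit t setT) w).
  congr fine; apply: ae_eq_integral => //.
  - exact: (measurable_int P (indic_int (mcontact t0 measurableT))).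
  - by have /measurable_int := integrableB measurableT cst1_int (surv_int mh).
  apply: filterS NE => w Nw _; congr EFin.
  rewrite -(survival_dist Bcompact Bconvex B0 u0 (fmark ^~ w) (lN w) Nw t0).
  rewrite !indicE; congr (_ %:R); congr nat_of_bool.
  by apply/idP/idP => /set_mem => [[h _]|h]; apply/mem_set.
rewrite RintegralB//; last exact: surv_int.
rewrite Rintegral_cst// [X in fine X]probability_setT/=; lra.
Qed.

Lemma contact_increment t h C : 0 <= t -> 0 <= h -> measurable C ->
  `| (contact_distribution P N B u0 (t + h) C - contact_distribution P N B u0 t C) -
     (expR (- G t setT) - expR (- (G t setT + (G (t + h) C - G t C)))) | <=
  2 * (expR (- G t setT) + expR (- G (t + h) setT) -
       2 * expR (- (G t setT + G (t + h) setT) / 2)).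
Proof.
move=> t0 h0 mC; have th0 : 0 <= t + h by rewrite addr_ge0.
have m0 := mhit t0 (@measurableT _ V); have mA := mhit th0 (@measurableT _ V).
have m1 := mhit t0 mC; have m2 := mhit th0 mC.
have m3 : measurable (hit t setT `|` hit (t + h) C) by exact: measurableU.
(* A cluster keeps its contact direction as t grows, so the members of [hit (t + h) C] already hit
   at time t are exactly those of [hit t C]; the rest is disjoint from [hit t setT]. *)
have IU : mark_intensity P L0 (hit t setT `|` hit (t + h) C) =
  (hit_intensity P B L0 u0 t setT +
   (hit_intensity P B L0 u0 (t + h) C - hit_intensity P B L0 u0 t C))%:E.
  have mD : measurable (hit (t + h) C `\` hit t setT) by exact: measurableD.
  have -> : hit t setT `|` hit (t + h) C = hit t setT `|` (hit (t + h) C `\` hit t setT).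
    apply/seteqP; split => z [h1|]; [by left| |by left|by case; right].
    by move=> h1; have [z0|nz0] := pselect (hit t setT z); [left|right].
  rewrite mark_intensityU//; last by rewrite setIDA setIC -setIDA setDv setI0.
  rewrite hitE// EFinD; congr (_ + _)%E.
  have -> : hit_intensity P B L0 u0 (t + h) C = hit_intensity P B L0 u0 t C +
      fine (mark_intensity P L0 (hit (t + h) C `\` hit t setT)).
    apply/EFin_inj; rewrite EFinD -!hitE//.
    have Dle : (mark_intensity P L0 (hit (t + h) C `\` hit t setT) <= mark_intensity P L0 (hit (t + h) C))%E.
      by apply: mark_intensity_le => // z [].
    rewrite fineK; last first.
      rewrite ge0_fin_numE; first by rewrite (le_lt_trans Dle)// hitE// ltry.
      by apply: integral_ge0.
    rewrite -mark_intensityU//; first last.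
      by apply/seteqP; split => // z [[h1 _] [_ n1]]; apply: n1.
    congr (mark_intensity P L0 _); apply/seteqP; split => z.
      move=> hz; have [z0|nz0] := pselect (hit t setT z); last by right.
      by left; case: hz z0 => _ Cz [dz _]; split.
    case=> [[dz Cz]|[]//]; split => //.
    by rewrite (le_trans dz)// lee_fin lerDl.
  rewrite [X in X - _]addrC addrK fineK//.
  rewrite ge0_fin_numE; last by apply: integral_ge0.
  apply: (@le_lt_trans _ _ (mark_intensity P L0 (hit (t + h) C))).
    by apply: mark_intensity_le => // z [].
  by rewrite hitE// ltry.
pose E := contact_event (t + h) C `\` contact_event t C.
have mE : measurable E by apply: measurableD; exact: mcontact.
have mct := mcontact t0 mC; have mcth := mcontact th0 mC.
have -> : contact_distribution P N B u0 (t + h) C - contact_distribution P N B u0 t C =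
    \int[P]_w (\1_E w : R).
  rewrite !contactE// -RintegralB//; [|exact: indic_int|exact: indic_int].
  congr fine; apply: eq_integral => w _; congr EFin; rewrite /E !indicE in_setD.
  have : w \in contact_event t C -> w \in contact_event (t + h) C.
    move=> /set_mem[dw Cw]; apply/mem_set; split => //.
    by rewrite (le_trans dw)// lee_fin lerDl.
  case: (w \in contact_event t C) => [->//|_]; rewrite /= ?subrr//.
  by rewrite andbT subr0.
rewrite -(mulrBr lambda) -(mulrDr lambda).
rewrite -(surv_mean m3 IU) -(surv_mean m0 (hitE t0 measurableT)).
rewrite -(surv_mean mA (hitE th0 measurableT)).
rewrite -(surv2_mean m0 mA (hitE t0 measurableT) (hitE th0 measurableT)).
have i0 := surv_int m0; have iA := surv_int mA; have i3 := surv_int m3.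
have i2 := surv2_int m0 mA; have iE := indic_int mE.
have i03 : P.-integrable setT (EFin \o (fun w => surv (hit t setT) w -
    surv (hit t setT `|` hit (t + h) C) w)) by exact: (integrableB measurableT i0 i3).
have i0A : P.-integrable setT (EFin \o (fun w => surv (hit t setT) w +
    surv (hit (t + h) setT) w)) by exact: (integrableD measurableT i0 iA).
have i22 : P.-integrable setT (EFin \o (fun w => 2 * surv2 (hit t setT) (hit (t + h) setT) w)).
  by exact: (integrableZl measurableT 2 i2).
have i0A2 : P.-integrable setT (EFin \o (fun w => (surv (hit t setT) w +
    surv (hit (t + h) setT) w) - 2 * surv2 (hit t setT) (hit (t + h) setT) w)).
  exact: (integrableB measurableT i0A i22).
rewrite -RintegralB// -RintegralB// -RintegralD// -(RintegralZl 2 measurableT i2) -RintegralB//.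
rewrite -(RintegralZl 2 measurableT i0A2).
apply: normr_Rintegral_le_ae.
- exact: (integrableB measurableT iE i03).
- exact: (integrableZl measurableT 2 i0A2).
apply: filterS NE => w Nw.
apply: le_trans (survival_contact Bcompact Bconvex B0 u0 (fmark ^~ w) (lN w) Nw C t0 h0).
rewrite le_eqVlt; apply/orP; left; apply/eqP; congr `|_ - _|.
rewrite !indicE; congr (_ %:R); congr nat_of_bool.
apply/idP/idP => /set_mem => [[[dw Cw] nw]|[[d1 d2] Cw]]; apply/mem_set.
  by split => //; split => //; rewrite ltNge; apply/negP => dt; apply: nw.
by split => // -[dt _]; move: d1; rewrite ltNge dt.
Qed.

End contact.

(** * The hazard *)

Section right_derivative.
Context {R : realType}.

Lemma cvg_right_increment (phi : R -> R) (a : R) : h^-1 * phi h @[h --> 0^'+] --> a ->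
  phi h @[h --> 0^'+] --> (0 : R).
Proof.
move=> ca; have ch : (h : R) @[h --> 0^'+] --> (0 : R).
  by apply: cvg_at_right_filter; exact: cvg_id.
have c : h * (h^-1 * phi h) @[h --> 0^'+] --> (0 : R).
  by rewrite -[X in _ --> X](mul0r a); exact: cvgM.
apply: (squeeze_cvgr _ c c).
near=> h; have h0 : 0 < h by near: h; exact: nbhs_right_gt.
by rewrite mulVKf ?lexx// gt_eqF.
Unshelve. all: by end_near. Qed.

(** Two uses of exp y >= 1 + y give phi exp (- phi) <= 1 - exp (- phi) <= phi for either sign of
    phi, and [phi h] tends to 0. *)
Lemma expR_right_increment (phi : R -> R) (a : R) : h^-1 * phi h @[h --> 0^'+] --> a ->
  h^-1 * (1 - expR (- phi h)) @[h --> 0^'+] --> a.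
Proof.
move=> ca; have c0 := cvg_right_increment ca.
have ce : expR (- phi h) @[h --> 0^'+] --> (1 : R).
  have : expR (- phi h) @[h --> 0^'+] --> expR (- 0 : R).
    by apply: continuous_cvg; [exact: continuous_expR|exact: cvgN].
  by rewrite oppr0 expR0.
apply: (@squeeze_cvgr _ _ _ _ (fun h => h^-1 * phi h * expR (- phi h)) (fun h => h^-1 * phi h)).
- near=> h; have h0 : 0 < h by near: h; exact: nbhs_right_gt.
  rewrite -mulrA !ler_pM2l ?invr_gt0//; apply/andP; split.
    have e1 := expR_ge1Dx (phi h); have e0 := expR_gt0 (- phi h).
    have : (1 + phi h) * expR (- phi h) <= expR (phi h) * expR (- phi h) by rewrite ler_pM2r.
    by rewrite expRxMexpNx_1; lra.
  have := expR_ge1Dx (- phi h); lra.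
- by rewrite -[X in _ --> X](mulr1 a); exact: cvgM.
- exact: ca.
Unshelve. all: by end_near. Qed.

(* The bound on F is 2 (exp (- G t / 2) - exp (- G (t + h) / 2)) ^ 2 = O(h ^ 2). *)
Lemma right_derivative_of_bound (F G H : R -> R) (t a b : R) :
  h^-1 * (G (t + h) - G t) @[h --> 0^'+] --> b ->
  h^-1 * (H (t + h) - H t) @[h --> 0^'+] --> a ->
  (forall h, 0 <= h ->
    `| (F (t + h) - F t) - (expR (- G t) - expR (- (G t + (H (t + h) - H t)))) | <=
    2 * (expR (- G t) + expR (- G (t + h)) - 2 * expR (- (G t + G (t + h)) / 2))) ->
  h^-1 * (F (t + h) - F t) @[h --> 0^'+] --> expR (- G t) * a.
Proof.
move=> cG cH bound.
have cA := expR_right_increment cH.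
have cG2 : h^-1 * ((G (t + h) - G t) / 2) @[h --> 0^'+] --> b / 2.
  rewrite (_ : (fun h => _) = fun h => h^-1 * (G (t + h) - G t) / 2).
    by apply: cvgMr_tmp.
  by apply/funext => h; rewrite mulrA.
have cB := expR_right_increment cG2.
have ch : (h : R) @[h --> 0^'+] --> (0 : R).
  by apply: cvg_at_right_filter; exact: cvg_id.
pose A h := h^-1 * (1 - expR (- (H (t + h) - H t))).
pose D h := h^-1 * (1 - expR (- ((G (t + h) - G t) / 2))).
(* The given bound divided by h: with 1 - exp (- (G (t + h) - G t) / 2) = h D h, it equals 2 exp (-
   G t) (h D h) ^ 2 / h. *)
pose e h := 2 * expR (- G t) * (h * (D h * D h)).
have ce : e h @[h --> 0^'+] --> (0 : R).
  rewrite -[X in _ --> X](mulr0 (2 * expR (- G t))); apply: cvgMl_tmp.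
  by rewrite -[X in _ --> X](mul0r (b / 2 * (b / 2))); apply: cvgM => //; exact: cvgM.
have cA' : expR (- G t) * A h @[h --> 0^'+] --> expR (- G t) * a by apply: cvgMl_tmp.
apply: (@squeeze_cvgr _ _ _ _ (fun h => expR (- G t) * A h - e h) (fun h => expR (- G t) * A h + e h)).
- near=> h; have h0 : 0 < h by near: h; exact: nbhs_right_gt.
  have hV : 0 < h^-1 by rewrite invr_gt0.
  have := bound h (ltW h0); rewrite -(ler_pM2l hV) -{1}(gtr0_norm hV) -normrM.
  have -> : h^-1 * (2 * (expR (- G t) + expR (- G (t + h)) - 2 * expR (- (G t + G (t + h)) / 2))) = e h.
    rewrite /e /D.
    have -> : expR (- (G t + G (t + h)) / 2) = expR (- G t) * expR (- ((G (t + h) - G t) / 2)).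
      by rewrite -expRD; congr expR; lra.
    have -> : expR (- G (t + h)) = expR (- G t) *
        (expR (- ((G (t + h) - G t) / 2)) * expR (- ((G (t + h) - G t) / 2))).
      by rewrite -!expRD; congr expR; lra.
    set x := expR (- ((G _ - _) / 2)); set y := expR (- G t).
    by field; rewrite gt_eqF.
  have -> : h^-1 * (F (t + h) - F t - (expR (- G t) - expR (- (G t + (H (t + h) - H t))))) =
      h^-1 * (F (t + h) - F t) - expR (- G t) * A h.
    by rewrite /A (opprD (G t)) expRD; set x := expR _; set y := expR _; ring.
  by rewrite ler_distl.
- by rewrite -[X in _ --> X]subr0; exact: cvgB.
- by rewrite -[X in _ --> X]addr0; exact: cvgD.
Unshelve. all: by end_near. Qed.

End right_derivative.

(** * The measure [nu] as a volume of cones *)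

Section nu.
Context {R : realType} {d : nat} (d_gt0 : (0 < d)%N) (B : set 'rV[R]_d).
Hypotheses (Bcompact : compact B) (Bconvex : convex_set B)
  (B0 : nbhs (0 : 'rV[R]_d) B).
Local Notation V := 'rV[R]_d.
Local Notation g := (gauge B).
Local Notation Leb := (@lebesgue_rV R d).

Lemma rel_dist_origin (x : V) : rel_dist B x [set 0] = rel_dist B 0 [set - x].
Proof.
congr ereal_inf; congr image; apply/funext => t /=; apply/propext.
split=> -[t0 [_ [[b Bb <-] /= bx]]]; split => //.
  exists (0 + t *: b); split; first by exists b.
  by rewrite /= add0r; apply/eqP; rewrite -addr_eq0 addrC; apply/eqP.
by exists (x + t *: b); split; [exists b|rewrite /= -[t *: b]add0r bx subrr].
Qed.

(** The substitution x = - y carries [reflection B] onto the unit body of the gauge and turns the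
    normalised x into - y / g y, the contact direction. The resulting set differs from the cone at
    most by the origin, which is null. *)
Lemma nuE (C : set V) : measurable C -> fine (nu B C) = d%:R * dir_volume B C.
Proof.
move=> mC; rewrite /nu.
pose A := [set y | C (- (g y)^-1 *: y)] `&` [set y | g y <= 1].
have mL := measurable_gauge_le Bcompact Bconvex B0 1.
have mD : measurable (dir_cone B C `&` [set y | g y <= 1]).
  by apply: measurableI => //; exact: measurable_dir_cone.
have mA : measurable A by apply: measurableI => //; exact: measurable_gauge_dir.
have mrA : measurable ((fun v : V => (-1) *: v + 0) @^-1` A).
  exact: measurable_preimage_affine.
have reflE : reflection B = (fun v : V => (-1) *: v + 0) @^-1` [set y | g y <= 1].
  apply/seteqP; split => x /=; rewrite scaleN1r addr0.
    by move=> [b Bb <-]; rewrite opprK; exact/(gauge_le1 Bcompact Bconvex B0).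
  by move=> /(gauge_le1 Bcompact Bconvex B0) Bx; exists (- x); rewrite ?opprK.
have mr : measurable (reflection B) by rewrite reflE; exact: measurable_preimage_affine.
have -> : (\int[Leb]_(x in reflection B) (\1_C ((fine (rel_dist B x [set 0]))^-1 *: x))%:E =
    Leb A)%E.
  rewrite integral_mkcond.
  rewrite (_ : _ \_ _ = fun x => (\1_((fun v : V => (-1) *: v + 0) @^-1` A) x)%:E).
    rewrite integral_indic// setIT.
    have r0 : (-1 : R) != 0 by rewrite oppr_eq0 oner_eq0.
    apply: (eq_trans (lebesgue_rV_affine 0 r0 mA)).
    by rewrite normrN1 expr1n invr1 mul1e.
  apply/funext => x; rewrite patchE rel_dist_origin -/(g (- x)).
  have AE : ((fun v : V => (-1) *: v + 0) @^-1` A) x <->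
      C ((g (- x))^-1 *: x) /\ reflection B x.
    by rewrite reflE /A /= scaleN1r addr0 scalerN scaleNr opprK.
  case: ifPn => [/set_mem rx|/negP rx].
    rewrite !indicE; congr (_ %:R)%:E; congr nat_of_bool.
    by apply/idP/idP => /set_mem => [Cx|/AE[Cx _]]; apply/mem_set => //; apply/AE.
  by rewrite indicE memNset// => /AE[_ rB]; apply: rx; exact/mem_set.
suff -> : Leb A = Leb (dir_cone B C `&` [set y | g y <= 1]).
  rewrite fineM// ge0_fin_numE//.
  by apply: (lebesgue_gauge_le_fin Bcompact Bconvex B0 mD (t := 1)) => y [].
apply/eqP; rewrite eq_le; apply/andP; split; last first.
  by apply: le_measure; [exact/mem_set|exact/mem_set|move=> y [[_ Cy] gy]].
apply: (@le_trans _ _ (Leb ((dir_cone B C `&` [set y | g y <= 1]) `|` [set 0]))).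
  apply: le_measure; first exact/mem_set.
    by apply/mem_set; apply: measurableU => //; exact: measurable_rV1.
  move=> y [Cy gy]; have [->|y0] := eqVneq y 0; first by right.
  by left; split => //; split => //; exact: (gauge_gt0 Bcompact Bconvex B0).
apply: (le_trans (measureU2 _ _ _)) => //; first exact: measurable_rV1.
by rewrite [X in (_ + X)%E](lebesgue_rV1 Bcompact Bconvex B0 d_gt0) adde0.
Qed.

End nu.

Theorem proposition3p6 (R : realType) (d : nat) (hd : (0 < d)%N)
    (disp : measure_display) (T : measurableType disp) (P : probability T R)
    (B : set 'rV[R]_d)
    (Bcompact : compact B) (Bconvex : convex_set B) (B0 : nbhs (0 : 'rV[R]_d) B)
    (lambda : R) (Pi : T -> set 'rV[R]_d) (L : T -> 'rV[R]_d -> set 'rV[R]_d)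
    (L0 N : T -> set 'rV[R]_d)
    (clusterN : poisson_cluster_process P lambda Pi L L0 N)
    (L0_ac : difference_measure P L0 `<< lebesgue_rV d)
    (u0 : 'rV[R]_d) (hu0 : boundary (reflection B) u0)
    (C : set 'rV[R]_d) (mC : measurable C) :
  t ^ (1 - d%:Z) * hazard P N B u0 t C @[t --> +oo] -->
  fine (P [set w | L0 w !=set0]) * lambda * fine (nu B C).
Proof.
case: clusterN => [[lambda_gt0 poissonPi] [mL0 fL0] /andP[_ L0_fin]
  [xi [[mxi xiP] Lxi law_mark indep]] [[mN lN] aeN]].
pose mark n w : @config R d := L w (xi n w).
have mmark n : measurable_fun [set: T] (mark n) := (Lxi n).1.
have fmark n w : finite_set (mark n w) := (Lxi n).2 w.
have NE : {ae P, forall w, N w = \bigcup_n translate (mark n w) (xi n w)}.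
  apply: filterS2 xiP aeN => w [_ PiE] ->; rewrite PiE.
  apply/seteqP; split => [y [_ [n _ <-] Ly]|y [n _ Ly]]; first by exists n.
  by exists (xi n w) => //; exists n.
pose H t E := hit_intensity P B L0 u0 t E.
have H_conc E := hit_intensity_concave hd Bcompact Bconvex B0 u0 mL0 fL0 L0_fin L0_ac (C := E).
have H0 E := hit_intensity0 P hd Bcompact Bconvex B0 u0 fL0 (C := E).
have H_lim := hit_intensity_lim hd Bcompact Bconvex B0 u0 mL0 fL0 L0_fin L0_ac mC.
have dH E t : measurable E -> 0 < t -> h^-1 * (lambda * H (t + h) E - lambda * H t E) @[h --> 0^'+] -->
    lambda * (d%:R * t ^+ d.-1 * right_slope d (H ^~ E) t).
  move=> mE t0.
  have c := right_derivative_concave_in_power hd (H0 E mE)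
    (fun t1 t2 t3 => @H_conc E t1 t2 t3 mE) t0.
  rewrite (_ : (fun h => _) = fun h => lambda * (h^-1 * (H (t + h) E - H t E))).
    by apply: cvgMl_tmp.
  by apply/funext => h; rewrite -mulrBr mulrCA.
have hazardE t : 0 < t ->
    hazard P N B u0 t C = lambda * (d%:R * t ^+ d.-1 * right_slope d (H ^~ C) t).
  move=> t0; rewrite /hazard.
  rewrite (void_probability hd Bcompact Bconvex B0 u0 lambda_gt0 poissonPi mxi xiP
    mmark fmark mL0 fL0 L0_fin law_mark indep mN lN NE (ltW t0)).
  have c : h^-1 * (contact_distribution P N B u0 (t + h) C - contact_distribution P N B u0 t C)
      @[h --> 0^'+] --> expR (- (lambda * H t setT)) *
      (lambda * (d%:R * t ^+ d.-1 * right_slope d (H ^~ C) t)).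
    have dG := dH _ _ measurableT t0.
    have dHC := dH _ _ mC t0.
    apply: (@right_derivative_of_bound _ (fun s => contact_distribution P N B u0 s C)
      (fun s => lambda * H s setT) (fun s => lambda * H s C) _ _ _ dG dHC) => h h0.
    exact: (contact_increment hd Bcompact Bconvex B0 u0 lambda_gt0 poissonPi mxi xiP
      mmark fmark mL0 fL0 L0_fin law_mark indep mN lN NE (ltW t0) h0 mC).
  rewrite /contact_density (cvg_lim _ c)//.
  by rewrite mulrAC divff ?mul1r// gt_eqF// expR_gt0.
have cs : lambda * d%:R * right_slope d (H ^~ C) t @[t --> +oo] -->
    fine (P [set w | L0 w !=set0]) * lambda * fine (nu B C).
  rewrite (nuE hd Bcompact Bconvex B0 mC).
  rewrite (_ : _ * lambda * _ =
    lambda * d%:R * (fine (P [set w | L0 w !=set0]) * dir_volume B C)); last by ring.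
  apply: cvgMl_tmp.
  exact: (right_slope_cvg hd (H0 C mC) (fun t1 t2 t3 => @H_conc C t1 t2 t3 mC) H_lim).
(* [hazardE] holds for t > 0 only, so the limit is transferred by squeezing the hazard between two
   copies of the same function, eventually equal to it. *)
apply: (squeeze_cvgr _ cs cs); near=> t.
have t0 : 0 < t by near: t; exact: nbhs_pinfty_gt.
have te : t ^ (1 - d%:Z) * t ^+ d.-1 = 1.
  rewrite -[t ^+ d.-1]/(t ^ d.-1%:Z) -expfzDr ?gt_eqF//.
  by rewrite (_ : 1 - d%:Z + d.-1%:Z = 0) ?expr0z//; rewrite -{1}(prednK hd) intS opprD addrA subrr add0r addNr.
rewrite hazardE// (_ : _ * (lambda * _) =
  lambda * d%:R * right_slope d (H ^~ C) t * (t ^ (1 - d%:Z) * t ^+ d.-1)); last by ring.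
by rewrite te mulr1 lexx.
Unshelve. all: by end_near. Qed.
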